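(* Let $\mathcal G$ be a universal quantum gate set, i.e. a finite set of elements of $SU(d)$ such that $\langle\mathcal G\rangle$ is dense in $SU(d)$, and suppose that $\mathcal G$ contains the Weyl operators. Then for any $\epsilon>0$ and given any $U\in SU(d)$, there is an efficient classical algorithm that constructs a sequence of gates $V_L\cdots V_1V_0$ with $V_i\in\mathcal G$ and $L=\operatorname{polylog}(1/\epsilon)$ such that $$\|V_L\cdots V_1V_0-U\|\le\epsilon .$$
   Context: $\|\cdot\|$ is the operator norm on $d\times d$ complex matrices, and $\langle\mathcal G\rangle$ is the group generated by $\mathcal G$. The set $\mathcal G$ is not assumed to be closed under inverses. With $\omega=e^{2\pi i/d}$ and $|0\rangle,\dots,|d-1\rangle$ the standard basis of $\mathbb C^d$, let $X|x\rangle=|x+1\bmod d\rangle$ and $Z|x\rangle=\omega^x|x\rangle$; the ($d$-dimensional) Weyl operators are $\sigma_{\boldsymbol a}=Z^{a_1}X^{a_2}$ for $\boldsymbol a=(a_1,a_2)\in\{0,\dots,d-1\}^2$. $\operatorname{polylog}(1/\epsilon)$ denotes a quantity bounded by a polynomial in $\log(1/\epsilon)$. *)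

(* Defs.v *)
From mathcomp Require Import all_boot all_order all_algebra.
From mathcomp Require Import all_classical all_reals all_analysis.
From mathcomp Require Import complex.

Set Implicit Arguments.
Unset Strict Implicit.
Unset Printing Implicit Defensive.

Import Order.TTheory GRing.Theory Num.Theory.

Local Open Scope classical_set_scope.
Local Open Scope ring_scope.
Local Open Scope complex_scope.

Section Gates.
Variables (R : realType) (d : nat).
Local Notation M := 'M[R[i]]_d.

Definition l2norm (v : 'cV[R[i]]_d) : R :=
  Num.sqrt (\sum_i ComplexField.Normc.normc (v i 0) ^+ 2).

Definition opnorm (A : M) : R :=
  sup [set l2norm (A *m v) | v in [set v | l2norm v <= 1]].

Definition in_SU (A : M) : Prop := A \is unitarymx /\ \det A = 1.

Definition omega : R[i] :=
  cos (2 * pi / d%:R) +i* sin (2 * pi / d%:R).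

Definition weylX : M :=
  \matrix_(y, x) (nat_of_ord y == x.+1 %% d)%N%:R.

Definition weylZ : M :=
  \matrix_(y, x) ((y == x)%:R * omega ^+ x).

Definition weyl (a : 'I_d * 'I_d) : M := weylZ ^+ a.1 *m weylX ^+ a.2.

Inductive generated (G : seq M) : M -> Prop :=
| gen_one : generated G 1%:M
| gen_gate A : A \in G -> generated G A
| gen_inv A : generated G A -> generated G (invmx A)
| gen_mul A B : generated G A -> generated G B -> generated G (A *m B).

Definition universal (G : seq M) : Prop :=
  (forall A, A \in G -> in_SU A) /\
  (forall A, in_SU A -> forall e : R, 0 < e ->
    exists2 B, generated G B & opnorm (B - A) < e).

(* Membership is up to a global phase: det X = det Z = (-1)^(d-1), so for even
   d the matrices X and Z are not in SU(d), only suitable unit multiples of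
   them are. *)
Definition contains_weyl (G : seq M) : Prop :=
  forall a : 'I_d * 'I_d, exists2 c : R[i],
    ComplexField.Normc.normc c = 1 & c *: weyl a \in G.

(* [:: k_L; ..; k_0] denotes V_L ... V_0, where V_i is the k_i-th gate. *)
Definition word_mx (G : seq M) (w : seq 'I_(size G)) : M :=
  \big[mulmx/1%:M]_(k <- w) G`_k.

End Gates.

(* Programs of a first-order, call-by-value language of recursive functions on
   binary trees with integer leaves.  Tree operations have unit cost (trees are
   immutable and shared); arithmetic is charged the product of the bit lengths
   of its operands.  This cost is polynomially related to Turing-machine time.
   Real inputs are read through an oracle giving dyadic approximations; asking
   for p bits costs at least p, as for an oracle machine that writes the
   requested precision in unary. *)

Inductive val := VInt of int | VPair of val & val.

Definition truthy (v : val) : bool :=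
  if v is VInt z then 0 < z else true.

Inductive arith := Add | Sub | Mul | Div.

Definition arith_fun (o : arith) (x y : int) : int :=
  match o with
  | Add => x + y
  | Sub => x - y
  | Mul => x * y
  | Div => (x %/ y)%Z
  end.

Definition bits (x : int) : nat := (trunc_log 2 `|x|%N).+1.

(* EVar is a de Bruijn index; ECall f e calls the f-th function of the program
   with one argument; EAsk a p asks the oracle for p bits of the real number
   with address a. *)
Inductive expr :=
| EVar of nat
| EInt of int
| EPair of expr & expr
| EFst of expr
| ESnd of expr
| EArith of arith & expr & expr
| EIf of expr & expr & expr
| ELet of expr & expr
| ECall of nat & expr
| EAsk of expr & expr.

Record program := Program { main : expr; funs : seq expr }.

Definition oracle := val -> nat -> int.

(* eval P O env e v t: in the environment env, the expression e has value v,
   computed at cost t. *)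
Inductive eval (P : program) (O : oracle) :
    seq val -> expr -> val -> nat -> Prop :=
| ev_var env n v : onth env n = Some v -> eval P O env (EVar n) v 1
| ev_int env z : eval P O env (EInt z) (VInt z) 1
| ev_pair env e1 e2 v1 v2 t1 t2 :
    eval P O env e1 v1 t1 -> eval P O env e2 v2 t2 ->
    eval P O env (EPair e1 e2) (VPair v1 v2) (t1 + t2).+1
| ev_fst env e v1 v2 t :
    eval P O env e (VPair v1 v2) t -> eval P O env (EFst e) v1 t.+1
| ev_snd env e v1 v2 t :
    eval P O env e (VPair v1 v2) t -> eval P O env (ESnd e) v2 t.+1
| ev_arith env o e1 e2 x y t1 t2 :
    eval P O env e1 (VInt x) t1 -> eval P O env e2 (VInt y) t2 ->
    eval P O env (EArith o e1 e2) (VInt (arith_fun o x y))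
      (t1 + t2 + bits x * bits y).+1
| ev_if env e0 e1 e2 v0 v t0 t :
    eval P O env e0 v0 t0 ->
    eval P O env (if truthy v0 then e1 else e2) v t ->
    eval P O env (EIf e0 e1 e2) v (t0 + t).+1
| ev_let env e1 e2 v1 v t1 t :
    eval P O env e1 v1 t1 -> eval P O (v1 :: env) e2 v t ->
    eval P O env (ELet e1 e2) v (t1 + t).+1
| ev_call env f e body v1 v t1 t :
    eval P O env e v1 t1 -> onth (funs P) f = Some body ->
    eval P O [:: v1] body v t ->
    eval P O env (ECall f e) v (t1 + t).+1
| ev_ask env e1 e2 a (p : nat) t1 t2 :
    eval P O env e1 a t1 -> eval P O env e2 (VInt p%:Z) t2 ->
    eval P O env (EAsk e1 e2) (VInt (O a p)) (t1 + t2 + p + bits (O a p)).+1.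

Definition runs (P : program) (O : oracle) (v : val) (t : nat) : Prop :=
  eval P O [::] (main P) v t.

Fixpoint vlist (s : seq nat) : val :=
  if s is n :: s' then VPair (VInt n%:Z) (vlist s') else VInt 0.

Definition approximates (R : realType) (O : oracle) (a : val) (x : R) : Prop :=
  forall p : nat, `|x - (O a p)%:~R / 2 ^+ p| <= 2 ^- p.

(* Address [::] holds eps; [:: k; i; j; 0] and [:: k; i; j; 1] hold the real
   and imaginary parts of the (i, j) entry of U if k = 0, of the (k-1)-st gate
   otherwise. *)
Definition presents (R : realType) (d : nat) (G : seq 'M[R[i]]_d)
    (O : oracle) (eps : R) (U : 'M[R[i]]_d) : Prop :=
  approximates O (vlist [::]) eps /\
  forall (k : 'I_(size G).+1) (i j : 'I_d),
    approximates O (vlist [:: k : nat; i : nat; j : nat; 0%N])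
      (complex.Re ((U :: G)`_k i j)) /\
    approximates O (vlist [:: k : nat; i : nat; j : nat; 1%N])
      (complex.Im ((U :: G)`_k i j)).

(* Main.v *)
(* A Solovay-Kitaev recursion that uses neither inverse gates nor a logarithm.
   Suppose that U' approximates U with error y^2, so that U U'^* = 1 + E with
   E = O(y^2).  For a family A_j of su(d) satisfying the Casimir identity
     sum_j [A_j, [A_j, K]] = c (tr K - d K),
   the coefficients c_j(E), proportional to [A_j, E - E^*], satisfy
   sum_j [A_j, c_j(E)] = E + O(y^4), so the product over j of the group commutators
   of exp (y A_j) and exp (y^-1 c_j(E)) is 1 + E + O(y^3).  All four factors lie at
   distance O(y) from 1 and are needed with error O(y^2) only, so they can be
   produced by recursive calls.

   The inverse of a word v is not available as a word, but a recursive call yields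
   v' with v' v = P = 1 + F and F = O(y^2).  The conjugates of F by all Weyl operators
   add up to d (tr F) 1, and tr F = O(y^4) because det P = 1; hence the product of
   the conjugates of P by the nontrivial Weyl operators is P^-1 up to O(y^4).  The
   inverse of a Weyl gate is one of its powers.

   A level-k call has error O(2^-k) and makes boundedly many calls of level at most
   3k/4; both the length of the word and the running time are therefore polynomial
   in k.  The levels below a constant are served by a finite net, searched
   exhaustively.  All matrices are computed in fixed-point arithmetic with O(k) bits. *)

Require Import Defs.
From HB Require Import structures.
From mathcomp Require Import all_boot all_order all_algebra fingroup perm.
From mathcomp Require Import all_classical all_reals all_analysis.
From mathcomp Require Import complex ring lra zify.
From Stdlib Require Ncring Ncring_tac.

Set Implicit Arguments.
Unset Strict Implicit.
Unset Printing Implicit Defensive.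

Import Order.TTheory GRing.Theory Num.Theory.
Local Open Scope ring_scope.
Local Open Scope sesquilinear_scope.

(** The constant in the error O(2^-k) has to be the same for the input and the output of a level.
    The inaccuracy of the recursive calls enters only the y^3 term, which beats 2^-k by a power of
    2^k and so absorbs any constant; what remains is the rounding of E, whose constant depends on d
    alone. Hence E must be known far better than the accuracy of the call that produced U'. A call
    therefore returns, along with its word, a fixed-point matrix of that very word, whose error is
    governed by the working precision and not by the level. Each level multiplies this error by a
    constant, so a precision linear in the top level suffices.

    The inputs of the recursive calls are second-order Taylor polynomials of exponentials and not
    unitary; a Cayley transform provides a special unitary target near each of them.

    Running time is treated in two layers: a judgement without costs for one function body, in which
    calls have a given time budget, and a bound for the cost by a number computed from the
    expression. *)

Section NcRing.
Variable T : pzRingType.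
(** These instances let the normalizer for noncommutative rings act on square matrices. *)
#[local] Instance pzring_ops :
  @Ncring.Ring_ops T 0 1 +%R *%R (fun x y => x - y) (@GRing.opp T) eq := {}.
#[local] Instance pzring_ring : Ncring.Ring (Ro := pzring_ops).
Proof.
constructor; try typeclasses eauto; try (repeat intro; subst; done).
- exact: add0r.
- exact: addrC.
- exact: addrA.
- exact: mul1r.
- exact: mulr1.
- exact: mulrA.
- exact: mulrDl.
- by move=> *; exact: mulrDr.
- by move=> *; exact: subrr.
Qed.
End NcRing.
#[local] Existing Instance pzring_ops.
#[local] Existing Instance pzring_ring.

(* Instance search is syntactic in the carrier, so complex matrices need instances
   of their own. *)
#[local] Instance cmx_ops (R : realType) d :
  @Ncring.Ring_ops 'M[R[i]]_d _ _ _ _ _ _ eq := pzring_ops 'M[R[i]]_d.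
#[local] Instance cmx_ring (R : realType) d : Ncring.Ring (Ro := cmx_ops R d) :=
  pzring_ring 'M[R[i]]_d.

Local Notation nc := ComplexField.Normc.normc.

(** * The entrywise norm and special unitary matrices *)

Section ComplexModulus.
Variable R : realType.
Implicit Types x y : R[i].

Lemma nc_norm x : (nc x)%:C%C = `|x|.
Proof. by []. Qed.

Lemma nc_ge0 x : 0 <= nc x.
Proof. by rewrite -lecR nc_norm normr_ge0. Qed.

Lemma nc0 : nc (0 : R[i]) = 0.
Proof. exact: ComplexField.Normc.normc0. Qed.

Lemma nc1 : nc (1 : R[i]) = 1.
Proof. exact: ComplexField.Normc.normc1. Qed.

Lemma ncM x y : nc (x * y) = nc x * nc y.
Proof. exact: ComplexField.Normc.normcM. Qed.

Lemma ncX x n : nc (x ^+ n) = nc x ^+ n.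
Proof. by elim: n => [|n IH]; rewrite ?expr0 ?nc1 // !exprS ncM IH. Qed.

Lemma ncV x : nc x^-1 = (nc x)^-1.
Proof. exact: ComplexField.Normc.normcV. Qed.

Lemma ncN x : nc (- x) = nc x.
Proof. exact: normcN. Qed.

Lemma ncD x y : nc (x + y) <= nc x + nc y.
Proof. exact: le_normcD. Qed.

Lemma nc_conj x : nc x^* = nc x.
Proof. by apply: complexI; rewrite !nc_norm norm_conjC. Qed.

Lemma nc_real (x : R) : nc x%:C%C = `|x|.
Proof. by rewrite /= expr0n /= addr0 sqrtr_sqr. Qed.

Lemma nc_nat n : nc (n%:R : R[i]) = n%:R.
Proof. by apply: complexI; rewrite nc_norm normr_nat rmorph_nat. Qed.

Lemma nc_Re x : `|complex.Re x| <= nc x.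
Proof. by case: x => a b /=; rewrite -sqrtr_sqr ler_wsqrtr // lerDl sqr_ge0. Qed.

Lemma nc_Im x : `|complex.Im x| <= nc x.
Proof. by case: x => a b /=; rewrite -sqrtr_sqr ler_wsqrtr // lerDr sqr_ge0. Qed.

Lemma nc_sqr x : nc x ^+ 2 = complex.Re x ^+ 2 + complex.Im x ^+ 2.
Proof. by case: x => a b /=; rewrite sqr_sqrtr // addr_ge0 ?sqr_ge0. Qed.

Lemma nc_ReIm x : nc x <= `|complex.Re x| + `|complex.Im x|.
Proof.
rewrite -(@ler_pXn2r _ 2) ?nnegrE ?addr_ge0 ?nc_ge0 //.
rewrite nc_sqr sqrrD !real_normK ?num_real //.
by rewrite lerD2r lerDl mulrn_wge0 // mulr_ge0.
Qed.

Lemma nc_eq0 x : (nc x == 0) = (x == 0).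
Proof.
apply/eqP/eqP => [/ComplexField.Normc.eq0_normc //|->]; exact: nc0.
Qed.

Lemma nc_sum (I : Type) (r : seq I) (P : pred I) (F : I -> R[i]) :
  nc (\sum_(i <- r | P i) F i) <= \sum_(i <- r | P i) nc (F i).
Proof.
elim/big_rec2: _ => [|i y x _ H]; first by rewrite nc0.
by apply: le_trans (ncD _ _) _; rewrite lerD2l.
Qed.

Lemma Re_sum (I : Type) (r : seq I) (P : pred I) (F : I -> R[i]) :
  complex.Re (\sum_(i <- r | P i) F i) = \sum_(i <- r | P i) complex.Re (F i).
Proof. by elim/big_rec2: _ => // i y [u v] _ <-; case: (F i). Qed.

Lemma nc_prod (I : Type) (r : seq I) (P : pred I) (F : I -> R[i]) :
  nc (\prod_(i <- r | P i) F i) = \prod_(i <- r | P i) nc (F i).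
Proof. by elim/big_rec2: _ => [|i y x _ H]; rewrite ?nc1 // ncM H. Qed.

End ComplexModulus.

Section MatrixNorm.
Variables (R : realType) (d : nat).
Local Notation M := 'M[R[i]]_d.
Implicit Types A B U : M.

(** The entrywise l1 norm is submultiplicative, invariant under adjoints and equivalent to the
    operator norm up to d^2. All estimates use it; [opnorm] enters only through the density
    hypothesis and the final bound. *)
Definition mxn A : R := \sum_i \sum_j nc (A i j).
Definition adj A : M := A^t*.

Lemma adjE A i j : adj A i j = (A j i)^*.
Proof. by rewrite !mxE. Qed.

Lemma adjK A : adj (adj A) = A.
Proof. exact: trmxCK. Qed.

Lemma adjD A B : adj (A + B) = adj A + adj B.
Proof. by rewrite /adj linearD /= map_mxD. Qed.

Lemma adjN A : adj (- A) = - adj A.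
Proof. by rewrite /adj linearN /= map_mxN. Qed.

Lemma adjB A B : adj (A - B) = adj A - adj B.
Proof. by rewrite adjD adjN. Qed.

Lemma adjM A B : adj (A * B) = adj B * adj A.
Proof. by rewrite /adj trmx_mul map_mxM. Qed.

Lemma adj1 : adj 1 = 1.
Proof. by rewrite /adj trmx1 map_mx1. Qed.

Lemma adjZ c A : adj (c *: A) = c^* *: adj A.
Proof. by rewrite /adj linearZ /= map_mxZ. Qed.

Lemma det_adj A : \det (adj A) = (\det A)^*.
Proof. by rewrite /adj det_map_mx det_tr. Qed.

Lemma tr_adj A : \tr (adj A) = (\tr A)^*.
Proof. by rewrite /mxtrace rmorph_sum; apply: eq_bigr => i _; rewrite adjE. Qed.

Lemma mxn_ge0 A : 0 <= mxn A.
Proof. by apply: sumr_ge0 => i _; apply: sumr_ge0 => j _; exact: nc_ge0. Qed.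

Lemma mxn0 : mxn 0 = 0.
Proof. by rewrite /mxn big1 // => i _; rewrite big1 // => j _; rewrite mxE nc0. Qed.

Lemma mxnN A : mxn (- A) = mxn A.
Proof. by apply: eq_bigr => i _; apply: eq_bigr => j _; rewrite mxE ncN. Qed.

Lemma mxnD A B : mxn (A + B) <= mxn A + mxn B.
Proof.
rewrite /mxn -big_split; apply: ler_sum => i _ /=; rewrite -big_split /=.
by apply: ler_sum => j _; rewrite mxE ncD.
Qed.

Lemma mxnB A B : mxn (A - B) <= mxn A + mxn B.
Proof. by rewrite -(mxnN B) mxnD. Qed.

Lemma mxn_dist A B : mxn (A - B) = mxn (B - A).
Proof. by rewrite -mxnN opprB. Qed.

Lemma mxn_tri B A C : mxn (A - C) <= mxn (A - B) + mxn (B - C).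
Proof. by rewrite -[A - C](subrKA B) mxnD. Qed.

Lemma mxnZ c A : mxn (c *: A) = nc c * mxn A.
Proof.
rewrite /mxn mulr_sumr; apply: eq_bigr => i _; rewrite mulr_sumr.
by apply: eq_bigr => j _; rewrite mxE ncM.
Qed.

Lemma mxn_row A i : \sum_j nc (A i j) <= mxn A.
Proof.
rewrite /mxn [leRHS](bigD1 i) //= lerDl sumr_ge0 // => k _.
by apply: sumr_ge0 => l _; exact: nc_ge0.
Qed.

Lemma mxn_entry A i j : nc (A i j) <= mxn A.
Proof.
apply: le_trans (mxn_row A i); rewrite [leRHS](bigD1 j) //= lerDl sumr_ge0 // => k _.
exact: nc_ge0.
Qed.

Lemma mxnM A B : mxn (A * B) <= mxn A * mxn B.
Proof.
rewrite [in leRHS]/mxn mulr_suml; apply: ler_sum => i _.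
apply: (@le_trans _ _ (\sum_j \sum_k nc (A i k) * nc (B k j))).
  apply: ler_sum => j _; rewrite mxE; apply: le_trans (nc_sum _ _ _) _.
  by apply: ler_sum => k _; rewrite ncM.
rewrite exchange_big /= mulr_suml; apply: ler_sum => k _.
by rewrite -mulr_sumr ler_wpM2l ?nc_ge0 ?mxn_row.
Qed.

Lemma mxn_adj A : mxn (adj A) = mxn A.
Proof.
rewrite /mxn exchange_big; apply: eq_bigr => i _; apply: eq_bigr => j _.
by rewrite adjE nc_conj.
Qed.

Lemma nc_tr A : nc (\tr A) <= mxn A.
Proof.
apply: le_trans (nc_sum _ _ _) _; apply: ler_sum => i _.
by rewrite [leRHS](bigD1 i) //= lerDl sumr_ge0 // => j _; exact: nc_ge0.
Qed.

Lemma mxn_le_entries A (c : R) : (forall i j, nc (A i j) <= c) -> mxn A <= (d ^ 2)%:R * c.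
Proof.
move=> H; apply: (@le_trans _ _ (\sum_(i < d) \sum_(j < d) c)).
  by apply: ler_sum => i _; apply: ler_sum.
by rewrite !sumr_const !card_ord -mulrnA mulnn mulr_natl.
Qed.

Lemma mxn1 : mxn (1 : M) = d%:R.
Proof.
rewrite /mxn -[in RHS](card_ord d) -sumr_const; apply: eq_bigr => i _.
rewrite (bigD1 i) //= mxE eqxx nc1 big1 ?addr0 // => j ji.
by rewrite mxE eq_sym (negbTE ji) nc0.
Qed.

Lemma unitary_mulVr U : U \is unitarymx -> U * adj U = 1.
Proof. by move/unitarymxP. Qed.

Lemma unitary_mulVl U : U \is unitarymx -> adj U * U = 1.
Proof. by rewrite -trmxC_unitary => /unitarymxP; rewrite trmxCK. Qed.

(** The diagonal of [U * adj U] says that the squared moduli in each row add up to 1. *)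
Lemma unitary_entry U i j : U \is unitarymx -> nc (U i j) <= 1.
Proof.
move=> /unitary_mulVr hU.
rewrite -(@ler_pXn2r _ 2) ?nnegrE ?nc_ge0 // expr1n.
have /(congr1 (@complex.Re R)) : (U * adj U) i i = 1 by rewrite hU mxE eqxx.
rewrite mxE Re_sum (bigD1 j) //= => <-.
have E k : complex.Re (U i k * adj U k i) = nc (U i k) ^+ 2.
  rewrite adjE; have := sqr_normc (U i k); rewrite -nc_norm => /(congr1 (@complex.Re R)).
  by rewrite -rmorphXn /= => ->.
by rewrite E lerDl sumr_ge0 // => k _; rewrite E sqr_ge0.
Qed.

Lemma mxn_unitary U : U \is unitarymx -> mxn U <= (d ^ 2)%:R.
Proof. by move=> hU; rewrite -[leRHS]mulr1; apply: mxn_le_entries => i j; exact: unitary_entry. Qed.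

End MatrixNorm.

Section SpecialUnitary.
Variables (R : realType) (d : nat).
Local Notation M := 'M[R[i]]_d.
Implicit Types U V : M.

Lemma SU1 : in_SU (1 : M).
Proof. by split; [apply/unitarymxP; rewrite trmx1 map_mx1 mulmx1 | exact: det1]. Qed.

Lemma SUM U V : in_SU U -> in_SU V -> in_SU (U * V).
Proof.
move=> [hU dU] [hV dV]; rewrite -[U * V]/(U *m V).
split; first by apply: mul_unitarymx hU hV.
by rewrite det_mulmx dU dV mulr1.
Qed.

Lemma SU_adj U : in_SU U -> in_SU (adj U).
Proof. by move=> [hU dU]; split; [rewrite trmxC_unitary | rewrite det_adj dU conjC1]. Qed.

Lemma SU_mulVr U : in_SU U -> U * adj U = 1.
Proof. by case=> /unitary_mulVr. Qed.

Lemma SU_mulVl U : in_SU U -> adj U * U = 1.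
Proof. by case=> /unitary_mulVl. Qed.

Lemma SUX U n : in_SU U -> in_SU (U ^+ n).
Proof.
by move=> hU; elim: n => [|n IH]; [exact: SU1 | rewrite exprS; exact: SUM].
Qed.

Lemma mxn_SU U : in_SU U -> mxn U <= (d ^ 2)%:R.
Proof. by case=> /mxn_unitary. Qed.

End SpecialUnitary.

Ltac ncring :=
  lazymatch goal with |- @eq ?T ?a ?b =>
    let T' := eval hnf in T in change (@eq T' a b) end;
  Ncring_tac.non_commutative_ring.

(** * Order estimates that are uniform over a family *)

Section BigO.
Variables (R : realType) (d : nat) (I : Type) (y : I -> R).
Hypothesis y01 : forall i, 0 < y i <= 1.
Local Notation M := 'M[R[i]]_d.
Implicit Types X Y : I -> M.

(* X i = O(y i ^ n), uniformly in i; the index carries a whole configuration of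
   the algorithm. *)
Definition bO (n : nat) X := exists C, forall i, mxn (X i) <= C * y i ^+ n.

Let y_gt0 i : 0 < y i. Proof. by case/andP: (y01 i). Qed.
Let y_le1 i : y i <= 1. Proof. by case/andP: (y01 i). Qed.
Let yX_ge0 i n : 0 <= y i ^+ n. Proof. by rewrite exprn_ge0 // ltW. Qed.

Lemma bO_pos n X : bO n X ->
  exists2 C, 0 <= C & forall i, mxn (X i) <= C * y i ^+ n.
Proof.
case=> C H; exists (Num.max C 0); first by rewrite le_max lexx orbT.
move=> i; apply: le_trans (H i) _; rewrite ler_wpM2r // le_max lexx //.
Qed.

Lemma bO_ext n X Y : (forall i, X i = Y i) -> bO n X -> bO n Y.
Proof. by move=> E [C H]; exists C => i; rewrite -E. Qed.

Lemma bO_weak m n X : (m <= n)%N -> bO n X -> bO m X.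
Proof.
move=> mn /bO_pos[C C0 H]; exists C => i; apply: le_trans (H i) _.
rewrite ler_wpM2l // -(subnKC mn) exprD ler_piMr // exprn_ile1 //.
exact: ltW.
Qed.

Lemma bO_add n X Y : bO n X -> bO n Y -> bO n (fun i => X i + Y i).
Proof.
move=> [C H] [C' H']; exists (C + C') => i; apply: le_trans (mxnD _ _) _.
by rewrite mulrDl lerD.
Qed.

Lemma bO_opp n X : bO n X -> bO n (fun i => - X i).
Proof. by move=> [C H]; exists C => i; rewrite mxnN. Qed.

Lemma bO_sub n X Y : bO n X -> bO n Y -> bO n (fun i => X i - Y i).
Proof. by move=> hX /bO_opp; exact: bO_add. Qed.

Lemma bO_mul m n X Y : bO m X -> bO n Y -> bO (m + n) (fun i => X i * Y i).
Proof.
move=> [C H] [C' H']; exists (C * C') => i; apply: le_trans (mxnM _ _) _.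
by rewrite exprD mulrACA ler_pM ?mxn_ge0.
Qed.

Lemma bO_adj n X : bO n X -> bO n (fun i => adj (X i)).
Proof. by move=> [C H]; exists C => i; rewrite mxn_adj. Qed.

Lemma bO_scale n c X : bO n X -> bO n (fun i => c *: X i).
Proof.
move=> [C H]; exists (nc c * C) => i; rewrite mxnZ -mulrA.
by rewrite ler_wpM2l ?nc_ge0.
Qed.

Lemma bO_scaley n X : bO n X -> bO n.+1 (fun i => (y i)%:C%C *: X i).
Proof.
move=> [C H]; exists C => i; rewrite mxnZ nc_real gtr0_norm //.
by rewrite exprS mulrCA ler_wpM2l // ltW.
Qed.

Lemma bO_divy n X : bO n.+1 X -> bO n (fun i => (y i)^-1%:C%C *: X i).
Proof.
move=> [C H]; exists C => i; rewrite mxnZ nc_real gtr0_norm ?invr_gt0 //.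
by rewrite mulrC ler_pdivrMr // -mulrA -exprSr.
Qed.

Lemma bO_const (A : M) : bO 0 (fun=> A).
Proof. by exists (mxn A) => i; rewrite expr0 mulr1. Qed.

Lemma bO_SU X : (forall i, in_SU (X i)) -> bO 0 X.
Proof. by move=> H; exists (d ^ 2)%:R => i; rewrite expr0 mulr1 mxn_SU. Qed.

Lemma bO_zero n : bO n (fun=> 0).
Proof. by exists 0 => i; rewrite mxn0 mul0r. Qed.

Lemma bO_sum (J : Type) (r : seq J) n (X : J -> I -> M) :
  (forall j, bO n (X j)) -> bO n (fun i => \sum_(j <- r) X j i).
Proof.
move=> H; elim: r => [|j r IH].
  by apply: bO_ext (bO_zero n) => i; rewrite big_nil.
by apply: bO_ext (bO_add (H j) IH) => i; rewrite big_cons.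
Qed.

Lemma bO_prod (J : Type) (r : seq J) n (X : J -> I -> M) :
  (forall j, bO n (X j)) ->
  bO (n + n) (fun i => \prod_(j <- r) (1 + X j i) - 1 - \sum_(j <- r) X j i).
Proof.
move=> H; elim: r => [|j r IH].
  by apply: bO_ext (bO_zero _) => i; rewrite !big_nil !subrr.
have hS : bO n (fun i => \sum_(j <- r) X j i) by exact: bO_sum.
have h1 : bO (n + n) (fun i => X j i * (\prod_(j <- r) (1 + X j i) - 1 -
    \sum_(j <- r) X j i)).
  by apply: (@bO_weak _ (n + (n + n))); [lia | exact: bO_mul].
have h2 := bO_mul (H j) hS.
apply: bO_ext (bO_add IH (bO_add h1 h2)) => i; rewrite !big_cons.
set P : M := \prod_(_ <- _) _; set S : M := \sum_(_ <- _) _; set x : M := X j i.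
ncring.
Qed.

End BigO.

(** * Exponentials up to third order *)

Section DetExpansion.
Variables (R : realType) (d : nat).
Local Notation M := 'M[R[i]]_d.
Implicit Types (A : M) (J : {set 'I_d}).

(** The part of the Leibniz expansion of det (1 + A) in which the rows in J are taken from A and the
    others from the identity. It is the principal minor of A on J, homogeneous of degree [#|J|]. *)
Definition det_part A J : R[i] :=
  \sum_(s : 'S_d) (-1) ^+ s *
    \prod_i (if i \in J then A i (s i) else (i == s i)%:R).

Lemma det1D A : \det (1 + A) = \sum_J det_part A J.
Proof.
rewrite exchange_big; apply: eq_bigr => s _ /=; rewrite -mulr_sumr; congr (_ * _).
under eq_bigr => i _ do rewrite !mxE addrC.
by rewrite bigA_distr /=; apply: eq_bigr => J _.
Qed.

Lemma det_part0 A : det_part A finset.set0 = 1.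
Proof.
rewrite -(det1 _ d); apply: eq_bigr => s _; congr (_ * _).
by apply: eq_bigr => i _; rewrite inE mxE.
Qed.

(** A permutation that fixes every point other than j also fixes j, so only the identity
    contributes. *)
Lemma det_part1 A j : det_part A [set j]%SET = A j j.
Proof.
rewrite /det_part (bigD1 1%g) //= odd_perm1 expr0 mul1r.
rewrite (bigD1 j) //= inE eqxx perm1 big1 ?mulr1 => [|i ij]; last first.
  by rewrite inE (negbTE ij) perm1 eqxx.
rewrite big1 ?addr0 // => s s1; suff [i ij si] : exists2 i, i != j & s i != i.
  by rewrite (bigD1 i) //= inE (negbTE ij) eq_sym (negbTE si) mul0r mulr0.
apply/exists_inP; apply: contraNT s1 => /exists_inPn H; apply/eqP/permP => k.
rewrite perm1; have fix_ i : i != j -> s i = i by move=> /H; rewrite negbK => /eqP.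
have [->|/fix_ //] := eqVneq k j; apply/eqP; apply: contraT => sj.
by have := fix_ _ sj => /perm_inj sj'; rewrite sj' eqxx in sj.
Qed.

Lemma det_partN A J : det_part (- A) J = (-1) ^+ #|J| * det_part A J.
Proof.
rewrite /det_part mulr_sumr; apply: eq_bigr => s _; rewrite mulrCA; congr (_ * _).
rewrite -prodr_const [in RHS]big_mkcond -big_split /=; apply: eq_bigr => i _.
by case: ifP => _; rewrite ?mxE ?mulN1r ?mul1r.
Qed.

Lemma det_part_le A J : nc (det_part A J) <= #|{: 'S_d}|%:R * mxn A ^+ #|J|.
Proof.
apply: le_trans (nc_sum _ _ _) _; rewrite mulr_natl -sumr_const.
apply: ler_sum => s _; rewrite ncM ncX ncN nc1 expr1n mul1r nc_prod.
rewrite -prodr_const [leRHS]big_mkcond; apply: ler_prod => i _.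
rewrite nc_ge0 /=; case: ifP => _; first exact: mxn_entry.
by rewrite nc_nat lern1 leq_b1.
Qed.

Let split_det (f : {set 'I_d} -> R[i]) :
  \sum_J f J = f finset.set0 + \sum_j f [set j]%SET + \sum_(J : {set 'I_d} | (2 <= #|J|)%N) f J.
Proof.
rewrite (bigD1 finset.set0) //= -addrA; congr (_ + _).
rewrite (bigID (fun J : {set 'I_d} => #|J| == 1%N)) /=; congr (_ + _).
  rewrite (eq_bigl (fun J => J \in [set [set j]%SET | j : 'I_d])); last first.
    move=> J; apply/andP/imsetP => [[_ /cards1P[j ->]]|[j _ ->]]; first by exists j.
    by rewrite cards1 -card_gt0 cards1.
  by rewrite big_imset //= => i j _ _; exact: finset.set1_inj.
by apply: eq_bigl => J; rewrite -card_gt0; case: #|J| => [|[]].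
Qed.

Lemma det1D_split A : \det (1 + A) =
  1 + \tr A + \sum_(J : {set 'I_d} | (2 <= #|J|)%N) det_part A J.
Proof.
by rewrite det1D split_det det_part0; under eq_bigr do rewrite det_part1.
Qed.

(** The factor 2 is there for [det1D_odd], where each minor occurs once for A and once for -A. *)
Definition detC : R :=
  \sum_(J : {set 'I_d} | (2 <= #|J|)%N) 2 * #|{: 'S_d}|%:R.

Lemma detC_ge0 : 0 <= detC.
Proof. by apply: sumr_ge0 => J _; rewrite mulr_ge0. Qed.

Lemma det1D_tr A : mxn A <= 1 ->
  nc (\det (1 + A) - 1 - \tr A) <= detC * mxn A ^+ 2.
Proof.
move=> A1; rewrite det1D_split.
have E (y z : R[i]) : 1 + y + z - 1 - y = z by ring.
rewrite E mulr_suml; apply: le_trans (nc_sum _ _ _) _; apply: ler_sum => J J2.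
apply: le_trans (det_part_le _ _) _; apply: ler_pM; rewrite ?exprn_ge0 ?mxn_ge0 //.
  by rewrite ler_peMl // ler1n.
by apply: ler_wiXn2l => //; exact: mxn_ge0.
Qed.

(* Terms of even degree cancel in the difference, and the linear one is the trace. *)
Lemma det1D_odd A : mxn A <= 1 -> \tr A = 0 ->
  nc (\det (1 + A) - \det (1 - A)) <= detC * mxn A ^+ 3.
Proof.
move=> A1 trA; rewrite !det1D_split [\tr (- A)]linearN /= trA oppr0 addr0.
have E (y z : R[i]) : 1 + y - (1 + z) = y - z by ring.
rewrite E -sumrB mulr_suml; apply: le_trans (nc_sum _ _ _) _.
apply: ler_sum => J; rewrite leq_eqVlt => /orP[/eqP J2|J3].
  rewrite det_partN -J2 sqrrN expr1n mul1r subrr nc0.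
  by rewrite !mulr_ge0 ?exprn_ge0 ?mxn_ge0.
apply: (@le_trans _ _ (2 * nc (det_part A J))).
  rewrite (le_trans (ncD _ _)) // ncN det_partN ncM ncX ncN nc1 expr1n mul1r.
  by rewrite mulr_natl.
rewrite -mulrA ler_wpM2l //; apply: le_trans (det_part_le _ _) _.
by rewrite ler_wpM2l // ler_wiXn2l // mxn_ge0.
Qed.
End DetExpansion.

Section Cayley.
Variables (R : realType) (d : nat).
Hypothesis d_gt0 : (0 < d)%N.
Local Notation M := 'M[R[i]]_d.

Definition near_exp (X : M) : M := 1 + X + (2^-1 : R[i]) *: (X * X).

(** Only the first row is multiplied by the conjugate of the determinant. This avoids a d-th root
    and moves the matrix by a multiple of |det V0 - 1|. *)
Lemma unitary_phase (V0 : M) : V0 \is unitarymx ->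
  exists2 V : M, in_SU V & mxn (V - V0) <= nc (\det V0 - 1) * (d ^ 2)%:R.
Proof.
move=> hV0; have /unitary_mulVr uV0 := hV0.
pose i0 := Ordinal d_gt0; pose c := (\det V0)^*.
have cc : c * c^* = 1.
  by rewrite /c conjCK -det_adj -[RHS](det1 _ d) -[1%:M]uV0 -[V0 * _]/(V0 *m _) det_mulmx mulrC.
pose r : 'rV[R[i]]_d := \row_j if j == i0 then c else 1.
have adjr : adj (diag_mx r) = diag_mx (\row_j if j == i0 then c^* else 1).
  apply/matrixP => i j; rewrite adjE !mxE [j == i]eq_sym.
  case: (eqVneq i j) => [->|_]; last by rewrite !mulr0n conjC0.
  by rewrite !mulr1n; case: ifP; rewrite ?conjC1.
have Dunit : diag_mx r \is unitarymx.
  apply/unitarymxP; rewrite -/(adj (diag_mx r)) adjr mulmx_diag.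
  apply/matrixP => i j; rewrite !mxE; case: (eqVneq i j) => [->|_]; last by rewrite mulr0n.
  by rewrite mulr1n; case: ifP => _; rewrite ?cc ?mulr1.
exists (diag_mx r *m V0).
  split; first by apply: mul_unitarymx Dunit hV0.
  rewrite det_mulmx det_diag (bigD1 i0) //= big1 => [|j ji]; last first.
    by rewrite mxE (negbTE ji).
  by rewrite mxE eqxx mulr1 -[\det V0]conjCK.
have -> : diag_mx r *m V0 - V0 = (diag_mx r - 1) * V0.
  by rewrite mulrBl mul1r.
apply: le_trans (mxnM _ _) _; apply: ler_pM; rewrite ?mxn_ge0 ?mxn_unitary //.
rewrite /mxn (bigD1 i0) //= [X in _ + X]big1 => [|i ii0]; last first.
  rewrite big1 // => j _; rewrite !mxE (negbTE ii0).
  by case: (i == j); rewrite ?subrr ?mulr0n ?subr0 ?nc0.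
rewrite addr0 (bigD1 i0) //= big1 ?addr0 => [|j ji]; last first.
  by rewrite !mxE [i0 == j]eq_sym (negbTE ji) subr0 mulr0n nc0.
have -> : (diag_mx r - 1) i0 i0 = (\det V0 - 1)^*.
  by rewrite [RHS]rmorphB rmorph1 !mxE !eqxx !mulr1n.
by rewrite nc_conj.
Qed.

(** The adjoint of A B^-1 is A^-1 B, and A commutes with B^-1. *)
Lemma cayley_unitary (A B : M) : A *m B = B *m A -> adj B = A ->
  B \in unitmx -> A *m invmx B \is unitarymx.
Proof.
move=> AB adjB_ uB; have uA : A \in unitmx.
  by rewrite unitmxE unitfE -adjB_ det_adj conjC_eq0 -unitfE -unitmxE.
have E : A *m invmx B = invmx B *m A.
  by rewrite -[LHS](mulKmx uB) [B *m _]mulmxA -AB mulmxK.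
have adjI : adj (invmx B) = invmx A by rewrite /adj trmx_inv map_invmx -/(adj _) adjB_.
apply/unitarymxP; rewrite -/(adj (A *m invmx B)) [adj _]adjM adjI -adjB_ adjK adjB_.
by rewrite -[invmx A * B]/(invmx A *m B) E mulmxA mulmxK // mulVmx.
Qed.

Lemma det_cayley (A B : M) : \det B != 0 ->
  \det (A *m invmx B) - 1 = (\det A - \det B) / \det B.
Proof. by move=> dB0; rewrite det_mulmx det_inv mulrBl divff. Qed.

(* The Cayley transform of X / 2 is unitary and agrees with near_exp X to second
   order; its determinant is 1 up to third order, which a phase corrects. *)
Lemma near_exp_SU : exists rho C : R, 0 < rho /\
  forall X : M, adj X = - X -> \tr X = 0 -> mxn X <= rho ->
    exists2 V : M, in_SU V & mxn (V - near_exp X) <= C * mxn X ^+ 3.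
Proof.
pose c := detC R d; have c0 : 0 <= c by exact: detC_ge0.
pose D : R := (d ^ 2)%:R; have D0 : 0 <= D by [].
(* This radius keeps |det (1 - H)| at least 1/2 for H = X / 2. The summands of the constant come
   from the phase correction and from the exact remainder (1 + V0) H^3. *)
exists (2 * (c + 1))^-1, (2 * c * D + (d%:R + D)); split.
  by rewrite invr_gt0; lra.
move=> X adjX trX Xrho; have X0 := mxn_ge0 X.
have X1 : 2 * (c + 1) * mxn X <= 1.
  by rewrite mulrC -ler_pdivlMr ?mul1r //; lra.
pose H := (2^-1 : R[i]) *: X.
have adjH : adj H = - H by rewrite adjZ adjX scalerN fmorphV rmorph_nat.
have trH : \tr H = 0 by rewrite linearZ /= trX mulr0.
have NH : mxn H = mxn X / 2 by rewrite mxnZ ncV nc_nat mulrC.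
have XH : X = H + H.
  have hh : 2^-1 + 2^-1 = 1 :> R[i] by rewrite [RHS](splitr 1) !mul1r.
  by rewrite -scalerDl hh scale1r.
have NH1 : mxn H <= 1 by rewrite NH; nra.
have dB : 2^-1 <= nc (\det (1 - H)).
  have := @det1D_tr _ _ (- H); rewrite mxnN [\tr _]linearN /= trH oppr0 subr0.
  move=> /(_ NH1) h; have := ncD (\det (1 - H)) (- (\det (1 - H) - 1)).
  rewrite ncN opprB addrC subrK nc1 => h2.
  have : detC R d * mxn H ^+ 2 <= 2^-1 by rewrite -/c NH expr2; nra.
  by lra.
have dB0 : \det (1 - H) != 0 by rewrite -nc_eq0 gt_eqF //; lra.
have uB : (1 - H : M) \in unitmx by rewrite unitmxE unitfE.
have adjB_ : adj (1 - H) = 1 + H by rewrite adjB adj1 adjH opprK.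
have AB : (1 + H) * (1 - H) = (1 - H) * (1 + H) by ncring.
pose V0 : M := (1 + H) *m invmx (1 - H).
have V0B : V0 * (1 - H) = 1 + H by exact: mulmxKV.
have V0u : V0 \is unitarymx by apply: cayley_unitary.
have [V hV NV] := unitary_phase V0u; exists V => //.
apply: le_trans (mxn_tri V0 _ _) _.
rewrite mulrDl; apply: lerD.
  apply: le_trans NV _; rewrite -/D mulrAC ler_wpM2r //.
  have -> : \det V0 - 1 = (\det (1 + H) - \det (1 - H)) / \det (1 - H).
    by apply: det_cayley.
  rewrite ncM ncV; have := det1D_odd NH1 trH; rewrite -/c => h.
  rewrite ler_pdivrMr; last by lra.
  apply: le_trans h _; rewrite NH.
  have : 0 <= c * mxn X ^+ 3 by rewrite mulr_ge0 ?exprn_ge0.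
  rewrite exprMn; set z := _ * _ ^+ 3 => z0.
  have -> : c * (mxn X ^+ 3 * 2^-1 ^+ 3) = z / 8 by rewrite /z; field.
  have -> : 2 * c * mxn X ^+ 3 = 2 * z by rewrite /z; ring.
  nra.
have -> : V0 - near_exp X = (1 + V0) * (H * H * H).
  (* Inserting V0 = 1 + H + V0 H into itself twice isolates the terms up to second order. *)
  have E1 : V0 = 1 + H + V0 * H by rewrite -V0B; ncring.
  have E2 : V0 = 1 + H + (1 + H + (1 + H + V0 * H) * H) * H by rewrite -!E1.
  have -> : near_exp X = 1 + (H + H) + H * (H + H).
    by rewrite -XH /near_exp; congr (_ + _); exact: scalemxAl.
  rewrite [in LHS]E2; ncring.
apply: le_trans (mxnM _ _) _; apply: ler_pM; rewrite ?mxn_ge0 //.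
  by rewrite (le_trans (mxnD _ _)) // mxn1 lerD2l mxn_unitary.
apply: le_trans (mxnM _ _) _; rewrite exprSr; apply: ler_pM; rewrite ?mxn_ge0 //.
  by rewrite (le_trans (mxnM _ _)) // -expr2 ler_pXn2r ?nnegrE ?mxn_ge0 // NH; lra.
by rewrite NH; lra.
Qed.

End Cayley.

(** * Weyl operators and approximate inverses *)

Section ScaleMul.
Variables (R : realType) (d : nat).
Implicit Types (c : R[i]) (A B : 'M[R[i]]_d).

Lemma mulZl c A B : (c *: A) * B = c *: (A * B).
Proof. exact/esym/scalemxAl. Qed.

Lemma mulZr c A B : A * (c *: B) = c *: (A * B).
Proof. exact/esym/scalemxAr. Qed.

Lemma detM A B : \det (A * B) = \det A * \det B.
Proof. exact: det_mulmx. Qed.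

Lemma trM A B : \tr (A * B) = \tr (B * A).
Proof. exact: mxtrace_mulC. Qed.

End ScaleMul.

Section Weyl.
Variables (R : realType) (d : nat).
Hypothesis d_gt0 : (0 < d)%N.
Local Notation M := 'M[R[i]]_d.
Local Notation w := (omega R d).

Lemma omegaX n : w ^+ n = (cos (2 * pi / d%:R *+ n) +i* sin (2 * pi / d%:R *+ n))%C.
Proof.
elim: n => [|n IH]; first by rewrite !mulr0n cos0 sin0.
rewrite exprSr IH !mulrSr cosD sinD /omega; simpc.
by congr (_ +i* _)%C; rewrite addrC.
Qed.

Lemma omega_d : w ^+ d = 1.
Proof.
rewrite omegaX -mulr_natr divfK ?pnatr_eq0 -?lt0n // mulr_natl.
by rewrite cos2pi sin2pi.
Qed.

Lemma omega_conj : w * w^* = 1.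
Proof.
by have := sqr_normc w; rewrite -nc_norm => <-; rewrite -rmorphXn /= sqr_sqrtr
  ?addr_ge0 ?sqr_ge0 // cos2Dsin2.
Qed.

(** The real part is 1 - 2 sin^2 t with t = pi n / d strictly between 0 and pi. *)
Lemma omegaX_neq1 n : (0 < n < d)%N -> w ^+ n != 1.
Proof.
case/andP => n0 nd; rewrite omegaX; apply/eqP => -[+ _].
pose t : R := pi / d%:R *+ n.
have -> : 2 * pi / d%:R *+ n = t *+ 2 by rewrite /t -mulrA mulr_natl mulrnAC.
rewrite cos_mulr2n cos2sin2 => E.
have : 0 < sin t.
  apply: sin_gt0_pi; rewrite pmulrn_lgt0 // divr_gt0 ?pi_gt0 ?ltr0n //=.
  rewrite /t -mulr_natr mulrAC ltr_pdivrMr ?ltr0n // ltr_pM2l ?pi_gt0 //.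
  by rewrite ltr_nat.
by move=> s0; nra.
Qed.

(** This is Z^m X^n with arbitrary natural exponents: a family closed under products up to powers of
    omega, without reduction modulo d. *)
Definition shiftmx (m n : nat) : M :=
  \matrix_(y, x) ((nat_of_ord y == (x + n) %% d)%N%:R * w ^+ (m * y)).

Lemma weylX_exp n : weylX R d ^+ n = shiftmx 0 n.
Proof.
elim: n => [|n IH].
  apply/matrixP => y x; rewrite expr0 !mxE mul0n expr0 mulr1 addn0 modn_small //.
rewrite exprSr IH; apply/matrixP => y x; rewrite !mxE.
pose x1 := Ordinal (ltn_pmod x.+1 d_gt0).
rewrite (bigD1 x1) //= big1 => [|z zx]; last first.
  by rewrite !mxE -[(nat_of_ord z == x.+1 %% d)%N]/(z == x1) (negbTE zx) mulr0.
by rewrite !mxE eqxx mulr1 addr0 /= modnDml addSnnS.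
Qed.

Lemma weylZ_exp m : weylZ R d ^+ m = shiftmx m 0.
Proof.
elim: m => [|m IH].
  by apply/matrixP => y x; rewrite expr0 !mxE mul0n expr0 mulr1 addn0 modn_small.
rewrite exprS IH; apply/matrixP => y x; rewrite !mxE.
rewrite (bigD1 y) //= big1 => [|z zy]; last first.
  by rewrite !mxE eq_sym (negbTE zy) !mul0r.
by rewrite !mxE eqxx mul1r addr0 mulrCA -exprD mulSn.
Qed.

(** Moving X^n past Z^m' costs omega^(- m' n); as exponents are natural numbers, -1 is written
    [d.-1]. *)
Lemma shiftmxM m n m' n' :
  shiftmx m n * shiftmx m' n' = w ^+ (m' * n * d.-1) *: shiftmx (m + m') (n + n').
Proof.
apply/matrixP => y x; rewrite !mxE.
pose x1 := Ordinal (ltn_pmod (x + n') d_gt0).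
rewrite (bigD1 x1) //= big1 => [|z zx]; last first.
  by rewrite !mxE -[(nat_of_ord z == (x + n') %% d)%N]/(z == x1) (negbTE zx) mul0r mulr0.
rewrite !mxE eqxx mul1r addr0 /= modnDml -addnA [(n' + n)%N]addnC.
case: eqP => [->|_]; last by rewrite !mul0r mulr0.
have wM k a : w ^+ (k * (a %% d)) = w ^+ (k * a).
  by rewrite ![(k * _)%N]mulnC !exprM (expr_mod _ omega_d).
rewrite !mul1r !wM -!exprD.
have -> : (m' * n * d.-1 + (m + m') * (x + (n + n')) =
  m * (x + (n + n')) + m' * (x + n') + m' * n * d)%N.
  have -> : (m' * n * d = m' * n * d.-1 + m' * n)%N.
    by rewrite -{1}(prednK d_gt0) mulnS addnC.
  by move: (nat_of_ord x) => k; lia.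
by rewrite [in RHS]exprD [(m' * n * d)%N]mulnC [in RHS]exprM omega_d expr1n mulr1.
Qed.

Lemma weylE a : weyl R a = shiftmx a.1 a.2.
Proof.
rewrite /weyl weylX_exp weylZ_exp -[_ *m _]/(_ * _) shiftmxM.
by rewrite !mul0n expr0 scale1r addn0 add0n.
Qed.

Lemma shiftmx_period m n : shiftmx (d * m) (d * n) = 1.
Proof.
apply/matrixP => y x; rewrite !mxE -mulnA exprM omega_d expr1n mulr1.
by rewrite [(d * n)%N]mulnC addnC modnMDl modn_small.
Qed.

Lemma shiftmxX m n k : exists e, shiftmx m n ^+ k = w ^+ e *: shiftmx (k * m) (k * n).
Proof.
elim: k => [|k [e IH]].
  by exists 0%N; rewrite expr0 scale1r -(shiftmx_period 0 0) !muln0.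
exists (e + k * m * n * d.-1)%N; rewrite exprS IH mulZr shiftmxM scalerA.
by rewrite -exprD !mulSn.
Qed.

(** A geometric sum whose ratio z is a d-th root of unity, equal to 1 only if y = y'. *)
Lemma omega_orth (y y' : 'I_d) :
  \sum_(m < d) w ^+ (m * y) * (w ^+ (m * y'))^* = (d * (y == y'))%:R.
Proof.
pose z := w ^+ y * (w ^+ y')^*.
have -> : \sum_(m < d) w ^+ (m * y) * (w ^+ (m * y'))^* = \sum_(m < d) z ^+ m.
  by apply: eq_bigr => m _; rewrite ![(m * _)%N]mulnC !exprM exprMn -rmorphXn.
have wV k : w ^+ k * (w ^+ k)^* = 1.
  by rewrite rmorphXn -exprMn omega_conj expr1n.
case: (eqVneq y y') => [E|yy'] /=.
  under eq_bigr do rewrite /z E wV expr1n.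
  by rewrite sumr_const card_ord muln1.
rewrite muln0; have zd : z ^+ d = 1.
  rewrite exprMn -rmorphXn -!exprM ![(_ * d)%N]mulnC !exprM omega_d !expr1n.
  by rewrite rmorph1 mulr1.
suff z1 : z - 1 != 0.
  by apply: (mulfI z1); rewrite -subrX1 zd subrr mulr0.
rewrite subr_eq0; apply: contraNneq yy' => zE.
have {zE} E : w ^+ y = w ^+ y'.
  by rewrite -[LHS]mulr1 -(wV y') mulrCA -/z zE mulr1.
clear z zd; wlog le_yy' : y y' E / (y <= y')%N => [H|].
  by case: (leqP y y') => [|/ltnW] h; [exact: (H y y') | rewrite eq_sym; exact: (H y' y)].
rewrite -val_eqE /= eqn_leq le_yy' leqNgt /=; apply/negP => lt_yy'.
have /negP[] : w ^+ (y' - y) != 1.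
  by apply: omegaX_neq1; have := ltn_ord y'; lia.
have wy0 : w ^+ y != 0.
  by apply: contra_eq_neq (wV y) => ->; rewrite mul0r eq_sym oner_neq0.
by apply/eqP/(mulfI wy0); rewrite -exprD subnKC // mulr1 E.
Qed.

(** The sum over powers of Z removes the off-diagonal entries by orthogonality of characters; the
    sum over powers of X then replaces each diagonal entry by the trace. *)
Lemma weyl_twirl (E : M) :
  \sum_a weyl R a * E * adj (weyl R a) = (d%:R * \tr E) *: (1 : M).
Proof.
apply/matrixP => y y'.
pose D (a2 x z : 'I_d) : R[i] := (nat_of_ord z == (x + a2) %% d)%N%:R.
transitivity (\sum_(a1 < d) \sum_(a2 < d) (w ^+ (a1 * y) * (w ^+ (a1 * y'))^*) *
    \sum_(x < d) \sum_(x' < d) D a2 x y * D a2 x' y' * E x x').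
  rewrite pair_bigA summxE; apply: eq_bigr => -[a1 a2] _ /=; rewrite weylE mxE /=.
  under eq_bigr => x' _ do rewrite mxE mulr_suml.
  rewrite exchange_big mulr_sumr; apply: eq_bigr => x _; rewrite mulr_sumr.
  apply: eq_bigr => x' _; rewrite adjE !mxE rmorphM rmorph_nat /D /=.
  by set u := _%:R; set v := _%:R; ring.
rewrite exchange_big /=; under eq_bigr do rewrite -mulr_suml omega_orth.
rewrite -mulr_sumr !mxE; case: eqP => [<-|_]; last by rewrite muln0 !mul0r mulr0n mulr0.
rewrite muln1 mulr1n mulr1; congr (_ * _).
rewrite exchange_big; apply: eq_bigr => x _; rewrite exchange_big (bigD1 x) //=.
rewrite [X in _ + X]big1 ?addr0 => [|x' xx']; last first.
  rewrite big1 // => a2 _; rewrite /D; case: eqP => [->|_]; last by rewrite !mul0r.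
  rewrite eqn_modDr !modn_small // val_eqE eq_sym (negbTE xx') mulr0 mul0r //.
rewrite -mulr_suml -[RHS]mul1r; congr (_ * _).
(* The only shift that takes x to y. *)
pose a2 := Ordinal (ltn_pmod (y + (d - x)) d_gt0).
have Da (a : 'I_d) : D a x y = (a == a2)%:R.
  rewrite /D; congr (nat_of_bool _)%:R; apply/eqP/eqP => [yE|->] /=.
    apply: val_inj; rewrite /= yE modnDml.
    have -> : (x + a + (d - x) = a + d)%N by have := ltn_ord x; lia.
    by rewrite modnDr modn_small.
  rewrite modnDmr; have -> : (x + (y + (d - x)) = y + d)%N by have := ltn_ord x; lia.
  by rewrite modnDr modn_small.
rewrite (bigD1 a2) //= big1 => [|a aa2]; rewrite Da ?eqxx ?mulr1 ?addr0 //.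
by rewrite (negbTE aa2) mul0r.
Qed.

End Weyl.

Lemma expZ (R : realType) (d : nat) (c : R[i]) (A : 'M[R[i]]_d) n :
  (c *: A) ^+ n = c ^+ n *: A ^+ n.
Proof.
elim: n => [|n IH]; first by rewrite !expr0 scale1r.
by rewrite !exprS IH mulZl mulZr scalerA.
Qed.

Definition ord2_0 d (d_gt0 : (0 < d)%N) : 'I_d * 'I_d := (Ordinal d_gt0, Ordinal d_gt0).

(** The phase of a Weyl gate g cancels under conjugation. As for the period, g^d is a scalar z, and
    det g = 1 forces z^d = 1, so g^(d^2) = 1. The factor 2 keeps 2 d^2 - 1 positive even for d = 1,
    so that the inverse of g is a nonempty word. *)
Lemma weyl_gates (R : realType) (d : nat) (d_gt0 : (0 < d)%N) (G : seq 'M[R[i]]_d) :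
  universal G -> contains_weyl G ->
  exists kw : 'I_d * 'I_d -> 'I_(size G),
  [/\ forall E, \sum_a G`_(kw a) * E * adj (G`_(kw a)) = (d%:R * \tr E) *: (1 : 'M[R[i]]_d),
      forall E, G`_(kw (ord2_0 d_gt0)) * E * adj (G`_(kw (ord2_0 d_gt0))) = E &
      forall a, G`_(kw a) ^+ (2 * d ^ 2) = 1].
Proof.
move=> [hSU _] hW.
have /choice[kc hkc] : forall a, exists kc : 'I_(size G) * R[i],
    nc kc.2 = 1 /\ G`_kc.1 = kc.2 *: weyl R a.
  move=> a; have [c c1 cG] := hW a.
  have lt : (index (c *: weyl R a) G < size G)%N by rewrite index_mem.
  by exists (Ordinal lt, c); rewrite /= nth_index.
have cc a : (kc a).2 * (kc a).2^* = 1.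
  have [c1 _] := hkc a.
  by have := sqr_normc (kc a).2; rewrite -nc_norm c1 expr1n => <-.
have conjE a E : G`_(kc a).1 * E * adj (G`_(kc a).1) = weyl R a * E * adj (weyl R a).
  by have [_ ->] := hkc a; rewrite adjZ !mulZl mulZr scalerA cc scale1r.
exists (fun a => (kc a).1); split=> [E|E|a].
- by rewrite -(weyl_twirl d_gt0 E); apply: eq_bigr => a _; rewrite conjE.
- rewrite conjE weylE //= /ord2_0 /= -[shiftmx _ _ _ _]/(shiftmx R d 0 0).
  have -> : shiftmx R d 0 0 = 1 by rewrite -(shiftmx_period R d_gt0 0 0) !muln0.
  by rewrite adj1 mul1r mulr1.
have [_ Ga] := hkc a; pose g := G`_(kc a).1.
have [_ gSU] : in_SU g by apply: hSU; rewrite mem_nth.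
have [e we] := shiftmxX R d_gt0 a.1 a.2 d.
pose z := (kc a).2 ^+ d * omega R d ^+ e.
have gd : g ^+ d = z *: (1 : 'M[R[i]]_d).
  by rewrite /g Ga expZ weylE // we shiftmx_period // scalerA.
have zd : z ^+ d = 1.
  have := detZ z (1 : 'M[R[i]]_d); rewrite det1 mulr1 => <-; rewrite -gd.
  elim: (d in X in _ ^+ X) => [|n IH]; first by rewrite expr0 det1.
  by rewrite exprS detM gSU IH mul1r.
have gdd : g ^+ (d ^ 2) = 1 by rewrite -mulnn exprM gd expZ zd expr1n scale1r.
by rewrite mulnC exprM gdd expr1n.
Qed.

Section ApproxInverse.
Variables (R : realType) (d : nat).
Hypothesis d_gt0 : (0 < d)%N.
Local Notation M := 'M[R[i]]_d.

(** The trace is the linear part of det (1 + X) - 1 = 0. For [mxn X] above 1 the trivial bound by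
    [mxn X] is already quadratic, whence the added 1 in the constant. *)
Lemma tr_SU : exists C, forall X : M, in_SU (1 + X) -> nc (\tr X) <= C * mxn X ^+ 2.
Proof.
exists (detC R d + 1) => X [_ detX]; have c0 := detC_ge0 R d.
have X0 := mxn_ge0 X; have [X1|X1] := lerP (mxn X) 1.
  have := det1D_tr X1; rewrite detX subrr sub0r ncN => h; apply: le_trans h _.
  by rewrite ler_wpM2r ?exprn_ge0 // lerDl.
by apply: le_trans (nc_tr _) _; rewrite expr2 mulrA ler_peMl //; nra.
Qed.

Variables (I : Type) (y : I -> R).
Hypothesis y01 : forall i, 0 < y i <= 1.

Lemma bO_tr_SU n (X : I -> M) : (forall i, in_SU (1 + X i)) -> bO y n X ->
  bO y (n + n) (fun i => (\tr (X i)) *: (1 : M)).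
Proof.
move=> hSU /(bO_pos y01)[C C0 hX]; have [c hc] := tr_SU.
exists (Num.max c 0 * C ^+ 2 * d%:R) => i; rewrite mxnZ mxn1 mulrAC.
rewrite ler_wpM2r //; apply: le_trans (hc _ (hSU i)) _.
apply: (@le_trans _ _ (Num.max c 0 * mxn (X i) ^+ 2)).
  by rewrite ler_wpM2r ?exprn_ge0 ?mxn_ge0 // le_max lexx.
rewrite -mulrA ler_wpM2l ?le_max ?lexx ?orbT // exprD -expr2 -exprMn.
by rewrite ler_pXn2r ?nnegrE ?mxn_ge0 // (le_trans (mxn_ge0 _) (hX i)).
Qed.

Variable g : 'I_d * 'I_d -> M.
Hypothesis g_SU : forall a, in_SU (g a).
Hypothesis g_twirl : forall E, \sum_a g a * E * adj (g a) = (d%:R * \tr E) *: (1 : M).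
Hypothesis g_center : forall E, g (ord2_0 d_gt0) * E * adj (g (ord2_0 d_gt0)) = E.

Definition nontriv : seq ('I_d * 'I_d) := [seq a <- index_enum _ | a != ord2_0 d_gt0].

(* Conjugating by all Weyl operators annihilates the first-order part of P - 1,
   so the product over the nontrivial ones alone is P^-1 up to second order. *)
Definition twirl_prod (P : M) : M := \prod_(a <- nontriv) (g a * P * adj (g a)).

Lemma twirl_prod_inv n (P : I -> M) : (forall i, in_SU (P i)) ->
  bO y n (fun i => P i - 1) -> bO y (n + n) (fun i => twirl_prod (P i) * P i - 1).
Proof.
move=> hP hE; pose E i := P i - 1.
have PE i : P i = 1 + E i by rewrite /E addrC subrK.
have hX a : bO y n (fun i => g a * E i * adj (g a)).
  by rewrite -[n]addn0; exact: bO_mul (bO_mul (bO_const y (g a)) hE) (bO_const y _).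
have hQ := bO_prod y01 nontriv hX.
have htr : bO y (n + n) (fun i => (\tr (E i)) *: (1 : M)).
  by apply: bO_tr_SU => // i; rewrite -PE.
have hd := bO_scale d%:R htr.
have h1 := bO_add hQ hd.
have := bO_mul h1 (bO_SU y hP); rewrite addn0 => h1P.
have h2 := bO_sub h1P (bO_mul hE hE).
apply: bO_ext h2 => i; rewrite -/(E i) /twirl_prod.
have prodE : \prod_(a <- nontriv) (g a * P i * adj (g a)) =
    \prod_(a <- nontriv) (1 + g a * E i * adj (g a)).
  apply: eq_bigr => a _; rewrite PE mulrDr mulrDl mulr1 SU_mulVr //.
(* The omitted Weyl operator is the identity, whose conjugate is E itself; this is where the sign of
   the inverse comes from. *)
have sumE : \sum_(a <- nontriv) g a * E i * adj (g a) = d%:R *: (\tr (E i) *: (1 : M)) - E i.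
  apply/eqP; rewrite -[X in _ == _ - X]g_center scalerA -g_twirl.
  by rewrite /nontriv big_filter [in X in _ == X](bigD1 (ord2_0 d_gt0)) //= addrAC subrr add0r.
rewrite prodE sumE; set Q : M := \prod_(_ <- _) _; set T : M := d%:R *: _; rewrite PE.
ncring.
Qed.

End ApproxInverse.

(** * The commutator step *)

Section Casimir.
Variables (R : realType) (d : nat).
Local Notation M := 'M[R[i]]_d.
Local Notation e a b := (delta_mx a b : M).

(** Gaussian integer matrices, as real and imaginary parts. They serve both for the generators of
    su(d), which are thereby exact constants of the program, and for fixed-point matrices. *)
Definition zmx : Type := 'M[int]_d * 'M[int]_d.
Definition zval (A : zmx) : M := map_mx intr A.1 + 'i *: map_mx intr A.2.

(** All ordered pairs are kept. The family is redundant and contains zeros, but its Casimir sum runs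
    over all matrix units without case distinctions. *)
Definition lie_idx : finType := ('I_d * 'I_d * bool)%type.

(* Up to the factor d these are the skew-Hermitian combinations of the matrix
   units, the diagonal ones being shifted to trace zero. *)
Definition lie_gen (j : lie_idx) : zmx :=
  let: (a, b, t) := j in
  if t then (0, (d%:Z *: (delta_mx a b + delta_mx b a) - (2 * (a == b))%:Z%:M))
  else (d%:Z *: (delta_mx a b - delta_mx b a), 0).

Lemma lie_genF a b : zval (lie_gen (a, b, false)) = d%:R *: (e a b - e b a).
Proof.
by rewrite /zval /= map_mx0 scaler0 addr0 map_mxZ map_mxB !map_delta_mx.
Qed.

Lemma lie_genT a b : zval (lie_gen (a, b, true)) =
  'i *: (d%:R *: (e a b + e b a) - (2 * (a == b))%:R *: (1 : M)).
Proof.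
rewrite /zval /= map_mx0 add0r map_mxB map_mxZ map_mxD !map_delta_mx map_scalar_mx.
by rewrite -scalemx1.
Qed.

Lemma adj_delta a b : adj (e a b) = e b a.
Proof. by apply/matrixP => i j; rewrite adjE !mxE rmorph_nat andbC. Qed.

Lemma lie_gen_skew j : adj (zval (lie_gen j)) = - zval (lie_gen j).
Proof.
case: j => -[a b] [].
  rewrite lie_genT adjZ adjB !adjZ adjD !adj_delta adj1 !rmorph_nat conjCi addrC.
  by rewrite scaleNr [e b a + _]addrC [- _ + _ *: _]addrC.
by rewrite lie_genF adjZ adjB !adj_delta rmorph_nat -scalerN opprB.
Qed.

Lemma tr_delta a b : \tr (e a b) = (a == b)%:R.
Proof.
rewrite /mxtrace (bigD1 a) //= big1 ?addr0 => [|i ia]; first by rewrite mxE eqxx.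
by rewrite mxE (negbTE ia).
Qed.

Lemma lie_gen_tr j : \tr (zval (lie_gen j)) = 0.
Proof.
case: j => -[a b] [].
  rewrite lie_genT mxtraceZ mxtraceD [\tr (- _)]linearN /= !mxtraceZ mxtraceD !tr_delta mxtrace1.
  rewrite [b == a]eq_sym natrM; apply/eqP; rewrite mulf_eq0; apply/orP; right.
  by apply/eqP; ring.
by rewrite lie_genF linearZ /= linearB /= !tr_delta [b == a]eq_sym subrr mulr0.
Qed.

Definition brk (A B : M) : M := A * B - B * A.

Let sum_unit_mul : \sum_a \sum_b e a b * e b a = d%:R *: (1 : M).
Proof.
under eq_bigr => a _ do (under eq_bigr => b _ do
  rewrite -[e a b * _]/(e a b *m _) mul_delta_mx).
under eq_bigr => a _ do rewrite sumr_const card_ord -scaler_nat.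
by rewrite -scaler_sumr -mx1_sum_delta.
Qed.

Let sum_unit_conj (K : M) : \sum_a \sum_b e a b * K * e b a = \tr K *: (1 : M).
Proof.
have E a b : e a b * K * e b a = K b b *: e a a.
  apply/matrixP => i j; rewrite !mxE (bigD1 b) //= big1 => [|k kb]; last first.
    by rewrite [e b a _ _]mxE (negbTE kb) mulr0.
  rewrite !mxE (bigD1 b) //= big1 => [|k kb]; last first.
    by rewrite mxE (negbTE kb) andbF mul0r.
  rewrite !mxE !eqxx andbT !addr0.
  by case: (i == a); rewrite ?mul0r ?mulr0 ?mul1r //= mulrC [RHS]mulrC.
under eq_bigr => a _ do (under eq_bigr => b _ do rewrite E).
rewrite exchange_big /=; under eq_bigr => b _ do rewrite -scaler_sumr -mx1_sum_delta.
by rewrite -scaler_suml.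
Qed.

Lemma sum_lie_idx (F : lie_idx -> M) :
  \sum_j F j = \sum_a \sum_b \sum_t F (a, b, t).
Proof.
have -> : \sum_j F j = \sum_p \sum_t F (p, t).
  by rewrite pair_bigA; apply: eq_bigr => -[p t].
by rewrite [RHS]pair_bigA; apply: eq_bigr => -[a b].
Qed.

(** Trace shifts vanish in brackets, and the remaining sums reduce to those of e_ab e_ba, which is
    d, and of e_ab K e_ba, which is tr K. *)
Lemma casimir (K : M) :
  \sum_j brk (zval (lie_gen j)) (brk (zval (lie_gen j)) K) =
  (8 * d ^ 2)%:R *: (\tr K *: (1 : M) - d%:R *: K).
Proof.
rewrite sum_lie_idx.
have brkZ c A B : brk (c *: A) B = c *: brk A B.
  by rewrite /brk mulZl mulZr scalerBr.
have brkZr c A B : brk A (c *: B) = c *: brk A B.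
  by rewrite /brk mulZl mulZr scalerBr.
have brkS c A B : brk (A - c *: (1 : M)) B = brk A B.
  rewrite /brk mulrBl mulrBr mulZl mulZr mul1r mulr1; set T : M := c *: B.
  ncring.
(* Since i^2 = -1, the terms containing the same unit twice cancel between the two generators of a
   pair; the mixed terms add up to -2 W. *)
pose W a b : M := e a b * e b a * K + e b a * e a b * K +
  (K * (e a b * e b a) + K * (e b a * e a b)) -
  (e a b * K * e b a + e b a * K * e a b) - (e a b * K * e b a + e b a * K * e a b).
have E a b : \sum_t brk (zval (lie_gen (a, b, t))) (brk (zval (lie_gen (a, b, t))) K) =
   (d ^ 2)%:R *: (- (W a b + W a b)).
  rewrite big_bool lie_genF lie_genT /= !brkZ !brkS !brkZr !brkZ !brkZr !scalerA.
  rewrite -mulrA -natrM mulnn -expr2 sqrCi mulN1r scaleNr -scalerN -scalerDr.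
  congr (_ *: _); rewrite /W /brk; move: (e a b) (e b a) => u v; ncring.
under eq_bigr => a _ do (under eq_bigr => b _ do rewrite E).
have S1 : \sum_a \sum_b e b a * e a b = d%:R *: (1 : M) by rewrite exchange_big sum_unit_mul.
have S2 : \sum_a \sum_b e b a * K * e a b = \tr K *: (1 : M).
  by rewrite exchange_big sum_unit_conj.
have SW : \sum_a \sum_b W a b =
    d%:R *: K + d%:R *: K + (d%:R *: K + d%:R *: K) - (\tr K *: (1 : M) + \tr K *: (1 : M)) -
      (\tr K *: (1 : M) + \tr K *: (1 : M)).
  have L (F : 'I_d -> 'I_d -> M) : \sum_a \sum_b F a b * K = (\sum_a \sum_b F a b) * K.
    by rewrite mulr_suml; apply: eq_bigr => a _; rewrite mulr_suml.
  have Rr (F : 'I_d -> 'I_d -> M) : \sum_a \sum_b K * F a b = K * (\sum_a \sum_b F a b).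
    by rewrite mulr_sumr; apply: eq_bigr => a _; rewrite mulr_sumr.
  have A2 (F H : 'I_d -> 'I_d -> M) : \sum_a \sum_b (F a b + H a b) =
      \sum_a \sum_b F a b + \sum_a \sum_b H a b.
    by rewrite -big_split; apply: eq_bigr => a _; rewrite -big_split.
  have B2 (F H : 'I_d -> 'I_d -> M) : \sum_a \sum_b (F a b - H a b) =
      \sum_a \sum_b F a b - \sum_a \sum_b H a b.
    by rewrite -sumrB; apply: eq_bigr => a _; rewrite -sumrB.
  rewrite /W !B2 !A2 !L !Rr S1 S2 sum_unit_mul sum_unit_conj.
  by rewrite !mulZl !mulZr mul1r mulr1.
transitivity ((d ^ 2)%:R *: - (\sum_a \sum_b W a b + \sum_a \sum_b W a b)).
  rewrite -big_split -sumrN scaler_sumr; apply: eq_bigr => a _ /=.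
  by rewrite -big_split -sumrN scaler_sumr.
rewrite SW; set T : M := _ *: (1 : M); set D : M := d%:R *: K.
rewrite mulnC natrM -scalerA; congr (_ *: _).
rewrite scaler_nat !mulrS mulr0n; ncring.
Qed.

End Casimir.

Section CommutatorStep.
Variables (R : realType) (d : nat).
Hypothesis d_gt0 : (0 < d)%N.
Local Notation M := 'M[R[i]]_d.
Local Notation J := (lie_idx d).
Variable g : 'I_d * 'I_d -> M.
Hypothesis g_SU : forall a, in_SU (g a).
Hypothesis g_twirl : forall E, \sum_a g a * E * adj (g a) = (d%:R * \tr E) *: (1 : M).
Hypothesis g_center : forall E, g (ord2_0 d_gt0) * E * adj (g (ord2_0 d_gt0)) = E.

Definition approx_inv (v v' : M) : M := twirl_prod d_gt0 g (v' * v) * v'.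

Lemma brkZl c (A B : M) : brk (c *: A) B = c *: brk A B.
Proof. by rewrite /brk mulZl mulZr scalerBr. Qed.

Lemma brkZr c (A B : M) : brk A (c *: B) = c *: brk A B.
Proof. by rewrite /brk mulZl mulZr scalerBr. Qed.

Section Families.
Variables (I : Type) (y : I -> R).
Hypothesis y01 : forall i, 0 < y i <= 1.
Implicit Types x z v w : I -> M.

Lemma bO_brk m n x z : bO y m x -> bO y n z -> bO y (m + n) (fun i => brk (x i) (z i)).
Proof.
move=> hx hz; apply: bO_sub; first exact: bO_mul.
by rewrite addnC; exact: bO_mul.
Qed.

(** As (1 - x) (1 + x) = 1 - x^2, the product v' v is within O(y^2) of 1, and the twirl doubles the
    exponent. The exact inverse of v' v times v' is the inverse of v. *)
Lemma approx_invP x v v' : (forall i, in_SU (v i)) -> (forall i, in_SU (v' i)) ->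
  bO y 1 x -> bO y 2 (fun i => v i - (1 + x i)) ->
  bO y 2 (fun i => v' i - (1 - x i)) ->
  bO y 4 (fun i => approx_inv (v i) (v' i) - adj (v i)).
Proof.
move=> hv hv' hx h h'.
have h1x : bO y 0 (fun i => 1 - x i).
  exact: bO_sub (bO_const y 1) (bO_weak y01 (leq0n 1) hx).
have h2 : bO y 2 (fun i => v' i * v i - 1).
  have hA := bO_mul h' (bO_SU y hv); have hB := bO_mul h1x h.
  have hC := bO_mul hx hx; apply: bO_ext (bO_sub (bO_add hA hB) hC) => i.
  ncring.
have hP i : in_SU (v' i * v i) by exact: SUM.
have h4 := twirl_prod_inv y01 g_SU g_twirl g_center hP h2.
have h5 := bO_mul h4 (bO_adj (bO_SU y hv)).
apply: bO_ext h5 => i; rewrite /approx_inv mulrBl mul1r; congr (_ - _).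
by rewrite -!mulrA SU_mulVr // mulr1.
Qed.

(** With exact inverses the group commutator minus 1 is [v - 1, w - 1] times [adj v * adj w],
    because brackets ignore the 1 and the last factor is 1 + O(y). Errors O(y^2) in v and w are thus
    multiplied by a further O(y). *)
Lemma commutatorP x z v w vi wi :
  (forall i, in_SU (v i)) -> (forall i, in_SU (w i)) ->
  bO y 1 x -> bO y 1 z ->
  bO y 2 (fun i => v i - (1 + x i)) -> bO y 2 (fun i => w i - (1 + z i)) ->
  bO y 4 (fun i => vi i - adj (v i)) -> bO y 4 (fun i => wi i - adj (w i)) ->
  bO y 3 (fun i => v i * w i * vi i * wi i - 1 - brk (x i) (z i)).
Proof.
move=> hv hw hx hz hvx hwz hvi hwi.
have bv := bO_SU y hv; have bw := bO_SU y hw.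
have av : bO y 0 (fun i => adj (v i)) by exact: bO_adj.
have aw : bO y 0 (fun i => adj (w i)) by exact: bO_adj.
have bwi : bO y 0 wi.
  by apply: bO_ext (bO_add (bO_weak y01 (leq0n 4) hwi) aw) => i; rewrite subrK.
have h1 := bO_mul (bO_mul (bO_mul bv bw) hvi) bwi.
have h2 := bO_mul (bO_mul (bO_mul bv bw) av) hwi.
have h3 : bO y 3 (fun i => v i * w i * vi i * wi i - v i * w i * adj (v i) * adj (w i)).
  apply: (bO_weak y01 (leqnSn 3)); apply: bO_ext (bO_add h1 h2) => i; ncring.
have ha : bO y 1 (fun i => v i - 1).
  by apply: bO_ext (bO_add (bO_weak y01 (leqnSn 1) hvx) hx) => i; ncring.
have hb : bO y 1 (fun i => w i - 1).
  by apply: bO_ext (bO_add (bO_weak y01 (leqnSn 1) hwz) hz) => i; ncring.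
have h4 : bO y 1 (fun i => adj (v i) * adj (w i) - 1).
  have hA := bO_mul av (bO_adj hb); apply: bO_ext (bO_add hA (bO_adj ha)) => i.
  rewrite !adjB adj1; ncring.
have h5 := bO_mul (bO_brk ha hb) h4.
have h6 := bO_add (bO_brk hx hwz) (bO_brk hvx hb).
apply: bO_ext (bO_add h3 (bO_add h5 h6)) => i.
have E1 : w i * v i * adj (v i) * adj (w i) = 1.
  by rewrite -[w i * v i * _]mulrA SU_mulVr // mulr1 SU_mulVr.
rewrite -[X in _ = _ - X - _]E1 /brk; ncring.
Qed.

End Families.

(* Normalized so that, by the Casimir identity, the brackets of the generators with
   their coefficients add up to the projection of X to su(d). *)
Definition lie_coef (j : J) (X : M) : M :=
  (- (16 * d ^ 3)%:R^-1) *: brk (zval R (lie_gen j)) (X - adj X).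

Definition su_proj (X : M) : M :=
  2^-1 *: (X - adj X) - (2 * d)%:R^-1 *: (\tr (X - adj X) *: (1 : M)).

(** In 16 d^3 the factor 8 d^3 cancels the Casimir constant and the last 2 takes half of
    [X - adj X]. *)
Lemma sum_lie_coef X : \sum_j brk (zval R (lie_gen j)) (lie_coef j X) = su_proj X.
Proof.
rewrite /lie_coef; under eq_bigr => j _ do rewrite brkZr.
rewrite -scaler_sumr casimir scalerA /su_proj.
have d0 : d%:R != 0 :> R[i] by rewrite pnatr_eq0 -lt0n.
have E1 : - (16 * d ^ 3)%:R^-1 * (8 * d ^ 2)%:R = - (2 * d)%:R^-1 :> R[i].
  by rewrite !natrM; field; rewrite ?d0.
have E2 : - (2 * d)%:R^-1 * d%:R = - 2^-1 :> R[i] by rewrite natrM; field.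
by rewrite E1 scalerBr [_ *: (d%:R *: _)]scalerA E2 !scaleNr opprK addrC.
Qed.

Lemma su_projB X Y : su_proj (X - Y) = su_proj X - su_proj Y.
Proof.
have E : X - Y - adj (X - Y) = (X - adj X) - (Y - adj Y) by rewrite adjB; ncring.
rewrite /su_proj E; move: (X - adj X) (Y - adj Y) => A B.
rewrite [\tr _]linearB /= scalerBl !scalerBr; set a : M := 2^-1 *: A; set b : M := 2^-1 *: B.
set s : M := _ *: _; set t : M := _ *: (_ *: _); ncring.
Qed.

Lemma mxn_su_proj X : mxn (su_proj X) <= 2 * mxn X.
Proof.
have h : mxn (X - adj X) <= 2 * mxn X.
  by rewrite (le_trans (mxnB _ _)) // mxn_adj mulrDl !mul1r.
apply: le_trans (mxnB _ _) _; rewrite !mxnZ mxn1 !ncV !nc_nat.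
have := nc_tr (X - adj X); have : 0 < d%:R :> R by rewrite ltr0n.
rewrite natrM invfM; set D : R := d%:R; set t := nc _ => D0 tX.
have -> : 2^-1 * D^-1 * (t * D) = 2^-1 * t by field; lra.
lra.
Qed.

(* The configurations over which the estimate of the commutator step is uniform:
   y is the scale, v j and w j approximate exp (y A_j) and exp (y^-1 c_j), v' j and
   w' j their inverses. *)
Record step_data (C : R) := StepData {
  sd_y : R; sd_U : M; sd_U' : M; sd_E : M;
  sd_v : J -> M; sd_v' : J -> M; sd_w : J -> M; sd_w' : J -> M;
  sd_y01 : 0 < sd_y <= 1;
  sd_U_SU : in_SU sd_U; sd_U'_SU : in_SU sd_U';
  sd_v_SU : forall j, in_SU (sd_v j); sd_v'_SU : forall j, in_SU (sd_v' j);
  sd_w_SU : forall j, in_SU (sd_w j); sd_w'_SU : forall j, in_SU (sd_w' j);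
  sd_UU' : mxn (sd_U - sd_U') <= C * sd_y ^+ 2;
  sd_EUU' : mxn (sd_E - (sd_U * adj sd_U' - 1)) <= C * sd_y ^+ 2;
  sd_vP : forall j, mxn (sd_v j - (1 + sd_y%:C%C *: zval R (lie_gen j))) <= C * sd_y ^+ 2;
  sd_v'P : forall j, mxn (sd_v' j - (1 - sd_y%:C%C *: zval R (lie_gen j))) <= C * sd_y ^+ 2;
  sd_wP : forall j, mxn (sd_w j - (1 + sd_y^-1%:C%C *: lie_coef j sd_E)) <= C * sd_y ^+ 2;
  sd_w'P : forall j, mxn (sd_w' j - (1 - sd_y^-1%:C%C *: lie_coef j sd_E)) <= C * sd_y ^+ 2
}.

Definition step_mx (U' : M) (v v' w w' : J -> M) : M :=
  \prod_j (v j * w j * approx_inv (v j) (v' j) * approx_inv (w j) (w' j)) * U'.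

(** The rounding error of E is kept apart with an explicit coefficient: unlike C' it must not depend
    on C, or the constant would grow from level to level. *)
Lemma commutator_step C : exists C', forall D : step_data C,
  mxn (step_mx (sd_U' D) (sd_v D) (sd_v' D) (sd_w D) (sd_w' D) - sd_U D) <=
  2 * (d ^ 2)%:R * mxn (sd_E D - (sd_U D * adj (sd_U' D) - 1)) + C' * sd_y D ^+ 3.
Proof.
pose y := @sd_y C; have y01 : forall D, 0 < y D <= 1 by exact: sd_y01.
pose x j (D : step_data C) : M := (y D)%:C%C *: zval R (lie_gen j).
pose b j (D : step_data C) : M := lie_coef j (sd_E D).
pose z j (D : step_data C) : M := (y D)^-1%:C%C *: b j D.
pose E (D : step_data C) : M := sd_U D * adj (sd_U' D) - 1.
have bU' := bO_SU y (@sd_U'_SU C).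
have E1 D : 1 + E D = sd_U D * adj (sd_U' D) by rewrite /E addrC subrK.
have E1_SU D : in_SU (1 + E D).
  by rewrite E1; apply: SUM; [exact: sd_U_SU | exact/SU_adj/sd_U'_SU].
have bE : bO y 2 E.
  have h : bO y 2 (fun D => sd_U D - sd_U' D) by exists C; exact: sd_UU'.
  apply: bO_ext (bO_mul h (bO_adj bU')) => D; rewrite /E mulrBl SU_mulVr //.
  exact: sd_U'_SU.
have bEt : bO y 2 (@sd_E C).
  have h : bO y 2 (fun D => sd_E D - E D) by exists C; exact: sd_EUU'.
  by apply: bO_ext (bO_add h bE) => D; rewrite subrK.
have bb j : bO y 2 (b j).
  have h := bO_sub bEt (bO_adj bEt).
  exact: bO_scale (bO_brk (bO_const y (zval R (lie_gen j))) h).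
have bx j : bO y 1 (x j) by have := bO_scaley y01 (bO_const y (zval R (lie_gen j))).
have bz j : bO y 1 (z j) by have := bO_divy y01 (bb j).
have hv j := fun D => @sd_v_SU C D j; have hv' j := fun D => @sd_v'_SU C D j.
have hw j := fun D => @sd_w_SU C D j; have hw' j := fun D => @sd_w'_SU C D j.
have bv j : bO y 2 (fun D => sd_v D j - (1 + x j D)) by exists C => D; exact: sd_vP.
have bv' j : bO y 2 (fun D => sd_v' D j - (1 - x j D)) by exists C => D; exact: sd_v'P.
have bw j : bO y 2 (fun D => sd_w D j - (1 + z j D)) by exists C => D; exact: sd_wP.
have bw' j : bO y 2 (fun D => sd_w' D j - (1 - z j D)) by exists C => D; exact: sd_w'P.
pose c j (D : step_data C) : M := sd_v D j * sd_w D j * approx_inv (sd_v D j) (sd_v' D j) *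
  approx_inv (sd_w D j) (sd_w' D j).
have bc j : bO y 3 (fun D => c j D - 1 - brk (x j D) (z j D)).
  apply: commutatorP => //; first exact: approx_invP (hv j) (hv' j) (bx j) (bv j) (bv' j).
  exact: approx_invP (hw j) (hw' j) (bz j) (bw j) (bw' j).
have bc1 j : bO y 2 (fun D => c j D - 1).
  apply: bO_ext (bO_add (bO_weak y01 (leqnSn 2) (bc j)) (bO_brk (bx j) (bz j))) => D.
  by rewrite subrK.
have hprod := bO_weak y01 (leqnSn 3) (bO_prod y01 (index_enum J) bc1).
have hsum := bO_sum (index_enum J) bc.
have xz D j : brk (x j D) (z j D) = brk (zval R (lie_gen j)) (b j D).
  rewrite /x /z brkZl brkZr scalerA -rmorphM mulfV ?scale1r //.
  by case/andP: (y01 D) => /lt0r_neq0.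
have bW : bO y 3 (fun D => \prod_j c j D - 1 - su_proj (sd_E D)).
  apply: bO_ext (bO_add hprod hsum) => D.
  have -> : \prod_j (1 + (c j D - 1)) = \prod_j c j D.
    by apply: eq_bigr => j _; rewrite addrC subrK.
  rewrite [X in _ - _ + X]sumrB -sum_lie_coef.
  under [X in _ + (_ - X)]eq_bigr do rewrite xz.
  by rewrite addrA subrK.
have bPE : bO y 3 (fun D => su_proj (E D) - E D).
  have h1 := bO_scale 2^-1 (bO_mul bE (bO_adj bE)).
  have h2 := bO_tr_SU y01 E1_SU bE.
  have h3 := bO_scale (2 * d)%:R^-1 (bO_sub h2 (bO_adj h2)).
  apply: (bO_weak y01 (leqnSn 3)); apply: bO_ext (bO_sub h1 h3) => D.
  have trB : \tr (E D - adj (E D)) = \tr (E D) - (\tr (E D))^*.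
    by rewrite -tr_adj; exact: raddfB.
  rewrite /su_proj trB scalerBl adjZ adj1.
  set T := _ *: (_ - _); have /(congr1 (fun X : M => 2^-1 *: X)) : E D * adj (E D) = - (E D + adj (E D)).
    have := SU_mulVr (E1_SU D); rewrite adjD adj1 => h.
    transitivity ((1 + E D) * (1 + adj (E D)) - 1 - (E D + adj (E D))); first by ncring.
    by rewrite h subrr sub0r.
  move=> ->; have hh : (2^-1 + 2^-1) *: E D = E D.
    by have -> : 2^-1 + 2^-1 = 1 :> R[i]; [rewrite [RHS](splitr 1) !mul1r | rewrite scale1r].
  rewrite -[X in _ = _ - X]hh scalerDl scalerN scalerBr scalerDr.
  by set p : M := 2^-1 *: E D; set q : M := 2^-1 *: _; ncring.
have [C' hC'] := bO_mul (bO_add bW bPE) bU'.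
exists C' => D; rewrite addn0 in hC'.
have -> : step_mx (sd_U' D) (sd_v D) (sd_v' D) (sd_w D) (sd_w' D) - sd_U D =
    su_proj (sd_E D - E D) * sd_U' D +
    (\prod_j c j D - 1 - su_proj (sd_E D) + (su_proj (E D) - E D)) * sd_U' D.
  have hU : sd_U D = (1 + E D) * sd_U' D.
    by rewrite E1 -mulrA SU_mulVl ?mulr1 //; exact: sd_U'_SU.
  rewrite [X in _ - X]hU su_projB /step_mx -/(c _ D); move: (\prod_j _) => W; ncring.
apply: le_trans (mxnD _ _) _; rewrite lerD //.
apply: le_trans (mxnM _ _) _; rewrite mulrAC; apply: ler_pM; rewrite ?mxn_ge0 ?mxn_su_proj //.
exact/mxn_SU/sd_U'_SU.
Qed.

End CommutatorStep.

(** * Gate words and nets *)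

Section OperatorNorm.
Variables (R : realType) (d : nat).
Local Notation M := 'M[R[i]]_d.
Implicit Types (A : M) (v : 'cV[R[i]]_d).

Lemma l2norm_ge_entry v i : nc (v i 0) <= l2norm v.
Proof.
rewrite /l2norm -[leLHS]ger0_norm ?nc_ge0 // -sqrtr_sqr ler_wsqrtr //.
by rewrite (bigD1 i) //= lerDl sumr_ge0 // => j _; rewrite sqr_ge0.
Qed.

Lemma l2norm_le_sum v : l2norm v <= \sum_i nc (v i 0).
Proof.
have s0 (r : seq 'I_d) : 0 <= \sum_(i <- r) nc (v i 0).
  by apply: sumr_ge0 => i _; exact: nc_ge0.
rewrite /l2norm -[leRHS]ger0_norm ?s0 // -sqrtr_sqr ler_wsqrtr //.
elim: (index_enum _) => [|i r IH]; first by rewrite !big_nil expr0n.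
rewrite !big_cons sqrrD -addrA lerD2l; apply: le_trans IH _.
by rewrite lerDr mulrn_wge0 // mulr_ge0 ?nc_ge0.
Qed.

Lemma l2norm_mulmx A v : l2norm v <= 1 -> l2norm (A *m v) <= mxn A.
Proof.
move=> v1; apply: le_trans (l2norm_le_sum _) _; apply: ler_sum => i _.
rewrite mxE; apply: le_trans (nc_sum _ _ _) _; apply: ler_sum => j _.
by rewrite ncM ler_piMr ?nc_ge0 // (le_trans (l2norm_ge_entry _ _)).
Qed.

Lemma opnorm_le A : opnorm A <= mxn A.
Proof.
apply: ge_sup; last by move=> _ [v v1 <-]; exact: l2norm_mulmx.
exists (l2norm (A *m 0)), 0 => //=.
by rewrite /l2norm big1 ?sqrtr0 // => i _; rewrite mxE nc0 expr0n.
Qed.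

Lemma mxn_le_opnorm A : mxn A <= (d ^ 2)%:R * opnorm A.
Proof.
apply: mxn_le_entries => i j; pose v : 'cV[R[i]]_d := delta_mx j 0.
have v1 : l2norm v <= 1.
  rewrite /l2norm (bigD1 j) //= big1 => [|k kj]; last first.
    by rewrite mxE (negbTE kj) nc0 expr0n.
  by rewrite mxE !eqxx nc1 expr1n addr0 sqrtr1.
have -> : A i j = (A *m v) i 0 by rewrite -colE mxE.
apply: le_trans (l2norm_ge_entry _ _) _; apply: ub_le_sup; last by exists v.
by exists (mxn A) => _ [u u1 <-]; exact: l2norm_mulmx.
Qed.

End OperatorNorm.

Section Words.
Variable n : nat.

(* Words are kept as binary trees, so that the results of recursive calls can be
   shared; V is the type of holes. *)
Inductive wform (V : Type) :=
| WVar of V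
| WGate of 'I_n
| WMul of wform V & wform V.

Definition wtree := wform void.

Fixpoint wsubst V (F : wform V) (s : V -> wtree) : wtree :=
  match F with
  | WVar x => s x
  | WGate k => WGate _ k
  | WMul F1 F2 => WMul (wsubst F1 s) (wsubst F2 s)
  end.

Fixpoint leaves V (F : wform V) : nat :=
  if F is WMul F1 F2 then leaves F1 + leaves F2 else 1.

Fixpoint wflat (t : wtree) : seq 'I_n :=
  match t with
  | WVar x => match x with end
  | WGate k => [:: k]
  | WMul t1 t2 => wflat t1 ++ wflat t2
  end.

Lemma size_wflat t : size (wflat t) = leaves t.
Proof. by elim: t => [[]|k|t1 IH1 t2 IH2] //=; rewrite size_cat IH1 IH2. Qed.

Lemma leaves_gt0 V (F : wform V) : (0 < leaves F)%N.
Proof. by elim: F => //= F1 IH1 F2 IH2; rewrite addn_gt0 IH1. Qed.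

Lemma leaves_subst V (F : wform V) s L : (0 < L)%N ->
  (forall x, leaves (s x) <= L)%N -> (leaves (wsubst F s) <= leaves F * L)%N.
Proof.
move=> L0 hs; elim: F => [x|k|F1 IH1 F2 IH2] /=; rewrite ?mul1n //.
by rewrite mulnDl leq_add.
Qed.

(* The exponent is m + 1. *)
Definition wpow V (k : 'I_n) m : wform V := iter m (WMul (WGate V k)) (WGate V k).

End Words.

Section WordMatrices.
Variables (R : realType) (d : nat) (G : seq 'M[R[i]]_d).
Local Notation M := 'M[R[i]]_d.

Fixpoint fmx V (F : wform (size G) V) (r : V -> M) : M :=
  match F with
  | WVar x => r x
  | WGate k => G`_k
  | WMul F1 F2 => fmx F1 r * fmx F2 r
  end.

Definition tmx (t : wtree (size G)) : M := fmx t (fun x => match x with end).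

Lemma tmx_subst V (F : wform (size G) V) s : tmx (wsubst F s) = fmx F (tmx \o s).
Proof.
rewrite /tmx; elim: F => [x|k|F1 IH1 F2 IH2] //=; last by rewrite -IH1 -IH2.
Qed.

Lemma word_mx_flat t : word_mx (wflat t) = tmx t.
Proof.
rewrite /word_mx /tmx -[LHS]/(\prod_(k <- wflat t) (G`_k : M)); elim: t => [[]|k|t1 IH1 t2 IH2] /=.
  by rewrite big_cons big_nil mulr1.
by rewrite big_cat -IH1 -IH2.
Qed.

Lemma fmx_pow V (r : V -> M) k m : fmx (wpow V k m) r = G`_k ^+ m.+1.
Proof.
by elim: m => [|m IH]; rewrite ?expr1 // exprS -IH.
Qed.

Hypothesis hG : forall A, A \in G -> in_SU A.

Lemma gate_SU (k : 'I_(size G)) : in_SU G`_k.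
Proof. by apply: hG; rewrite mem_nth. Qed.

Lemma fmx_SU V (F : wform (size G) V) r : (forall x, in_SU (r x)) -> in_SU (fmx F r).
Proof.
move=> hr; elim: F => [x|k|F1 IH1 F2 IH2] /=; [exact: hr|exact: gate_SU|exact: SUM].
Qed.

Lemma tmx_SU t : in_SU (tmx t).
Proof. by apply: fmx_SU; case. Qed.

End WordMatrices.

(** * Density of the monoid generated by the gates, and finite nets *)

Section Density.
Variables (R : realType) (d : nat).
Local Notation M := 'M[R[i]]_d.

(** Total boundedness by rounding: entries have real and imaginary parts in [-1, 1], so finitely
    many grid cells suffice. The finite type serves both the pigeonhole argument and the net. *)
Lemma SU_cells (e : R) : 0 < e -> exists (T : finType) (f : M -> T),
  forall U V : M, in_SU U -> in_SU V -> f U = f V -> mxn (U - V) <= e.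
Proof.
move=> e0; pose m := (Num.truncn ((d ^ 2)%:R * 2 / e)).+1.
have m0 : 0 < m%:R :> R by rewrite ltr0n.
have me : (d ^ 2)%:R * (2 / m%:R) <= e.
  rewrite mulrA ler_pdivrMr // [e * _]mulrC -ler_pdivrMr // ltW // /m.
  exact: truncnS_gt.
pose c (x : R) : 'I_(2 * m).+1 := inord (Num.truncn ((x + 1) * m%:R)).
have cP (x z : R) : `|x| <= 1 -> `|z| <= 1 -> c x = c z -> `|x - z| <= m%:R^-1.
  move=> x1 z1 /(congr1 val) /=.
  have b (t : R) : `|t| <= 1 -> 0 <= (t + 1) * m%:R /\
      (Num.truncn ((t + 1) * m%:R) < (2 * m).+1)%N.
    rewrite ler_norml => /andP[t0 t1]; have h : 0 <= (t + 1) * m%:R by nra.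
    split => //; rewrite truncn_lt_nat // -natr1 natrM; nra.
  have [x0 xb] := b _ x1; have [z0 zb] := b _ z1; rewrite !inordK // => E.
  have /andP[h1 h2] := truncn_itv x0; have /andP[] := truncn_itv z0.
  rewrite -E => h3 h4; rewrite -natr1 in h2 h4.
  rewrite -(ler_pM2r m0) mulVf ?gt_eqF // -{1}(gtr0_norm m0) -normrM ler_norml.
  by apply/andP; split; nra.
exists {ffun 'I_d * 'I_d -> 'I_(2 * m).+1 * 'I_(2 * m).+1}%type.
exists (fun U => [ffun p => (c (complex.Re (U p.1 p.2)), c (complex.Im (U p.1 p.2)))]).
move=> U V [hU _] [hV _] /ffunP E; apply: le_trans me; apply: mxn_le_entries => i j.
have := E (i, j); rewrite !ffunE /= => -[/cP hre /cP him].
apply: le_trans (nc_ReIm _) _.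
have reB (x z : R[i]) : complex.Re (x - z) = complex.Re x - complex.Re z by case: x z => ? ? [].
have imB (x z : R[i]) : complex.Im (x - z) = complex.Im x - complex.Im z by case: x z => ? ? [].
rewrite !mxE reB imB mulr_natl mulr2n lerD //.
  by apply: hre; apply: le_trans (nc_Re _) (unitary_entry _ _ _).
by apply: him; apply: le_trans (nc_Im _) (unitary_entry _ _ _).
Qed.

(* By compactness some power of B returns close to 1, so that B^-1 is close to a
   nonnegative power of B and the monoid generated by the gates is dense too. *)
Lemma SU_recurrence (B : M) (e : R) : in_SU B -> 0 < e ->
  exists n, mxn (B ^+ n.+1 - 1) <= e.
Proof.
move=> hB e0; have hX n := SUX n hB.
have D0 : 0 < (d ^ 2)%:R + 1 :> R by rewrite ltr_wpDl.
have [T [f hf]] := SU_cells (divr_gt0 e0 D0).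
pose h (n : 'I_#|T|.+1) := f (B ^+ n).
have /injectivePn[i [j ij hij]] : ~~ injectiveb h.
  by apply/injectiveP => /leq_card; rewrite card_ord ltnn.
wlog lt_ij : i j ij hij / (i < j)%N => [H|].
  case: (ltngtP i j) => [|ji|/val_inj E]; first exact: H.
    by apply: (H j i); rewrite // eq_sym.
  by rewrite E eqxx in ij.
exists (j - i).-1; rewrite prednK ?subn_gt0 //.
have -> : B ^+ (j - i) - 1 = adj (B ^+ i) * (B ^+ j - B ^+ i).
  rewrite mulrBr SU_mulVl // -{2}(subnKC (ltnW lt_ij)) exprD mulrA.
  by rewrite SU_mulVl // mul1r.
apply: le_trans (mxnM _ _) _; rewrite mxn_adj -[e](divfK (lt0r_neq0 D0)) mulrC.
rewrite ler_pM ?mxn_ge0 //; last by rewrite (le_trans (mxn_SU (hX i))) // lerDl.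
by apply: hf => //; exact: esym.
Qed.

Variable G : seq M.
Hypothesis hG : universal G.
Variable k0 : 'I_(size G).
Hypothesis gate_period : exists m, G`_k0 ^+ m.+1 = 1.

Definition reachable (B : M) :=
  forall e : R, 0 < e -> exists t : wtree (size G), mxn (tmx t - B) <= e.

Let hSU : forall A, A \in G -> in_SU A := proj1 hG.
Let D : R := (d ^ 2)%:R.
Let scaled (e : R) : 0 < e -> exists2 x : R, 0 < x & e = x * (2 * (D + 1)).
Proof.
move=> e0; have D0 : 0 < 2 * (D + 1) by rewrite mulr_gt0 // ltr_wpDl.
by exists (e / (2 * (D + 1))); [rewrite divr_gt0 | rewrite divfK // lt0r_neq0].
Qed.

(** Trees have at least one leaf and so cannot denote the empty word; a gate of finite order
    supplies the identity. *)
Lemma reachable1 : reachable 1.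
Proof.
have [m hm] := gate_period; move=> e e0; exists (wpow _ k0 m).
by rewrite /tmx fmx_pow hm subrr mxn0 ltW.
Qed.

Lemma reachableM A B : in_SU B -> reachable A -> reachable B -> reachable (A * B).
Proof.
move=> hB hA' hB' _ /scaled[x x0 ->].
have [t ht] := hA' _ x0; have [u hu] := hB' _ x0; exists (WMul t u).
have -> : tmx (WMul t u) - A * B = tmx t * (tmx u - B) + (tmx t - A) * B.
  rewrite -[tmx (WMul t u)]/(tmx t * tmx u); ncring.
have h1 : mxn (tmx t * (tmx u - B)) <= D * x.
  by rewrite (le_trans (mxnM _ _)) // ler_pM ?mxn_ge0 // (mxn_SU (tmx_SU hSU t)).
have h2 : mxn ((tmx t - A) * B) <= x * D.
  by rewrite (le_trans (mxnM _ _)) // ler_pM ?mxn_ge0 // (mxn_SU hB).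
by apply: le_trans (mxnD _ _) _; nra.
Qed.

Lemma reachable_inv B : in_SU B -> reachable B -> reachable (adj B).
Proof.
move=> hB rB _ /scaled[x x0 ->]; have [n hn] := SU_recurrence hB x0.
have [t ht] : exists t : wtree (size G), mxn (tmx t - B ^+ n) <= x.
  suff : reachable (B ^+ n) by exact.
  elim: (n) => [|m IH]; first by rewrite expr0; exact: reachable1.
  by rewrite exprSr; apply: reachableM.
exists t; apply: le_trans (mxn_tri (B ^+ n) _ _) _.
have -> : B ^+ n - adj B = (B ^+ n.+1 - 1) * adj B.
  by rewrite mulrBl mul1r exprSr -mulrA SU_mulVr ?mulr1.
have h : mxn ((B ^+ n.+1 - 1) * adj B) <= x * D.
  by rewrite (le_trans (mxnM _ _)) // ler_pM ?mxn_ge0 // (mxn_SU (SU_adj hB)).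
nra.
Qed.

Lemma generated_reachable B : Defs.generated G B -> in_SU B /\ reachable B.
Proof.
elim=> [|A AG|A _ [hA rA]|A B' _ [hA rA] _ [hB rB]].
- by split; [exact: SU1 | exact: reachable1].
- split; first exact: hSU.
  move=> e e0; have lt : (index A G < size G)%N by rewrite index_mem.
  exists (WGate _ (Ordinal lt)); rewrite /tmx /= nth_index // subrr mxn0.
  exact: ltW.
- have [uA _] := hA; rewrite invmx_unitary // -/(adj A).
  by split; [exact: SU_adj | exact: reachable_inv].
by split; [exact: SUM | exact: reachableM].
Qed.

Lemma SU_reachable U : in_SU U -> reachable U.
Proof.
move=> hU _ /scaled[x x0 ->]; have [B genB hB] := proj2 hG U hU _ x0.
have [_ rB] := generated_reachable genB; have [t ht] := rB _ x0; exists t.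
apply: le_trans (mxn_tri B _ _) _.
have h : mxn (B - U) <= D * x.
  by rewrite (le_trans (mxn_le_opnorm _)) // ler_wpM2l // ltW.
nra.
Qed.

Lemma SU_net (e : R) : 0 < e ->
  exists (T : finType) (net : T -> wtree (size G)),
    forall U : M, in_SU U -> exists c, mxn (tmx (net c) - U) <= e.
Proof.
move=> e0; have e2 : 0 < e / 2 by rewrite divr_gt0.
have [T [f hf]] := SU_cells e2; exists T.
have /choice[net hnet] : forall c : T, exists t : wtree (size G),
    forall U : M, in_SU U -> f U = c -> mxn (tmx t - U) <= e.
  move=> c; have [[U [hU Uc]]|no] := pselect (exists U : M, in_SU U /\ f U = c).
    have [t ht] := SU_reachable hU e2; exists t => V hV Vc.
    apply: le_trans (mxn_tri U _ _) _; rewrite [e]splitr lerD //.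
    by apply: hf; rewrite ?Uc.
  (* Cells that miss SU(d) receive an arbitrary word. *)
  exists (WGate _ k0) => V hV Vc; case: no; by exists V.
by exists net => U hU; exists (f U); exact: hnet.
Qed.

End Density.

(** * Cost semantics *)

Section Semantics.
Local Open Scope nat_scope.
Variables (P : program) (O : oracle).

Fixpoint vbits (B : nat) (v : Defs.val) : bool :=
  match v with VInt z => bits z <= B | VPair u w => vbits B u && vbits B w end.

Lemma vbits_le B B' v : B <= B' -> vbits B v -> vbits B' v.
Proof.
move=> BB'; elim: v => [z|u IHu w IHw] /=; first by move/leq_trans; apply.
by move=> /andP[/IHu -> /IHw ->].
Qed.

Lemma absz_lt_bits z : `|z|%N < 2 ^ bits z.
Proof. exact: trunc_log_ltn. Qed.

Lemma bits_le z n : 0 < n -> `|z|%N < 2 ^ n -> bits z <= n.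
Proof.
move=> n0 zn; rewrite /bits; case: (posnP `|z|%N) => [->|z0].
  by rewrite trunc_log0.
by rewrite -(ltn_exp2l _ _ (isT : 1 < 2)) (leq_ltn_trans _ zn) // trunc_logP.
Qed.

Lemma bits_arith o x y : bits (arith_fun o x y) <= bits x + bits y.
Proof.
have hx := absz_lt_bits x; have hy := absz_lt_bits y.
have x0 : 0 < 2 ^ bits x by rewrite expn_gt0.
have y0 : 0 < 2 ^ bits y by rewrite expn_gt0.
have x2 : 2 <= 2 ^ bits x by rewrite -{1}(expn1 2) leq_exp2l.
have y2 : 2 <= 2 ^ bits y by rewrite -{1}(expn1 2) leq_exp2l.
apply: bits_le; first by rewrite addn_gt0.
have sum_le : `|x|%N + `|y|%N < 2 ^ (bits x + bits y).
  rewrite expnD; move: (2 ^ _) (2 ^ _) x2 y2 hx hy {x0 y0} => a b; nia.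
case: o => /=; [| | |].
- by apply: leq_ltn_trans sum_le; lia.
- by apply: leq_ltn_trans sum_le; lia.
- by rewrite abszM expnD ltn_mul.
apply: leq_ltn_trans (lez_div _ _) (leq_trans hx _).
by rewrite leq_exp2l // leq_addr.
Qed.

(* Evaluation without a cost, calls being allowed only when they run in time T
   and return integers of at most S bits, and oracle queries only when their
   precision is at most T. *)
Inductive dv (T S : nat) (env : seq Defs.val) : expr -> Defs.val -> Prop :=
| dv_var n v : onth env n = Some v -> dv T S env (EVar n) v
| dv_int z : dv T S env (EInt z) (VInt z)
| dv_pair e1 e2 v1 v2 : dv T S env e1 v1 -> dv T S env e2 v2 ->
    dv T S env (EPair e1 e2) (VPair v1 v2)
| dv_fst e v1 v2 : dv T S env e (VPair v1 v2) -> dv T S env (EFst e) v1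
| dv_snd e v1 v2 : dv T S env e (VPair v1 v2) -> dv T S env (ESnd e) v2
| dv_arith o e1 e2 x y : dv T S env e1 (VInt x) -> dv T S env e2 (VInt y) ->
    dv T S env (EArith o e1 e2) (VInt (arith_fun o x y))
| dv_if e0 e1 e2 v0 v : dv T S env e0 v0 ->
    dv T S env (if truthy v0 then e1 else e2) v -> dv T S env (EIf e0 e1 e2) v
| dv_call f e body v1 v t : dv T S env e v1 -> onth (funs P) f = Some body ->
    Defs.eval P O [:: v1] body v t -> t <= T -> vbits S v -> dv T S env (ECall f e) v
| dv_ask e1 e2 a (p : nat) : dv T S env e1 a -> dv T S env e2 (VInt p%:Z) ->
    p <= T -> bits (O a p) <= S -> dv T S env (EAsk e1 e2) (VInt (O a p)).

(* [dv] has no rule for [ELet], whose value here is a dummy. *)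
Fixpoint ecost (e : expr) : nat :=
  match e with
  | EVar _ => 1
  | EInt z => bits z
  | EPair e1 e2 => (ecost e1 + ecost e2).+1
  | EFst e | ESnd e => (ecost e).+1
  | EArith _ e1 e2 => (ecost e1 + ecost e2 + ecost e1 * ecost e2).+1
  | EIf e0 e1 e2 => (ecost e0 + ecost e1 + ecost e2).+1
  | ELet e1 e2 => 1
  | ECall _ e => (ecost e).+2
  | EAsk e1 e2 => (ecost e1 + ecost e2).+3
  end.

(** One number [ecost e] bounds both the growth of bit lengths, in units of B, and the time, in
    units of B^2 + T: an arithmetic operation costs at most [ecost e1 * ecost e2 * B^2]. For a fixed
    function body it is a constant. *)
Theorem dv_eval T S B env e v : 0 < B -> S <= B -> all (vbits B) env ->
  dv T S env e v ->
  exists2 t, Defs.eval P O env e v t & t <= ecost e * (B ^ 2 + T) /\ vbits (ecost e * B) v.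
Proof.
move=> B0 SB hB; have BB : 0 < B ^ 2 + T by rewrite addn_gt0 expn_gt0 B0.
set Q := B ^ 2 + T in BB *; elim.
- move=> n w hn; exists 1; first exact: ev_var.
  rewrite /= !mul1n; split=> //.
  elim: env n hn hB => [|u env IH] [|n] //= => [[<-]|]; first by case/andP.
  by move=> hn /andP[_ henv]; exact: IH hn henv.
- move=> z; exists 1; first exact: ev_int.
  rewrite /= muln_gt0 BB; split=> //.
  by rewrite -{1}[bits z]muln1 leq_mul2l B0 orbT.
- move=> e1 e2 v1 v2 _ [t1 h1 [l1 b1]] _ [t2 h2 [l2 b2]].
  exists (t1 + t2).+1; first exact: ev_pair.
  split; first by rewrite /=; nia.
  by apply/andP; split; [move: b1 | move: b2]; apply: vbits_le; rewrite leq_mul2r /=; lia.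
- move=> e1 v1 v2 _ [t h [l /andP[b _]]]; exists t.+1; first exact: ev_fst h.
  split; first by rewrite /=; nia.
  by apply: vbits_le b; rewrite leq_mul2r /=; lia.
- move=> e1 v1 v2 _ [t h [l /andP[_ b]]]; exists t.+1; first exact: ev_snd h.
  split; first by rewrite /=; nia.
  by apply: vbits_le b; rewrite leq_mul2r /=; lia.
- move=> o e1 e2 x y _ [t1 h1 [l1 b1]] _ [t2 h2 [l2 b2]].
  exists (t1 + t2 + bits x * bits y).+1; first exact: ev_arith.
  have hm : bits x * bits y <= ecost e1 * ecost e2 * Q.
    apply: leq_trans (leq_mul b1 b2) _; rewrite mulnACA leq_mul2l mulnn.
    by apply/orP; right; exact: leq_addr.
  split; first by rewrite /=; nia.
  rewrite /=; apply: leq_trans (bits_arith _ _ _) _; move: b1 b2 => /= b1 b2.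
  nia.
- move=> e0 e1 e2 v0 w _ [t0 h0 [l0 b0]] _ [t h [l b]].
  exists (t0 + t).+1; first exact: ev_if h.
  by case: (truthy v0) l b => l b; (split; [rewrite /=; nia |
     apply: vbits_le b; rewrite leq_mul2r /=; lia]).
- move=> f e1 body v1 w t _ [t1 h1 [l1 b1]] hf h hT hS.
  exists (t1 + t).+1; first exact: ev_call h.
  have TQ : T <= Q by exact: leq_addl.
  split; first by rewrite /=; nia.
  by apply: vbits_le hS; rewrite (leq_trans SB) //= leq_pmull.
move=> e1 e2 a p _ [t1 h1 [l1 b1]] _ [t2 h2 [l2 b2]] pT hS.
exists (t1 + t2 + p + bits (O a p)).+1; first exact: ev_ask.
have TQ : T <= Q by exact: leq_addl.
have SQ : S <= Q.
  by apply: leq_trans SB (leq_trans _ (leq_addr _ _)); rewrite -mulnn leq_pmull.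
split; first by rewrite /=; nia.
by rewrite /= (leq_trans hS) // (leq_trans SB) //= leq_pmull.
Qed.

End Semantics.

(** * Program expressions for finite sums and matrix arithmetic *)

Section Combinators.
Variables (P : program) (O : oracle) (T S : nat) (env : seq Defs.val).
Local Notation dv := (dv P O T S env).

(** Finite functions are lists in the order of [enum I]. As d is fixed, every loop over indices is
    unrolled into the expression. *)
Definition fval (I : finType) (f : I -> int) : Defs.val :=
  foldr (fun i v => VPair (VInt (f i)) v) (VInt 0) (enum I).

Definition EEntry (I : finType) (e : expr) (i : I) : expr :=
  EFst (iter (index i (enum I)) ESnd e).

Definition EFun (I : finType) (f : I -> expr) : expr :=
  foldr (fun i e => EPair (f i) e) (EInt 0) (enum I).

Definition ESum (I : finType) (f : I -> expr) : expr :=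
  foldr (fun i e => EArith Add (f i) e) (EInt 0) (enum I).

Lemma dv_entry (I : finType) (f : I -> int) e i :
  dv e (fval f) -> dv (EEntry e i) (VInt (f i)).
Proof.
rewrite /fval /EEntry => he.
have : i \in enum I by rewrite mem_enum.
elim: (enum I) e he => //= j s IH e he; rewrite inE eq_sym.
case: (eqVneq j i) he => [-> he _|_ he /= hi]; first exact: dv_fst he.
by rewrite -iterS iterSr; exact: IH (dv_snd he) hi.
Qed.

Lemma dv_fun (I : finType) (e : I -> expr) (f : I -> int) :
  (forall i, dv (e i) (VInt (f i))) -> dv (EFun e) (fval f).
Proof.
move=> h; rewrite /EFun /fval; elim: (enum I) => [|i s IH] /=; first exact: dv_int.
exact: dv_pair.
Qed.

Lemma dv_sum (I : finType) (e : I -> expr) (f : I -> int) :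
  (forall i, dv (e i) (VInt (f i))) -> dv (ESum e) (VInt (\sum_i f i)).
Proof.
move=> h; rewrite /ESum -big_enum; elim: (enum I) => [|i s IH] /=.
  by rewrite big_nil; exact: dv_int.
by rewrite big_cons; exact: (dv_arith Add (h i) IH).
Qed.

Variable d : nat.
Local Notation zmx := (zmx d).
Definition midx : finType := ('I_d * 'I_d * bool)%type.

Definition zent (A : zmx) (x : midx) : int :=
  if x.2 then A.2 x.1.1 x.1.2 else A.1 x.1.1 x.1.2.

Definition zadd (A B : zmx) : zmx := (A.1 + B.1, A.2 + B.2).
Definition zscl (c : int) (A : zmx) : zmx := (c *: A.1, c *: A.2).
Definition zmul (A B : zmx) : zmx :=
  (A.1 *m B.1 - A.2 *m B.2, A.1 *m B.2 + A.2 *m B.1).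
Definition zadj (A : zmx) : zmx := (A.1^T, - A.2^T).
Definition zdiv (c : int) (A : zmx) : zmx :=
  (map_mx (fun z => (z %/ c)%Z) A.1, map_mx (fun z => (z %/ c)%Z) A.2).
Definition zone : zmx := (1%:M, 0).

(** At program level a matrix is a family of expressions, one for each entry. Operands are copied
    and evaluated anew at each occurrence, recursive calls included; this only increases a
    constant. *)
Definition MAdd (a b : midx -> expr) (x : midx) := EArith Add (a x) (b x).
Definition MScl (c : expr) (a : midx -> expr) (x : midx) := EArith Mul c (a x).
Definition MDiv (c : expr) (a : midx -> expr) (x : midx) := EArith Div (a x) c.
Definition MCst (A : zmx) (x : midx) := EInt (zent A x).
Definition MAdj (a : midx -> expr) (x : midx) :=
  let: (i, j, t) := x in
  if t then EArith Defs.Sub (EInt 0) (a (j, i, true)) else a (j, i, false).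
Definition MMul (a b : midx -> expr) (x : midx) :=
  let: (i, j, t) := x in
  if t then ESum (fun k : 'I_d => EArith Add
      (EArith Mul (a (i, k, false)) (b (k, j, true)))
      (EArith Mul (a (i, k, true)) (b (k, j, false))))
  else ESum (fun k : 'I_d => EArith Defs.Sub
      (EArith Mul (a (i, k, false)) (b (k, j, false)))
      (EArith Mul (a (i, k, true)) (b (k, j, true)))).

Definition mdv (a : midx -> expr) (A : zmx) := forall x, dv (a x) (VInt (zent A x)).

Lemma mdv_add a b A B : mdv a A -> mdv b B -> mdv (MAdd a b) (zadd A B).
Proof.
move=> ha hb x; have -> : zent (zadd A B) x = arith_fun Add (zent A x) (zent B x).
  by rewrite /zent; case: x.2; rewrite mxE.
exact: dv_arith.
Qed.

Lemma mdv_scl c a z A : dv c (VInt z) -> mdv a A -> mdv (MScl c a) (zscl z A).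
Proof.
move=> hc ha x; have -> : zent (zscl z A) x = arith_fun Mul z (zent A x).
  by rewrite /zent; case: x.2; rewrite mxE.
exact: dv_arith.
Qed.

Lemma mdv_div c a z A : dv c (VInt z) -> mdv a A -> mdv (MDiv c a) (zdiv z A).
Proof.
move=> hc ha x; have -> : zent (zdiv z A) x = arith_fun Div (zent A x) z.
  by rewrite /zent; case: x.2; rewrite mxE.
exact: dv_arith.
Qed.

Lemma mdv_cst A : mdv (MCst A) A.
Proof. by move=> x; exact: dv_int. Qed.

Lemma mdv_adj a A : mdv a A -> mdv (MAdj a) (zadj A).
Proof.
move=> ha [[i j] []] /=.
  have -> : zent (zadj A) (i, j, true) = arith_fun Defs.Sub 0 (zent A (j, i, true)).
    by rewrite /zent /= !mxE sub0r.
  by apply: dv_arith => //; exact: dv_int.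
have -> : zent (zadj A) (i, j, false) = zent A (j, i, false) by rewrite /zent /= !mxE.
exact: ha.
Qed.

Lemma mdv_mul a b A B : mdv a A -> mdv b B -> mdv (MMul a b) (zmul A B).
Proof.
move=> ha hb [[i j] []] /=.
  have -> : zent (zmul A B) (i, j, true) = \sum_k arith_fun Add
      (arith_fun Mul (zent A (i, k, false)) (zent B (k, j, true)))
      (arith_fun Mul (zent A (i, k, true)) (zent B (k, j, false))).
    by rewrite /zent /= !mxE -big_split.
  by apply: dv_sum => k; do !apply: dv_arith.
have -> : zent (zmul A B) (i, j, false) = \sum_k arith_fun Defs.Sub
    (arith_fun Mul (zent A (i, k, false)) (zent B (k, j, false)))
    (arith_fun Mul (zent A (i, k, true)) (zent B (k, j, true))).
  by rewrite /zent /= !mxE -sumrB.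
by apply: dv_sum => k; do !apply: dv_arith.
Qed.

End Combinators.

(** * Fixed-point arithmetic *)

Section FixedPoint.
Variables (R : realType) (d : nat).
Local Notation M := 'M[R[i]]_d.
Local Notation zv := (@zval R d).
Implicit Types (A B : zmx d).

Lemma zval_add A B : zv (zadd A B) = zv A + zv B.
Proof. by rewrite /zval !map_mxD scalerDr addrACA. Qed.

Lemma zval_scl c A : zv (zscl c A) = c%:~R *: zv A.
Proof.
by rewrite /zval /= !map_mxZ scalerDr !scalerA mulrC.
Qed.

Lemma zval_mul A B : zv (zmul A B) = zv A * zv B.
Proof.
rewrite /zval /= map_mxB map_mxD !map_mxM.
move: (map_mx _ A.1) (map_mx _ A.2) (map_mx _ B.1) (map_mx _ B.2) => a b c e.
rewrite -![_ *m _]/(_ * _) mulrDl !mulrDr !mulZl !mulZr scalerA -expr2 sqrCi scaleN1r.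
rewrite scalerDr; set u := 'i *: _; set v := 'i *: _; ncring.
Qed.

Lemma zval_adj A : zv (zadj A) = adj (zv A).
Proof.
have adj_int (X : 'M[int]_d) : adj (map_mx intr X) = map_mx intr X^T.
  by apply/matrixP => i j; rewrite adjE !mxE rmorph_int.
by rewrite /zval /= adjD adjZ !adj_int map_mxN conjCi scalerN scaleNr.
Qed.

Lemma zval_one : zv (zone d) = 1.
Proof. by rewrite /zval /= map_mx0 scaler0 addr0 map_mx1. Qed.

Lemma zval_entry A i j : zv A i j = (((A.1 i j)%:~R : R) +i* ((A.2 i j)%:~R : R))%C.
Proof.
rewrite !mxE [RHS]complexE /= complexiE.
by rewrite -[RHS]/(_ + _) !rmorph_int.
Qed.

Lemma mxn_zdiv n A : (0 < n)%N ->
  mxn (zv (zdiv n%:Z A) - n%:R^-1 *: zv A) <= (d ^ 2)%:R * 2.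
Proof.
move=> n0; apply: mxn_le_entries => i j.
have dv1 (z : int) : `|((z %/ n)%Z%:~R : R) - n%:R^-1 * z%:~R| <= 1.
  have n0' : 0 < n%:R :> R by rewrite ltr0n.
  have E : z%:~R = (z %/ n)%Z%:~R * n%:R + (z %% n)%Z%:~R :> R.
    by rewrite {1}(divz_eq z n) rmorphD rmorphM.
  have m0 : 0 <= (z %% n)%Z%:~R :> R by rewrite ler0z modz_ge0 // lt0n_neq0.
  have mn : (z %% n)%Z%:~R <= n%:R :> R.
    by rewrite -[n%:R]/((n%:Z)%:~R) ler_int ltW // ltz_mod // lt0n_neq0.
  have -> : ((z %/ n)%Z%:~R : R) - n%:R^-1 * z%:~R = - ((z %% n)%Z%:~R / n%:R).
    by rewrite E; field; lra.
  by rewrite normrN ger0_norm ?divr_ge0 // ler_pdivrMr ?mul1r.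
have E (X Y : M) c : (X - c *: Y) i j = X i j - c * Y i j by rewrite !mxE.
rewrite E !zval_entry !mxE.
apply: le_trans (nc_ReIm _) _; rewrite [2]mulr2n.
have -> : (n%:R : R[i]) = (n%:R%:C)%C by rewrite rmorph_nat.
rewrite -fmorphV; simpc => /=.
by rewrite lerD.
Qed.

Definition appr (p : nat) A : M := (2 ^- p)%:C%C *: zv A.

Lemma ofR_pow p : ((2 ^ p)%:Z)%:~R = (2 ^+ p)%:C%C :> R[i].
Proof. by rewrite -[LHS]/((2 ^ p)%:R) natrX rmorphXn rmorph_nat. Qed.

Lemma ofR_powV p : (2 ^- p)%:C%C * (2 ^+ p)%:C%C = 1 :> R[i].
Proof. by rewrite -rmorphM mulVf // expf_neq0 // pnatr_eq0. Qed.

Lemma natrV_pow p : (2 ^ p)%:R^-1 = (2 ^- p)%:C%C :> R[i].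
Proof. by rewrite natrX fmorphV rmorphXn rmorph_nat. Qed.

Lemma appr_one p : appr p (zscl (2 ^ p)%:Z (zone d)) = 1.
Proof. by rewrite /appr zval_scl zval_one scalerA ofR_pow ofR_powV scale1r. Qed.

Lemma appr_add p A B : appr p (zadd A B) = appr p A + appr p B.
Proof. by rewrite /appr zval_add scalerDr. Qed.

Lemma appr_scl p c A : appr p (zscl c A) = c%:~R *: appr p A.
Proof. by rewrite /appr zval_scl !scalerA mulrC. Qed.

Lemma appr_adj p A : appr p (zadj A) = adj (appr p A).
Proof.
rewrite /appr zval_adj adjZ; congr (_ *: _); rewrite -[_^*]/(conjc _).
by rewrite conjc_real.
Qed.

Lemma appr_div p n A : (0 < n)%N ->
  mxn (appr p (zdiv n%:Z A) - n%:R^-1 *: appr p A) <= (d ^ 2)%:R * 2 * 2 ^- p.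
Proof.
move=> n0; have -> : appr p (zdiv n%:Z A) - n%:R^-1 *: appr p A =
    (2 ^- p)%:C%C *: (zv (zdiv n%:Z A) - n%:R^-1 *: zv A).
  by rewrite /appr scalerBr !scalerA [_%:R^-1 * _]mulrC.
rewrite mxnZ nc_real ger0_norm ?invr_ge0 ?exprn_ge0 // mulrC.
by rewrite ler_wpM2r ?invr_ge0 ?exprn_ge0 // mxn_zdiv.
Qed.

Definition zmulr p A B := zdiv (2 ^ p)%:Z (zmul A B).

Lemma appr_mul p A B :
  mxn (appr p (zmulr p A B) - appr p A * appr p B) <= (d ^ 2)%:R * 2 * 2 ^- p.
Proof.
have -> : appr p A * appr p B = (2 ^ p)%:R^-1 *: appr p (zmul A B).
  rewrite /appr zval_mul mulZl mulZr !scalerA; congr (_ *: _).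
  by rewrite natrV_pow.
by apply: appr_div; rewrite expn_gt0.
Qed.

Lemma appr_bits p c A x : mxn (appr p A) <= 2 ^+ c -> (bits (zent A x) <= p + c + 1)%N.
Proof.
move=> hA; apply: bits_le; first by rewrite addn1.
have h : `|(zent A x)%:~R : R| <= 2 ^+ (p + c).
  case: x => -[i j] t; have : nc (zv A i j) <= 2 ^+ (p + c).
    have E : zv A = (2 ^+ p)%:C%C *: appr p A.
      by rewrite /appr scalerA mulrC ofR_powV scale1r.
    rewrite E mxE ncM nc_real ger0_norm ?exprn_ge0 // exprD ler_wpM2l ?exprn_ge0 //.
    exact: le_trans (mxn_entry _ _ _) hA.
  rewrite zval_entry; apply: le_trans; case: t.
    exact: (nc_Im (Complex _ _)).
  exact: (nc_Re (Complex _ _)).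
rewrite -(ltr_nat R) natrX addn1 exprS; apply: le_lt_trans (_ : _ <= 2 ^+ (p + c)) _.
  by rewrite -intr_norm in h; rewrite -[X in X <= _]/((`|zent A x|%N%:Z)%:~R) abszE.
by rewrite ltr_pMl ?exprn_gt0 // ltr1n.
Qed.

End FixedPoint.

Section WordPrograms.
Variables (n d : nat).

Fixpoint znum p V (gz : 'I_n -> zmx d) (F : wform n V) (r : V -> zmx d) : zmx d :=
  match F with
  | WVar x => r x
  | WGate k => gz k
  | WMul F1 F2 => zmulr p (znum p gz F1 r) (znum p gz F2 r)
  end.

(* Gate k is encoded by the falsy integer -k, whereas pairs are truthy: this is how
   [flat_body] tells leaves from nodes. *)
Fixpoint tval (t : wtree n) : Defs.val :=
  match t with
  | WVar x => match x with end
  | WGate k => VInt (- (k : nat)%:Z)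
  | WMul t1 t2 => VPair (tval t1) (tval t2)
  end.

Definition zvalue (A : zmx d) : Defs.val := fval (zent A).
Definition wval t A := VPair (tval t) (zvalue A).

Fixpoint EList (s : seq nat) : expr :=
  if s is k :: s' then EPair (EInt k%:Z) (EList s') else EInt 0.

(* Entry x of U (k = 0) or of the gate of index k - 1. *)
Definition MAsk (k : nat) (pe : expr) (x : midx d) : expr :=
  let: (i, j, t) := x in EAsk (EList [:: k; i : nat; j : nat; t : nat]) pe.

Definition zask (O : oracle) (p k : nat) : zmx d :=
  (\matrix_(i, j) O (vlist [:: k; i : nat; j : nat; 0%N]) p,
   \matrix_(i, j) O (vlist [:: k; i : nat; j : nat; 1%N]) p).

Definition EPow2 (e : expr) := ECall 0 e.

Fixpoint EWord V (pe : expr) (F : wform n V) (ve : V -> expr) : expr :=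
  match F with
  | WVar x => ve x
  | WGate k => EPair (EInt (- (k : nat)%:Z)) (EFun (MAsk k.+1 pe))
  | WMul F1 F2 =>
    let e1 := EWord pe F1 ve in let e2 := EWord pe F2 ve in
    EPair (EPair (EFst e1) (EFst e2))
      (EFun (MDiv (EPow2 pe) (MMul (@EEntry (midx d) (ESnd e1)) (@EEntry (midx d) (ESnd e2)))))
  end.

End WordPrograms.

Section WordNumerics.
Variables (R : realType) (d : nat) (G : seq 'M[R[i]]_d).
Local Notation M := 'M[R[i]]_d.
Local Notation n := (size G).
Hypothesis d_gt0 : (0 < d)%N.
Hypothesis hSU : forall A, A \in G -> in_SU A.

Lemma mul_sub_split (A B X Y : M) : A * B - X * Y = (A - X) * B + X * (B - Y).
Proof. ncring. Qed.

(** The constant depends on the form alone, not on the precision or the matrices, so the same one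
    serves the step form at all levels. *)
Lemma znum_err V (F : wform n V) : exists2 C : R, 0 <= C &
  forall p (gz : 'I_n -> zmx d) (s : V -> M) (r : V -> zmx d) (e : R),
    (forall k : 'I_n, mxn (appr R p (gz k) - G`_k) <= e) ->
    (forall x, in_SU (s x)) -> (forall x, mxn (appr R p (r x) - s x) <= e) ->
    (d ^ 2)%:R * 2 * 2 ^- p <= e -> e <= 1 ->
    mxn (appr R p (znum p gz F r) - fmx F s) <= C * e.
Proof.
elim: F => [x|k|F1 [C1 C10 h1] F2 [C2 C20 h2]].
- by exists 1 => // p gz s r e _ _ hr _ _; rewrite mul1r; exact: hr.
- by exists 1 => // p gz s r e hg _ _ _ _; rewrite mul1r; exact: hg.
have D0 : 0 <= (d ^ 2)%:R :> R by [].
exists (1 + C1 * ((d ^ 2)%:R + C2) + (d ^ 2)%:R * C2).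
  by rewrite addr_ge0 ?mulr_ge0 // addr_ge0 ?mulr_ge0 // addr_ge0.
move=> p gz s r e hg hs hr pe e1; rewrite [znum _ _ _ _]/= [fmx _ _]/=.
set A := znum p gz F1 r; set B := znum p gz F2 r.
have hA := h1 p gz s r e hg hs hr pe e1; have hB := h2 p gz s r e hg hs hr pe e1.
have e0 : 0 <= e by apply: le_trans pe; rewrite !mulr_ge0 // invr_ge0 exprn_ge0.
have X1 := mxn_SU (fmx_SU hSU F1 hs); have X2 := mxn_SU (fmx_SU hSU F2 hs).
have bB : mxn (appr R p B) <= (d ^ 2)%:R + C2.
  rewrite -[appr R p B](subrK (fmx F2 s)) addrC (le_trans (mxnD _ _)) // lerD //.
  by rewrite (le_trans hB) // ler_piMr.
apply: le_trans (mxn_tri (appr R p A * appr R p B) _ _) _.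
rewrite mul_sub_split -addrA [leRHS]mulrDl mul1r lerD ?(le_trans (appr_mul _ _ _ _)) //.
apply: le_trans (mxnD _ _) _; rewrite [leRHS]mulrDl lerD //; apply: le_trans (mxnM _ _) _.
  by rewrite mulrAC ler_pM ?mxn_ge0.
by rewrite -mulrA ler_pM ?mxn_ge0.
Qed.

Definition presents_at (O : oracle) (k : nat) (A : M) := forall i j : 'I_d,
  approximates O (vlist [:: k; i : nat; j : nat; 0%N]) (complex.Re (A i j)) /\
  approximates O (vlist [:: k; i : nat; j : nat; 1%N]) (complex.Im (A i j)).

Lemma appr_ask O p k A : presents_at O k A ->
  mxn (appr R p (zask d O p k) - A) <= (d ^ 2)%:R * 2 * 2 ^- p.
Proof.
move=> hk; rewrite -mulrA; apply: mxn_le_entries => i j.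
have [/(_ p) hre /(_ p) him] := hk i j.
have E (X Y : M) c : (c *: X - Y) i j = c * X i j - Y i j by rewrite !mxE.
rewrite /appr E zval_entry !mxE; apply: le_trans (nc_ReIm _) _.
rewrite mulrDl !mul1r; move: hre him; case: (A i j) => a b /= hre him.
rewrite mul0r subr0 mul0r addr0; apply: lerD; rewrite distrC mulrC //.
Qed.

Variables (P : program) (O : oracle) (T S : nat) (env : seq Defs.val).
Local Notation dv := (dv P O T S env).

Lemma dv_list s : dv (EList s) (vlist s).
Proof. by elim: s => [|k s IH] /=; [exact: dv_int | apply: dv_pair => //; exact: dv_int]. Qed.

Lemma dv_MAsk k pe p A : presents_at O k A -> in_SU A ->
  dv pe (VInt p%:Z) -> (p <= T)%N -> (p + 2 <= S)%N ->
  mdv P O T S env (MAsk k pe) (zask d O p k).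
Proof.
move=> hk [hA _] hp pT pS [[i j] t].
(* The answer for a number in [-1, 1] is at most 2^p + 1 in absolute value, hence has at most p + 2
   bits. *)
have bO_ a (x : R) : approximates O a x -> `|x| <= 1 -> (bits (O a p) <= S)%N.
  move=> /(_ p) h x1; apply: leq_trans pS; apply: bits_le; first by rewrite addn2.
  have p0 : 0 < 2 ^+ p :> R by rewrite exprn_gt0.
  have h2 : `|(O a p)%:~R : R| <= 2 ^+ p + 1.
    have -> : (O a p)%:~R = 2 ^+ p * (x - (x - (O a p)%:~R / 2 ^+ p)) :> R.
      by field; rewrite expf_neq0 // pnatr_eq0.
    have -> : 2 ^+ p + 1 = 2 ^+ p * (1 + 2 ^- p) :> R.
      by rewrite mulrDr mulr1 mulfV // lt0r_neq0.
    rewrite normrM gtr0_norm // ler_wpM2l ?(ltW p0) //.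
    by rewrite (le_trans (ler_normB _ _)) // lerD.
  rewrite -(ltr_nat R) natrX addn2 !exprS mulrA.
  rewrite -[X in X < _]/((`|O a p|%N%:Z)%:~R) abszE intr_norm.
  have : 1 <= 2 ^+ p :> R by rewrite exprn_ege1 // ler1n.
  by move: (2 ^+ p) h2 => q; lra.
have [hre him] := hk i j; have u1 := unitary_entry i j hA.
case: t => /=.
  have -> : zent (zask d O p k) (i, j, true) = O (vlist [:: k; i : nat; j : nat; 1%N]) p.
    by rewrite /zent /= mxE.
  apply: dv_ask => //; first exact: (dv_list [:: k; i : nat; j : nat; 1%N]).
  by apply: bO_ him (le_trans (nc_Im _) u1).
have -> : zent (zask d O p k) (i, j, false) = O (vlist [:: k; i : nat; j : nat; 0%N]) p.
  by rewrite /zent /= mxE.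
apply: dv_ask => //; first exact: (dv_list [:: k; i : nat; j : nat; 0%N]).
by apply: bO_ hre (le_trans (nc_Re _) u1).
Qed.

Lemma mdv_entry e A : dv e (zvalue A) -> mdv P O T S env (@EEntry (midx d) e) A.
Proof. by move=> he x; exact: dv_entry. Qed.

Lemma dv_word V (F : wform n V) pe p ve s (r : V -> zmx d) :
  (forall k : 'I_n, presents_at O k.+1 G`_k) ->
  dv pe (VInt p%:Z) -> dv (EPow2 pe) (VInt (2 ^ p)%:Z) ->
  (p <= T)%N -> (p + 2 <= S)%N ->
  (forall x, dv (ve x) (wval (s x) (r x))) ->
  dv (EWord d pe F ve) (wval (wsubst F s) (znum p (fun k => zask d O p k.+1) F r)).
Proof.
move=> hG hp h2p pT pS hv; elim: F => [x|k|F1 h1 F2 h2] /=; first exact: hv.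
  apply: dv_pair; first exact: dv_int.
  by apply: dv_fun; apply: dv_MAsk (hG k) (gate_SU hSU k) hp pT pS.
apply: dv_pair; first by apply: dv_pair; [exact: dv_fst h1 | exact: dv_fst h2].
apply: dv_fun; apply: mdv_div => //.
by apply: mdv_mul; apply: mdv_entry; [exact: dv_snd h1 | exact: dv_snd h2].
Qed.

End WordNumerics.

(** * One level of the recursion *)

Section Refinement.
Variables (R : realType) (d : nat) (G : seq 'M[R[i]]_d).
Local Notation M := 'M[R[i]]_d.
Local Notation J := (lie_idx d).
Local Notation n := (size G).
Hypothesis d_gt0 : (0 < d)%N.
Hypothesis hSU : forall A, A \in G -> in_SU A.
Variable kw : 'I_d * 'I_d -> 'I_n.
Hypothesis kw_twirl : forall E, \sum_a G`_(kw a) * E * adj (G`_(kw a)) = (d%:R * \tr E) *: (1 : M).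
Hypothesis kw_center : forall E, G`_(kw (ord2_0 d_gt0)) * E * adj (G`_(kw (ord2_0 d_gt0))) = E.
Hypothesis kw_period : forall a, G`_(kw a) ^+ (2 * d ^ 2) = 1.

Local Notation D := ((d ^ 2)%:R : R).

(* None is the previous approximation U'; Some (j, b, s) approximates the exponential
   of y A_j if b is false, of y^-1 c_j if b is true, or its inverse if s is true. *)
Definition step_var : Type := option (J * bool * bool).

(** The exponent of [wpow] is one more than its argument, so the right factor is the power 2 d^2 - 1
    of the Weyl gate, its inverse. *)
Definition conj_form (F : wform n step_var) a : wform n step_var :=
  WMul (WMul (WGate _ (kw a)) F) (wpow _ (kw a) (2 * d ^ 2).-2).

Definition inv_form (F F' : wform n step_var) : wform n step_var :=
  foldr (fun a acc => WMul (conj_form (WMul F' F) a) acc) F' (nontriv d_gt0).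

Definition step_form : wform n step_var :=
  foldr (fun j acc =>
    let v s := WVar n (Some (j, false, s)) in let w s := WVar n (Some (j, true, s)) in
    WMul (WMul (WMul (WMul (v false) (w false)) (inv_form (v false) (v true)))
      (inv_form (w false) (w true))) acc)
  (WVar n None) (index_enum J).

Lemma fmx_conj_form F a (r : step_var -> M) :
  fmx (conj_form F a) r = G`_(kw a) * fmx F r * adj (G`_(kw a)).
Proof.
rewrite /= fmx_pow; congr (_ * _); have hg := gate_SU hSU (kw a).
have d2 : (2 <= 2 * d ^ 2)%N by rewrite leq_pmulr // expn_gt0 d_gt0.
rewrite -[LHS]mul1r -(SU_mulVl hg) -mulrA -exprS.
by have -> : ((2 * d ^ 2).-2.+2 = 2 * d ^ 2)%N by [lia]; rewrite kw_period mulr1.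
Qed.

Lemma fmx_inv_form F F' (r : step_var -> M) :
  fmx (inv_form F F') r = approx_inv d_gt0 (fun a => G`_(kw a)) (fmx F r) (fmx F' r).
Proof.
rewrite /inv_form /approx_inv /twirl_prod; elim: (nontriv d_gt0) => [|a s IH].
  by rewrite big_nil mul1r.
by rewrite big_cons -mulrA -IH -[fmx F' r * fmx F r]/(fmx (WMul F' F) r) -fmx_conj_form.
Qed.

Lemma fmx_step_form (r : step_var -> M) :
  fmx step_form r = step_mx d_gt0 (fun a => G`_(kw a)) (r None)
    (fun j => r (Some (j, false, false))) (fun j => r (Some (j, false, true)))
    (fun j => r (Some (j, true, false))) (fun j => r (Some (j, true, true))).
Proof.
rewrite /step_form /step_mx; elim: (index_enum J) => [|j s IH].
  by rewrite big_nil mul1r.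
by rewrite big_cons -mulrA -IH /= !fmx_inv_form.
Qed.

Definition zres p (A B : zmx d) := zadd (zmulr p A (zadj B)) (zscl (0 - (2 ^ p)%:Z) (zone d)).

(** The generators are unscaled integers, so the bracket needs no renormalization. The factor y^-1 =
    2^h is applied before the only division, and the rounding error does not depend on h. *)
Definition zcoef h (j : J) (E : zmx d) : zmx d :=
  let K := zadd E (zscl (-1) (zadj E)) in
  zdiv (16 * d ^ 3)%:Z (zscl (0 - (2 ^ h)%:Z)
    (zadd (zmul (lie_gen j) K) (zscl (-1) (zmul K (lie_gen j))))).

(** A single division by 2 * 2^p halves the square and restores its scale. *)
Definition znear p (X : zmx d) : zmx d :=
  zadd (zadd (zscl (2 ^ p)%:Z (zone d)) X) (zdiv (2 * (2 ^ p)%:Z) (zmul X X)).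

Definition zinput p h (E : zmx d) (x : J * bool * bool) : zmx d :=
  let: (j, b, s) := x in
  let X := if b then zcoef h j E else zscl (2 ^ (p - h))%:Z (lie_gen j) in
  znear p (if s then zscl (-1) X else X).

Lemma near_split (X Y u v w : M) : 1 + Y + u - (1 + X + w) = (Y - X) + ((u - v) + (v - w)).
Proof. ncring. Qed.

Lemma appr_near p e NX X (Xz : zmx d) : 0 <= e <= 1 -> mxn X <= NX ->
  mxn (appr R p Xz - X) <= e -> D * 2 * 2 ^- p <= e ->
  mxn (appr R p (znear p Xz) - near_exp X) <= e * (3 + NX).
Proof.
move=> /andP[e0 e1] hX he hp; set Y := appr R p Xz in he *.
have NX0 := le_trans (mxn_ge0 X) hX.
have hd : mxn (appr R p (zdiv (2 * 2 ^ p)%N%:Z (zmul Xz Xz)) - (2^-1 : R[i]) *: (Y * Y)) <= e.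
  apply: le_trans hp; have -> : (2^-1 : R[i]) *: (Y * Y) =
      (2 * 2 ^ p)%:R^-1 *: appr R p (zmul Xz Xz).
    rewrite natrM invfM -scalerA; congr (_ *: _); rewrite natrV_pow /Y /appr.
    by rewrite zval_mul mulZl mulZr !scalerA.
  by apply: appr_div; rewrite muln_gt0 expn_gt0.
have hY : mxn ((2^-1 : R[i]) *: (Y * Y) - (2^-1 : R[i]) *: (X * X)) <= e * (1 + NX).
  rewrite -scalerBr mul_sub_split mxnZ ncV nc_nat.
  have hYn : mxn Y <= NX + 1.
    by rewrite -[Y](subrK X) addrC (le_trans (mxnD _ _)) // lerD // (le_trans he).
  have h1 : mxn ((Y - X) * Y + X * (Y - X)) <= e * (NX + 1) + NX * e.
    by rewrite (le_trans (mxnD _ _)) // lerD // (le_trans (mxnM _ _)) // ler_pM ?mxn_ge0.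
  nra.
have -> : appr R p (znear p Xz) - near_exp X = (Y - X) +
   ((appr R p (zdiv (2 * 2 ^ p)%N%:Z (zmul Xz Xz)) - (2^-1 : R[i]) *: (Y * Y)) +
    ((2^-1 : R[i]) *: (Y * Y) - (2^-1 : R[i]) *: (X * X))).
  by rewrite /znear !appr_add appr_one; exact: near_split.
apply: le_trans (mxnD _ _) _; have -> : e * (3 + NX) = e + (e + e * (1 + NX)) by ring.
by rewrite lerD // (le_trans (mxnD _ _)) // lerD.
Qed.

Lemma appr_coef p h (j : J) E :
  mxn (appr R p (zcoef h j E) - (2 ^+ h)%:C%C *: lie_coef j (appr R p E)) <= D * 2 * 2 ^- p.
Proof.
rewrite /zcoef; set K := zadd E _; set Z := zadd (zmul _ K) _.
have -> : (2 ^+ h)%:C%C *: lie_coef j (appr R p E) =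
    (16 * d ^ 3)%:R^-1 *: appr R p (zscl (0 - (2 ^ h)%:Z) Z).
  have hK : appr R p K = appr R p E - adj (appr R p E).
    by rewrite /K appr_add appr_scl appr_adj -[(-1)%:~R]/(-1) scaleN1r.
  have hZ : appr R p Z = brk (zval R (lie_gen j)) (appr R p K).
    rewrite /Z appr_add appr_scl -[(-1)%:~R]/(-1) scaleN1r /brk /appr !zval_mul.
    by rewrite mulZl mulZr.
  rewrite appr_scl hZ hK sub0r rmorphN /= ofR_pow /lie_coef !scalerA; congr (_ *: _).
  by rewrite !mulrN mulrC.
by apply: appr_div; rewrite muln_gt0 expn_gt0 d_gt0.
Qed.

Lemma lie_coef_skew j (X : M) : adj (lie_coef j X) = - lie_coef j X.
Proof.
rewrite /lie_coef adjZ -scalerN; congr (_ *: _).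
  by rewrite rmorphN fmorphV rmorph_nat.
rewrite /brk adjB !adjM adjB adjK lie_gen_skew; move: (zval R _) (adj X) => A Y; ncring.
Qed.

Lemma lie_coef_tr j (X : M) : \tr (lie_coef j X) = 0.
Proof.
have trB A B : \tr (A - B : M) = \tr A - \tr B by exact: raddfB.
by rewrite /lie_coef mxtraceZ /brk trB trM subrr mulr0.
Qed.

Lemma mxn_lie_coef j (X : M) :
  mxn (lie_coef j X) <= 4 * mxn (zval R (lie_gen j)) * mxn X.
Proof.
rewrite /lie_coef mxnZ ncN ncV nc_nat.
have N0 : (1 : R) <= (16 * d ^ 3)%:R by rewrite ler1n muln_gt0 expn_gt0 d_gt0.
apply: (@le_trans _ _ (mxn (brk (zval R (lie_gen j)) (X - adj X)))).
  by rewrite ler_piMl ?mxn_ge0 // invf_le1 // (lt_le_trans _ N0).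
have h : mxn (X - adj X) <= 2 * mxn X.
  by rewrite (le_trans (mxnB _ _)) // mxn_adj mulrDl !mul1r.
rewrite /brk (le_trans (mxnB _ _)) //.
have -> : 4 * mxn (zval R (lie_gen j)) * mxn X = mxn (zval R (lie_gen j)) * (2 * mxn X) +
  2 * mxn X * mxn (zval R (lie_gen j)) by ring.
by rewrite lerD // (le_trans (mxnM _ _)) // ler_pM ?mxn_ge0.
Qed.

Lemma res_split (a b c : M) : a - 1 - (c - 1) = (a - b) + (b - c).
Proof. ncring. Qed.

Lemma appr_res p e Uz Mz (U U' : M) : in_SU U -> in_SU U' -> e <= 1 ->
  mxn (appr R p Uz - U) <= e -> mxn (appr R p Mz - U') <= e -> D * 2 * 2 ^- p <= e ->
  mxn (appr R p (zres p Uz Mz) - (U * adj U' - 1)) <= (2 * D + 2) * e.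
Proof.
move=> hU hU' e1 he he' hp; have e0 := le_trans (mxn_ge0 _) he.
have -> : appr R p (zres p Uz Mz) - (U * adj U' - 1) =
    (appr R p (zmulr p Uz (zadj Mz)) - appr R p Uz * adj (appr R p Mz)) +
    (appr R p Uz * adj (appr R p Mz) - U * adj U').
  rewrite /zres appr_add sub0r; set Z := appr R p (zscl _ _).
  have -> : Z = - 1.
    by rewrite /Z appr_scl rmorphN /= scaleNr -appr_scl appr_one.
  exact: res_split.
have h1 := appr_mul R p Uz (zadj Mz); rewrite appr_adj in h1.
have h2 : mxn (adj (appr R p Mz) - adj U') <= e by rewrite -adjB mxn_adj.
have h3 : mxn (adj (appr R p Mz)) <= D + 1.
  rewrite mxn_adj -[appr R p Mz](subrK U') addrC (le_trans (mxnD _ _)) // lerD ?mxn_SU //.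
  exact: le_trans e1.
apply: le_trans (mxnD _ _) _.
have -> : (2 * D + 2) * e = e + (e * (D + 1) + D * e) by ring.
rewrite lerD ?(le_trans h1) // mul_sub_split (le_trans (mxnD _ _)) // lerD //.
  by rewrite (le_trans (mxnM _ _)) // ler_pM ?mxn_ge0.
by rewrite (le_trans (mxnM _ _)) // ler_pM ?mxn_ge0 // mxn_SU.
Qed.

Lemma pow2_dom (C : R) : exists c : nat, C <= 2 ^+ c.
Proof.
exists (Num.truncn C).+1; apply: le_trans (ltW (truncnS_gt C)) _.
by rewrite -natrX ler_nat ltnW // ltn_expl.
Qed.

(** Rounding down leaves 3 h >= 9 k / 8 - 21 / 8, so the gain k / 8 covers c from this threshold
    on. *)
Lemma level_bounds c k : (8 * c + 30 < k)%N -> let h := (3 * k %/ 8)%N in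
  [/\ c + k <= 3 * h, c <= h, 2 * h <= k & 3 * h <= 2 * k]%N.
Proof.
move=> hk h; have := divn_eq (3 * k) 8; have := ltn_pmod (3 * k) (isT : 0 < 8)%N.
by rewrite -/h => *; split; lia.
Qed.

(* With y = 2^-h the step has error O(y^3) = O(2^(-9k/8)), which beats 2^-k for large
   k, and only needs inputs with error O(y^2), i.e. of level 2h <= 3k/4. *)
Lemma refine_level : exists2 C2 : R, 4 * D + 2 <= C2 & exists k0 : nat,
  forall k p (U U' : M) Uz Mz, (k0 < k)%N -> D * 2 * 2 ^- p <= 2 ^- (2 * k) -> (k <= p)%N ->
  let h := (3 * k %/ 8)%N in let E := zres p Uz Mz in
  in_SU U -> in_SU U' -> mxn (appr R p Uz - U) <= 2 ^- k ->
  mxn (U' - U) <= C2 * 2 ^- (2 * h) -> mxn (appr R p Mz - U') <= 2 ^- k ->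
  exists tgt : J * bool * bool -> M,
    (forall x, in_SU (tgt x) /\ mxn (appr R p (zinput p h E x) - tgt x) <= 2 ^- (2 * h)) /\
    forall r : step_var -> M, r None = U' -> (forall x, in_SU (r (Some x))) ->
      (forall x, mxn (r (Some x) - tgt x) <= C2 * 2 ^- (2 * h)) ->
      mxn (fmx step_form r - U) <= C2 * 2 ^- k.
Proof.
have [rho [Cq [rho0 hq]]] := @near_exp_SU R d d_gt0.
have D0 : 0 <= D by [].
(* Fixed before the constants of the step: the first summand is the rounding of E, the 1 is for the
   absorbed y^3 term, and 4 D + 2 is the error of the exhaustive search at the lowest levels. *)
pose C2 : R := 2 * D * (2 * D + 2) + 1 + (4 * D + 2).
have C20 : 0 <= C2 by rewrite !addr_ge0 ?mulr_ge0 // addr_ge0 // mulr_ge0.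
exists C2; first by rewrite lerDr addr_ge0 ?mulr_ge0 // addr_ge0 // mulr_ge0.
pose NA : R := \sum_j mxn (zval R (lie_gen (d := d) j)).
have hNA j : mxn (zval R (lie_gen (d := d) j)) <= NA.
  by rewrite /NA (bigD1 j) //= lerDl sumr_ge0 // => i _; exact: mxn_ge0.
have NA0 : 0 <= NA by apply: sumr_ge0 => j _; exact: mxn_ge0.
pose NB : R := 4 * NA * (2 * D + 2 + C2 * D).
have NB0 : 0 <= NB by rewrite !mulr_ge0 // !addr_ge0 ?mulr_ge0.
pose NX : R := NA + NB.
have NX0 : 0 <= NX by exact: addr_ge0.
pose Cq' : R := Num.max Cq 0.
have Cq0 : 0 <= Cq' by rewrite le_max lexx orbT.
pose C3 : R := C2 + (2 * D + 2) + (Cq' * NX ^+ 3 + NX ^+ 2).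
have C3a : C2 <= C3 by rewrite /C3 -addrA lerDl !addr_ge0 ?mulr_ge0 ?exprn_ge0.
have C3b : 2 * D + 2 <= C3 by rewrite /C3 addrAC lerDr !addr_ge0 ?mulr_ge0 ?exprn_ge0.
have [Cs hs] := @commutator_step R d d_gt0 (fun a => G`_(kw a)) (fun a => gate_SU hSU (kw a))
  kw_twirl kw_center C3.
pose C4 : R := 3 + NX + Cq' * NX ^+ 3.
(* These constants are absorbed for large k: NX / rho, so that the generators lie within the radius
   of [near_exp_SU]; C4, the rounding and non-unitarity of the inputs; Cs, the error of the step. *)
have [c1 hc1] := pow2_dom (NX / rho); have [c2 hc2] := pow2_dom C4.
have [c3 hc3] := pow2_dom Cs; pose c := (c1 + c2 + c3)%N.
have pow_le a b : (a <= b)%N -> 2 ^+ a <= 2 ^+ b :> R by move=> ab; rewrite ler_weXn2l // ler1n.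
exists (8 * c + 30)%N => k p U U' Uz Mz hk hp kp h E hU hU' hUz hUU' hMz.
have [hck hch h2k h3k] := level_bounds hk.
pose y : R := 2 ^- h.
have p2 m : 0 < 2 ^+ m :> R by exact: exprn_gt0.
have y0 : 0 < y by rewrite invr_gt0.
have y1 : y <= 1 by rewrite invf_le1 // exprn_ege1 // ler1n.
have yE m : y ^+ m = 2 ^- (m * h) by rewrite /y exprVn -exprM mulnC.
have inv_le a b : (a <= b)%N -> 2 ^- b <= 2 ^- a :> R by move=> ab; rewrite lef_pV2 ?posrE ?pow_le.
have yC C m : C <= 2 ^+ m -> (m <= c)%N -> C * y <= 1.
  move=> hC mc; rewrite ler_pdivrMr // mul1r (le_trans hC) // pow_le //.
  exact: leq_trans hch.
have y3k : Cs * y ^+ 3 <= 2 ^- k.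
  apply: (@le_trans _ _ (2 ^+ c * 2 ^- (3 * h))).
    by rewrite yE ler_wpM2r ?invr_ge0 ?(ltW (p2 _)) // (le_trans hc3) // pow_le // leq_addl.
  by rewrite ler_pdivrMr // mulrC ler_pdivlMr // -exprD pow_le.
have C4y : C4 * y <= 1 by apply: yC hc2 _; rewrite /c addnAC leq_addl.
have NXy : NX * y <= rho.
  rewrite -[rho]mul1r -ler_pdivrMr // mulrAC.
  by apply: yC hc1 _; rewrite /c -addnA leq_addr.
pose e : R := D * 2 * 2 ^- p.
have e0 : 0 <= e by rewrite !mulr_ge0 // invr_ge0 ltW.
have ey3 : e <= y ^+ 3 by rewrite yE (le_trans hp) // inv_le.
have ek : e <= 2 ^- k by rewrite (le_trans hp) // inv_le // leq_pmull.
have k1 : 2 ^- k <= 1 :> R by rewrite invf_le1 // exprn_ege1 // ler1n.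
have ky2 : 2 ^- k <= y ^+ 2 by rewrite yE inv_le.
have y2E : 2 ^- (2 * h) = y ^+ 2 by rewrite yE.
rewrite y2E in hUU' *; set Et := appr R p E.
have hEt : mxn (Et - (U * adj U' - 1)) <= (2 * D + 2) * 2 ^- k by exact: appr_res.
have hEt2 : mxn (Et - (U * adj U' - 1)) <= (2 * D + 2) * y ^+ 2.
  by rewrite (le_trans hEt) // ler_wpM2l // addr_ge0 ?mulr_ge0.
have hUU2 : mxn (U - U') <= C2 * y ^+ 2 by rewrite mxn_dist.
have NEt : mxn Et <= (2 * D + 2 + C2 * D) * y ^+ 2.
  rewrite -[Et](subrK (U * adj U' - 1)) mulrDl (le_trans (mxnD _ _)) // lerD //.
  have -> : U * adj U' - 1 = (U - U') * adj U' by rewrite mulrBl SU_mulVr.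
  rewrite (le_trans (mxnM _ _)) // mulrAC ler_pM ?mxn_ge0 //.
  exact/mxn_SU/SU_adj.
pose X (jb : J * bool) : M := if jb.2 then y^-1%:C%C *: lie_coef jb.1 Et
  else y%:C%C *: zval R (lie_gen jb.1).
have conjR (a : R) : (a%:C%C)^* = a%:C%C :> R[i] by rewrite -[_^*]/(conjc _) conjc_real.
have Xskew jb : adj (X jb) = - X jb.
  by rewrite /X; case: jb.2; rewrite adjZ conjR ?lie_coef_skew ?lie_gen_skew scalerN.
have Xtr jb : \tr (X jb) = 0.
  by rewrite /X; case: jb.2; rewrite mxtraceZ ?lie_coef_tr ?lie_gen_tr mulr0.
have y_ge0 := ltW y0.
have Xn jb : mxn (X jb) <= NX * y.
  rewrite /X; case: jb => j [] /=; rewrite mxnZ nc_real ger0_norm ?invr_ge0 //.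
    rewrite mulrC ler_pdivrMr // (le_trans (mxn_lie_coef _ _)) //.
    apply: (@le_trans _ _ (4 * NA * ((2 * D + 2 + C2 * D) * y ^+ 2))).
      by rewrite ler_pM ?mulr_ge0 ?mxn_ge0 // ler_wpM2l.
    by rewrite mulrA -[NX * y * y]mulrA -expr2 ler_wpM2r ?exprn_ge0 // /NX lerDr.
  by rewrite mulrC ler_wpM2r // (le_trans (hNA j)) // /NX lerDl.
have Xn1 jb : mxn (X jb) <= NX by rewrite (le_trans (Xn jb)) // ler_piMr.
pose Xs (x : J * bool * bool) : M := if x.2 then - X x.1 else X x.1.
have Xs_n x : mxn (Xs x) = mxn (X x.1) by rewrite /Xs; case: x.2; rewrite ?mxnN.
have Xs3 x : mxn (Xs x) ^+ 3 <= NX ^+ 3 * y ^+ 3.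
  rewrite -exprMn ler_pXn2r ?nnegrE ?mxn_ge0 ?mulr_ge0 // Xs_n; exact: Xn.
have trN (A : M) : \tr (- A) = - \tr A by exact: raddfN.
(* Correctness of a recursive call is relative to a target in SU(d). The program sees only a
   fixed-point value near it; the target itself exists in the proof alone. *)
have /choice[tgt htgt] : forall x, exists V : M,
    in_SU V /\ mxn (V - near_exp (Xs x)) <= Cq' * NX ^+ 3 * y ^+ 3.
  move=> x; have [|||V hV hVn] := hq (Xs x).
  - by rewrite /Xs; case: x.2; rewrite ?adjN Xskew.
  - by rewrite /Xs; case: x.2; rewrite ?trN Xtr ?oppr0.
  - by rewrite Xs_n (le_trans (Xn _)).
  exists V; split=> //; apply: le_trans hVn _; rewrite -mulrA.
  apply: (@le_trans _ _ (Cq' * mxn (Xs x) ^+ 3)).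
    by rewrite ler_wpM2r ?exprn_ge0 ?mxn_ge0 // le_max lexx.
  by rewrite ler_wpM2l.
exists tgt; split.
  move=> x; have [hx hxn] := htgt x; split=> //.
  pose Xz : zmx d := let X0 := if x.1.2 then zcoef h x.1.1 E
    else zscl (2 ^ (p - h))%:Z (lie_gen x.1.1) in if x.2 then zscl (-1) X0 else X0.
  have -> : zinput p h E x = znear p Xz by rewrite /Xz; case: (x) => -[].
  have hXz : mxn (appr R p Xz - Xs x) <= e.
    have h0 : mxn (appr R p (if x.1.2 then zcoef h x.1.1 E
        else zscl (2 ^ (p - h))%:Z (lie_gen x.1.1)) - X x.1) <= e.
      rewrite /X; case: x.1.2; first by rewrite /y invrK; exact: appr_coef.
      have -> : appr R p (zscl (2 ^ (p - h))%:Z (lie_gen x.1.1)) = y%:C%C *: zval R (lie_gen x.1.1).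
        rewrite appr_scl ofR_pow /appr scalerA -rmorphM; congr (_%:C%C *: _).
        have hp' : (h <= p)%N by apply: leq_trans kp; apply: leq_trans h2k; rewrite leq_pmull.
        rewrite /y -{2}(subnK hp') exprD invfM mulrA mulfV ?mul1r //.
      by rewrite subrr mxn0.
    rewrite /Xz /Xs; case: x.2 => //.
    by rewrite appr_scl -[(-1)%:~R]/(-1) scaleN1r -opprD mxnN.
  have e1 : 0 <= e <= 1 by rewrite e0 (le_trans ek).
  have Xs1 : mxn (Xs x) <= NX by rewrite Xs_n.
  have hnear := appr_near e1 Xs1 hXz (lexx _).
  apply: le_trans (mxn_tri (near_exp (Xs x)) _ _) _.
  rewrite [X in _ + X]mxn_dist.
  apply: (@le_trans _ _ (C4 * y ^+ 3)).
    rewrite /C4 mulrDl lerD // (le_trans hnear) // mulrC ler_wpM2l //.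
    by rewrite addr_ge0.
  by rewrite exprSr mulrCA ler_piMr ?exprn_ge0 // mulrC.
move=> r r0 hr hrt.
have hw x : mxn (r (Some x) - (1 + Xs x)) <= C3 * y ^+ 2.
  have [_ hxn] := htgt x.
  apply: (@le_trans _ _ ((C2 + (Cq' * NX ^+ 3 + NX ^+ 2)) * y ^+ 2)); last first.
    by rewrite ler_wpM2r ?exprn_ge0 // /C3 [leRHS]addrAC lerDl addr_ge0 ?mulr_ge0 //.
  apply: le_trans (mxn_tri (tgt x) _ _) _; rewrite [leRHS]mulrDl lerD //.
  apply: le_trans (mxn_tri (near_exp (Xs x)) _ _) _; rewrite mulrDl lerD //.
    rewrite (le_trans hxn) // ler_wpM2l ?mulr_ge0 ?exprn_ge0 //.
    by rewrite ler_wiXn2l.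
  have -> : near_exp (Xs x) - (1 + Xs x) = (2^-1 : R[i]) *: (Xs x * Xs x).
    by rewrite /near_exp addrAC subrr add0r.
  rewrite mxnZ ncV nc_nat (le_trans (ler_piMl (mxn_ge0 _) _)) //; first by lra.
  by rewrite (le_trans (mxnM _ _)) // -expr2 -exprMn ler_pXn2r ?nnegrE ?mxn_ge0 ?mulr_ge0 // Xs_n.
have y01 : 0 < y <= 1 by rewrite y0.
have C3y : C2 * y ^+ 2 <= C3 * y ^+ 2 by rewrite ler_wpM2r ?exprn_ge0.
have C3y' : (2 * D + 2) * y ^+ 2 <= C3 * y ^+ 2 by rewrite ler_wpM2r ?exprn_ge0.
pose SD := @StepData R d C3 y U U' Et
  (fun j => r (Some (j, false, false))) (fun j => r (Some (j, false, true)))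
  (fun j => r (Some (j, true, false))) (fun j => r (Some (j, true, true)))
  y01 hU hU' (fun j => hr _) (fun j => hr _) (fun j => hr _) (fun j => hr _)
  (le_trans hUU2 C3y) (le_trans hEt2 C3y')
  (fun j => hw (j, false, false)) (fun j => hw (j, false, true))
  (fun j => hw (j, true, false)) (fun j => hw (j, true, true)).
have := hs SD; rewrite fmx_step_form r0 /= => hfin; apply: le_trans hfin _.
apply: (@le_trans _ _ ((2 * D * (2 * D + 2) + 1) * 2 ^- k)).
  rewrite [leRHS]mulrDl mul1r lerD // -[leRHS]mulrA; apply: ler_wpM2l => //.
rewrite ler_wpM2r ?invr_ge0 ?(ltW (p2 _)) // /C2 lerDl addr_ge0 ?mulr_ge0 //.
Qed.

End Refinement.

(** * An exact integer test for closeness *)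

Section DistanceTest.
Variables (R : realType) (d : nat).
Local Notation M := 'M[R[i]]_d.
Local Notation D := ((d ^ 2)%:R : R).
Implicit Types A B : zmx d.

Lemma sum_midx (F : midx d -> int) :
  \sum_x F x = \sum_i \sum_j (F (i, j, false) + F (i, j, true)).
Proof.
have -> : \sum_x F x = \sum_(ij : 'I_d * 'I_d) \sum_t F (ij, t).
  by rewrite pair_bigA; apply: eq_bigr => -[ij t].
rewrite [RHS]pair_bigA; apply: eq_bigr => -[i j] _ /=.
by rewrite big_bool addrC.
Qed.

Lemma sum_sqr_appr p A B :
  (\sum_x (zent A x - zent B x) * (zent A x - zent B x))%:~R =
  2 ^+ p * 2 ^+ p * \sum_i \sum_j nc ((appr R p A - appr R p B) i j) ^+ 2 :> R.
Proof.
rewrite sum_midx rmorph_sum mulr_sumr; apply: eq_bigr => i _ /=.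
rewrite rmorph_sum mulr_sumr; apply: eq_bigr => j _ /=.
have E (X Y : M) c : (c *: X - c *: Y) i j = c * (X i j - Y i j) by rewrite !mxE mulrBr.
rewrite /appr E ncM exprMn nc_real ger0_norm ?invr_ge0 ?exprn_ge0 //.
rewrite nc_sqr !zval_entry /= rmorphD !rmorphM !rmorphB /zent /=.
have p0 : 2 ^+ p != 0 :> R by rewrite expf_neq0 // pnatr_eq0.
by move: (2 ^+ p) p0 => q q0; field.
Qed.

(** Squared Frobenius distances are compared after clearing denominators, so neither roots nor
    rounding occur. The threshold 4 / 2^k leaves room for three errors of 2^-k: of the target, of
    the net and of the computed net word. *)
Definition dist_test (k p : nat) A B : int :=
  16 * ((2 ^ p)%:Z * (2 ^ p)%:Z) - (2 ^ k)%:Z * (2 ^ k)%:Z *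
    \sum_x (zent A x - zent B x) * (zent A x - zent B x).

Lemma dist_testE k p A B : (0 < dist_test k p A B) =
  (\sum_i \sum_j nc ((appr R p A - appr R p B) i j) ^+ 2 < (4 / 2 ^+ k) ^+ 2).
Proof.
rewrite -(ltr_int R) /dist_test; have := sum_sqr_appr p A B.
move: (\sum_x _ * _) (\sum_i \sum_j _ ^+ 2) => z s zE; rewrite intrB !intrM zE /=.
rewrite -[((2 ^ p)%:Z)%:~R]/((2 ^ p)%:R) -[((2 ^ k)%:Z)%:~R]/((2 ^ k)%:R) !natrX.
have p0 : 0 < 2 ^+ p :> R by rewrite exprn_gt0.
have k0 : 0 < 2 ^+ k :> R by rewrite exprn_gt0.
rewrite subr_gt0 exprMn exprVn ltr_pdivlMr ?exprn_gt0 //.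
rewrite -[RHS](ltr_pM2r (mulr_gt0 p0 p0)); congr (_ < _); ring.
Qed.

Lemma dist_test_pos k p A B :
  mxn (appr R p A - appr R p B) <= 3 / 2 ^+ k -> 0 < dist_test k p A B.
Proof.
move=> h; rewrite dist_testE; set X := _ - _ in h *.
have k0 : 0 < 2 ^+ k :> R by rewrite exprn_gt0.
apply: le_lt_trans (_ : mxn X ^+ 2 < _).
  rewrite expr2 {1}/mxn mulr_suml; apply: ler_sum => i _; rewrite mulr_suml.
  by apply: ler_sum => j _; rewrite expr2 ler_wpM2l ?nc_ge0 ?mxn_entry.
rewrite ltr_pXn2r ?nnegrE ?mxn_ge0 ?divr_ge0 ?(ltW k0) //.
by rewrite (le_lt_trans h) // ltr_pM2r ?invr_gt0 // ltr_nat.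
Qed.

Lemma dist_test_le k p A B :
  0 < dist_test k p A B -> mxn (appr R p A - appr R p B) <= D * (4 / 2 ^+ k).
Proof.
rewrite dist_testE; set X := _ - _ => h.
have k0 : 0 < 2 ^+ k :> R by rewrite exprn_gt0.
apply: mxn_le_entries => i j.
rewrite -(@ler_pXn2r _ 2) ?nnegrE ?nc_ge0 ?divr_ge0 ?(ltW k0) // (le_trans _ (ltW h)) //.
rewrite (bigD1 i) //= (bigD1 j) //= -addrA lerDl addr_ge0 //.
  by apply: sumr_ge0 => l _; rewrite sqr_ge0.
by apply: sumr_ge0 => l _; apply: sumr_ge0 => l' _; rewrite sqr_ge0.
Qed.

End DistanceTest.

(** * The Solovay-Kitaev program *)

Section ArithRules.
Variables (P : program) (O : oracle) (T S : nat) (env : seq Defs.val).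
Local Notation dv := (dv P O T S env).

Lemma dv_sub e1 e2 x y : dv e1 (VInt x) -> dv e2 (VInt y) ->
  dv (EArith Defs.Sub e1 e2) (VInt (x - y)).
Proof. exact: dv_arith. Qed.

Lemma dv_mul e1 e2 x y : dv e1 (VInt x) -> dv e2 (VInt y) ->
  dv (EArith Mul e1 e2) (VInt (x * y)).
Proof. exact: dv_arith. Qed.

End ArithRules.

Section Program.
Variables (R : realType) (d : nat) (G : seq 'M[R[i]]_d).
Local Notation M := 'M[R[i]]_d.
Local Notation J := (lie_idx d).
Local Notation n := (size G).
Local Notation D := ((d ^ 2)%:R : R).
Hypothesis d_gt0 : (0 < d)%N.
Hypothesis hSU : forall A, A \in G -> in_SU A.
Variable kw : 'I_d * 'I_d -> 'I_n.
Variables (T0 : finType) (net : T0 -> wtree n) (k0 q c0 : nat).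

Local Notation "a -' b" := (EArith Defs.Sub a b) (at level 50, left associativity).
Local Notation "a *' b" := (EArith Mul a b) (at level 40, left associativity).

(* Functions are called by position: 0 computes 2^m, 1 is the recursion, 2 flattens
   word trees, 3 looks for the scale of eps, 4 is the driver. *)
Definition pow2_body : expr :=
  EIf (EVar 0) (EInt 2 *' EPow2 (EVar 0 -' EInt 1)) (EInt 1).

Definition ESize : expr := EFst (EVar 0).
Definition EPrec : expr := EFst (ESnd (EVar 0)).
Definition MTarget : midx d -> expr := EEntry (ESnd (ESnd (EVar 0))).
Definition EHalf : expr := EArith Div (EInt 3 *' ESize) (EInt 8).

Definition ERec (f : midx d -> expr) : expr :=
  ECall 1 (EPair (EInt 2 *' EHalf) (EPair EPrec (EFun f))).

Definition MRes : midx d -> expr :=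
  MAdd (MDiv (EPow2 EPrec) (MMul MTarget (MAdj (EEntry (ESnd (ERec MTarget))))))
    (MScl (EInt 0 -' EPow2 EPrec) (MCst (zone d))).

Definition MCoef (j : J) : midx d -> expr :=
  let K := MAdd MRes (MScl (EInt (-1)) (MAdj MRes)) in
  MDiv (EInt (16 * d ^ 3)%:Z) (MScl (EInt 0 -' EPow2 EHalf)
    (MAdd (MMul (MCst (lie_gen j)) K) (MScl (EInt (-1)) (MMul K (MCst (lie_gen j)))))).

Definition MNear (X : midx d -> expr) : midx d -> expr :=
  MAdd (MAdd (MScl (EPow2 EPrec) (MCst (zone d))) X)
    (MDiv (EInt 2 *' EPow2 EPrec) (MMul X X)).

Definition MInput (x : J * bool * bool) : midx d -> expr :=
  let: (j, b, s) := x in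
  let X := if b then MCoef j else MScl (EPow2 (EPrec -' EHalf)) (MCst (lie_gen j)) in
  MNear (if s then MScl (EInt (-1)) X else X).

Definition EStepVar (x : step_var d) : expr :=
  if x is Some x then ERec (MInput x) else ERec MTarget.

Definition ENet (c : T0) : expr :=
  EWord d EPrec (net c) (fun x : void => match x with end).

Definition EDist (c : T0) : expr := ESum (fun x : midx d =>
  let e := MTarget x -' EEntry (ESnd (ENet c)) x in e *' e).

Definition ETest (c : T0) : expr :=
  EInt 16 *' (EPow2 EPrec *' EPow2 EPrec) -' EPow2 ESize *' EPow2 ESize *' EDist c.

(** The final [EInt 0] is a default; it is not reached if some word of the list passes the test. *)
Definition ESearch (s : seq T0) : expr :=
  foldr (fun c e => EIf (ETest c) (ENet c) e) (EInt 0) s.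

Definition sk_body : expr :=
  EIf (ESize -' EInt k0%:Z) (EWord d EPrec (step_form d_gt0 kw) EStepVar)
    (ESearch (enum T0)).

(** The argument is a tree together with an accumulator, onto which the leaves are pushed from right
    to left; this makes flattening linear in the number of leaves. *)
Definition flat_body : expr :=
  EIf (EFst (EVar 0))
    (ECall 2 (EPair (EFst (EFst (EVar 0)))
      (ECall 2 (EPair (ESnd (EFst (EVar 0))) (ESnd (EVar 0))))))
    (EPair (EInt 0 -' EFst (EVar 0)) (ESnd (EVar 0))).

(** Address 0 is [vlist [::]], that of eps. An answer of at least 2 at precision p guarantees eps >=
    2^-p. *)
Definition find_body : expr :=
  EIf (EAsk (EInt 0) (EVar 0) -' EInt 1) (EVar 0)
    (ECall 3 (EArith Add (EVar 0) (EInt 1))).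

Definition top_body : expr :=
  let pe := EInt q%:Z *' EVar 0 in
  ECall 2 (EPair (EFst (ECall 1 (EPair (EVar 0) (EPair pe (EFun (@MAsk d 0 pe))))))
    (EInt 0)).

(** The level passed to the driver exceeds the scale of eps by [c0], which is to compensate the
    constant in front of the final error. *)
Definition sk_program : program := Program
  (ECall 4 (EArith Add (ECall 3 (EInt 0)) (EInt c0%:Z)))
  [:: pow2_body; sk_body; flat_body; find_body; top_body].

Local Notation P := sk_program.
Variable O : oracle.

Lemma bits_nat m : (bits m%:Z <= m.+1)%N.
Proof. by apply: bits_le => //=; apply: ltn_trans (ltn_expl m (isT : 1 < 2)%N) _; rewrite ltn_exp2l. Qed.

Lemma bits_pow2 m : bits (2 ^ m)%:Z = m.+1.
Proof. by rewrite /bits /= trunc_expnK. Qed.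

Definition pow2_time m : nat := 12 * m.+1 ^ 2.

Lemma pow2_eval m : exists2 t,
  Defs.eval P O [:: VInt m%:Z] pow2_body (VInt (2 ^ m)%:Z) t & (t <= pow2_time m)%N.
Proof.
elim: m => [|m [t ht lt]].
  exists 3%N => //; apply: (@ev_if P O _ _ _ _ (VInt 0) _ 1 1); first exact: ev_var.
  exact: ev_int.
have h1 : Defs.eval P O [:: VInt m.+1%:Z] (EVar 0 -' EInt 1) (VInt m%:Z)
    (1 + 1 + bits m.+1%:Z * bits 1).+1.
  have -> : m%:Z = arith_fun Defs.Sub m.+1%:Z 1 by rewrite /= -addn1 PoszD addrK.
  by apply: ev_arith; [exact: ev_var | exact: ev_int].
have h2 := @ev_call P O _ 0 _ pow2_body _ _ _ _ h1 erefl ht.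
have h3 := ev_arith Mul (ev_int P O [:: VInt m.+1%:Z] 2) h2.
have -> : (2 ^ m.+1)%:Z = arith_fun Mul 2 (2 ^ m)%:Z by rewrite expnS PoszM.
eexists.
  apply: (@ev_if P O _ _ _ _ (VInt m.+1%:Z)); [exact: ev_var | exact: h3].
have b1 := bits_nat m.+1; have b2 := bits_pow2 m; rewrite b2.
have -> : bits 1 = 1%N by []. have -> : bits 2 = 2%N by [].
move: lt b1; rewrite /pow2_time !expnS expn0; nia.
Qed.

Lemma tval_bits (t : wtree n) S : (n < S)%N -> vbits S (tval t).
Proof.
move=> nS; elim: t => [[]|k|t1 h1 t2 h2] /=; last by rewrite h1 h2.
apply: leq_trans nS; rewrite /bits abszN -/(bits k%:Z).
by rewrite (leq_trans (bits_nat _)) // ltnS ltnW.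
Qed.

Definition flat_const := (n + 60)%N.

(** The 20 is a credit: a node inherits one from each subtree, spends one on its own operations and
    passes the other on. *)
Lemma flat_eval (t : wtree n) (s : seq nat) : exists2 c,
  Defs.eval P O [:: VPair (tval t) (vlist s)] flat_body
    (vlist ([seq nat_of_ord k | k <- wflat t] ++ s)) c &
  (c + 20 <= flat_const * leaves t)%N.
Proof.
elim: t s => [[]|k|t1 IH1 t2 IH2] s.
  have hv := ev_var P O (erefl (onth [:: VPair (tval (WGate void k)) (vlist s)] 0)).
  have h1 := ev_fst hv; have h2 := ev_snd hv.
  have h3 := ev_arith Defs.Sub (ev_int P O _ 0) h1.
  have h4 := ev_pair h3 h2; rewrite /= sub0r opprK in h4.
  eexists; first by apply: (@ev_if P O _ _ _ _ _ _ _ _ h1); rewrite /= oppr_gt0; exact: h4.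
  have b : (bits (- (k : nat)%:Z) <= n)%N.
    by rewrite /bits abszN -/(bits k%:Z) (leq_trans (bits_nat _)).
  have -> : bits 0 = 1%N by [].
  by move: b; rewrite /flat_const /= muln1; lia.
rewrite /= map_cat -catA.
have [c2 e2 l2] := IH2 s; have [c1 e1 l1] := IH1 ([seq nat_of_ord k | k <- wflat t2] ++ s).
have hv := ev_var P O (erefl (onth [:: VPair (VPair (tval t1) (tval t2)) (vlist s)] 0)).
have h1 := ev_fst hv; have h2 := ev_snd hv.
have h3 := ev_pair (ev_snd h1) h2.
have h4 := @ev_call P O _ 2 _ flat_body _ _ _ _ h3 erefl e2.
have h5 := ev_pair (ev_fst h1) h4.
have h6 := @ev_call P O _ 2 _ flat_body _ _ _ _ h5 erefl e1.
eexists; first by apply: (@ev_if P O _ _ _ _ _ _ _ _ h1); exact: h6.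
by rewrite mulnDr; lia.
Qed.

Lemma find_eval n0 j : (j <= n0)%N -> 1 < O (VInt 0) n0 ->
  (forall i, (i < n0)%N -> O (VInt 0) i <= 1) ->
  (forall i, (i < n0)%N -> (bits (O (VInt 0) i) <= 1)%N) ->
  exists2 c, Defs.eval P O [:: VInt j%:Z] find_body (VInt n0%:Z) c &
  (c <= (n0 - j).+1 * (2 * n0 + 20) + 2 * bits (O (VInt 0) n0))%N.
Proof.
move=> + hn0 hlt hb; move: {2}(n0 - j)%N (leqnn (n0 - j)) => m.
elim: m j => [|m IH] j hm jn.
  have -> : j = n0 by lia.
  have hv := ev_var P O (erefl (onth [:: VInt n0%:Z] 0)).
  have h1 := ev_arith Defs.Sub (ev_ask (ev_int P O _ 0) hv) (ev_int P O _ 1).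
  eexists; first by apply: (@ev_if P O _ _ _ _ _ _ _ _ h1); rewrite /= subr_gt0 hn0; exact: hv.
  by have -> : bits 1 = 1%N by []; lia.
have [jn0|jn0] := eqVneq j n0; first by apply: IH; lia.
have {jn0 jn} jn : (j < n0)%N by lia.
have hv := ev_var P O (erefl (onth [:: VInt j%:Z] 0)).
have h1 := ev_arith Defs.Sub (ev_ask (ev_int P O _ 0) hv) (ev_int P O _ 1).
have h2 := ev_arith Add hv (ev_int P O _ 1).
have E : arith_fun Add j%:Z 1 = j.+1%:Z by rewrite /= -PoszD addn1.
rewrite E in h2; have [c ec lc] := IH j.+1 ltac:(lia) jn.
have h3 := @ev_call P O _ 3 _ find_body _ _ _ _ h2 erefl ec.
eexists.
  apply: (@ev_if P O _ _ _ _ _ _ _ _ h1); rewrite /= subr_gt0 ltNge hlt //=; exact: h3.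
have b1 := hb j jn; have b2 := bits_nat j; have -> : bits 1 = 1%N by [].
have -> : (n0 - j = (n0 - j.+1).+1)%N by lia.
rewrite mulSn; lia.
Qed.

Section Level.
Variables (T S : nat) (k p h : nat) (Uz : zmx d).
Hypothesis hh : h = (3 * k %/ 8)%N.

Definition sk_arg k' (A : zmx d) : Defs.val :=
  VPair (VInt k'%:Z) (VPair (VInt p%:Z) (zvalue A)).

Local Notation env := [:: sk_arg k Uz].
Local Notation dv := (dv P O T S env).
Local Notation mdv := (mdv P O T S env).

Hypothesis pow2_T : (pow2_time p <= T)%N.
Hypothesis p_S : (p < S)%N.
Hypothesis kp : (k <= p)%N.

Lemma dv_size : dv ESize (VInt k%:Z).
Proof. by apply: (@dv_fst _ _ _ _ _ _ _ (VPair (VInt p%:Z) (zvalue Uz))); exact: dv_var. Qed.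

Lemma dv_prec : dv EPrec (VInt p%:Z).
Proof.
apply: (@dv_fst _ _ _ _ _ _ _ (zvalue Uz)).
by apply: (@dv_snd _ _ _ _ _ _ (VInt k%:Z)); exact: dv_var.
Qed.

Lemma mdv_target : mdv MTarget Uz.
Proof.
apply: mdv_entry; apply: (@dv_snd _ _ _ _ _ _ (VInt p%:Z)).
by apply: (@dv_snd _ _ _ _ _ _ (VInt k%:Z)); exact: dv_var.
Qed.

Lemma dv_half : dv EHalf (VInt h%:Z).
Proof.
have -> : h%:Z = arith_fun Div (arith_fun Mul 3 k%:Z) 8 by rewrite /= hh -PoszM divz_nat.
by apply: dv_arith; [apply: dv_arith; [exact: dv_int | exact: dv_size] | exact: dv_int].
Qed.

Lemma dv_pow2 e m : (m <= p)%N -> dv e (VInt m%:Z) -> dv (EPow2 e) (VInt (2 ^ m)%:Z).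
Proof.
move=> mp he; have [t ht lt] := pow2_eval m.
apply: (@dv_call _ _ _ _ _ 0 _ pow2_body _ _ _ he _ ht) => //.
  apply: leq_trans lt (leq_trans _ pow2_T).
  by rewrite leq_mul2l leq_exp2r //= ltnS.
by rewrite /vbits bits_pow2 (leq_trans _ p_S).
Qed.

Let h_le_p : (h <= p)%N.
Proof. by apply: leq_trans kp; rewrite hh; lia. Qed.

Lemma dv_pow2p : dv (EPow2 EPrec) (VInt (2 ^ p)%:Z).
Proof. exact: dv_pow2 dv_prec. Qed.

Lemma dv_rec (f : midx d -> expr) (A : zmx d) (t : wtree n) (B : zmx d) c : mdv f A ->
  Defs.eval P O [:: sk_arg (2 * h) A] sk_body (wval t B) c -> (c <= T)%N ->
  vbits S (wval t B) -> dv (ERec f) (wval t B).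
Proof.
move=> hf ht cT bS; apply: dv_call ht cT bS => //.
apply: dv_pair.
  have -> : (2 * h)%:Z = arith_fun Mul 2 h%:Z by rewrite /= -PoszM.
  by apply: dv_arith; [exact: dv_int | exact: dv_half].
by apply: dv_pair; [exact: dv_prec | exact: dv_fun].
Qed.

Lemma mdv_res (t0 : wtree n) (A0 : zmx d) : dv (ERec MTarget) (wval t0 A0) -> mdv MRes (zres p Uz A0).
Proof.
move=> h0; apply: mdv_add.
  apply: mdv_div; first exact: dv_pow2p.
  apply: mdv_mul; first exact: mdv_target.
  by apply: mdv_adj; apply: mdv_entry; exact: dv_snd h0.
apply: mdv_scl; last exact: mdv_cst.
by apply: dv_sub; [exact: dv_int | exact: dv_pow2p].
Qed.

Lemma mdv_coef j E : mdv MRes E -> mdv (MCoef j) (zcoef h j E).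
Proof.
move=> hE; apply: mdv_div; first exact: dv_int.
have hK : mdv (MAdd MRes (MScl (EInt (-1)) (MAdj MRes))) (zadd E (zscl (-1) (zadj E))).
  by apply: mdv_add => //; apply: mdv_scl; [exact: dv_int | exact: mdv_adj].
apply: mdv_scl.
  by apply: dv_sub; [exact: dv_int | exact: dv_pow2 h_le_p dv_half].
apply: mdv_add; first by apply: mdv_mul => //; exact: mdv_cst.
by apply: mdv_scl; [exact: dv_int | apply: mdv_mul => //; exact: mdv_cst].
Qed.

Lemma mdv_near X A : mdv X A -> mdv (MNear X) (znear p A).
Proof.
move=> hX; apply: mdv_add.
  by apply: mdv_add => //; apply: mdv_scl; [exact: dv_pow2p | exact: mdv_cst].
apply: mdv_div; last exact: mdv_mul.
by apply: dv_mul; [exact: dv_int | exact: dv_pow2p].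
Qed.

Lemma mdv_input x (t0 : wtree n) (A0 : zmx d) : dv (ERec MTarget) (wval t0 A0) ->
  mdv (MInput x) (zinput p h (zres p Uz A0) x).
Proof.
move=> h0; case: x => -[j b] s; apply: mdv_near.
have hX : mdv (if b then MCoef j else MScl (EPow2 (EPrec -' EHalf)) (MCst (lie_gen j)))
   (if b then zcoef h j (zres p Uz A0) else zscl (2 ^ (p - h))%:Z (lie_gen j)).
  case: b; first exact/mdv_coef/(mdv_res h0).
  apply: mdv_scl; last exact: mdv_cst.
  apply: dv_pow2; first exact: leq_subr.
  have -> : (p - h)%N%:Z = arith_fun Defs.Sub p%:Z h%:Z by rewrite /= subzn.
  by apply: dv_arith; [exact: dv_prec | exact: dv_half].
by case: s => //; apply: mdv_scl => //; exact: dv_int.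
Qed.

Hypothesis hG : forall i : 'I_n, presents_at O i.+1 G`_i.
Hypothesis p_T : (p <= T)%N.
Hypothesis p_S2 : (p + 2 <= S)%N.

Definition znet (c : T0) : zmx d :=
  znum p (fun i => zask d O p i.+1) (net c) (fun x : void => match x with end).

Lemma wsubst_void (t : wtree n) s : wsubst t s = t.
Proof. by elim: t => [[]|i|t1 IH1 t2 IH2] //=; rewrite IH1 IH2. Qed.

Lemma dv_net c : dv (ENet c) (wval (net c) (znet c)).
Proof.
rewrite -{1}(wsubst_void (net c) (fun x : void => match x with end)).
by apply: (dv_word hSU) => //; [exact: dv_prec | exact: dv_pow2p].
Qed.

Definition ztest (c : T0) : int := dist_test k p Uz (znet c).

Lemma dv_test c : dv (ETest c) (VInt (ztest c)).
Proof.
have h2k := dv_pow2 kp dv_size.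
apply: dv_sub.
  apply: dv_mul; first exact: dv_int.
  by apply: dv_mul; exact: dv_pow2p.
apply: dv_mul; first exact: dv_mul.
apply: dv_sum => x; pose z := zent Uz x - zent (znet c) x.
have hz : dv (MTarget x -' EEntry (ESnd (ENet c)) x) (VInt z).
  apply: dv_sub; first exact: mdv_target.
  by apply: mdv_entry; exact: dv_snd (dv_net c).
exact: dv_mul.
Qed.

Lemma dv_search (s : seq T0) : (exists2 c, c \in s & 0 < ztest c) ->
  exists2 c, 0 < ztest c & dv (ESearch s) (wval (net c) (znet c)).
Proof.
elim: s => [|c s IH] [c1]; first by rewrite in_nil.
rewrite inE => hc hz; have [h0|h0] := ltP 0 (ztest c).
  exists c => //; apply: (dv_if (v0 := VInt (ztest c))); first exact: dv_test.
  by rewrite /= h0; exact: dv_net.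
case/orP: hc => [/eqP E|hc]; first by rewrite E ltNge h0 in hz.
have [c2 hc2 hd] := IH (ex_intro2 _ _ c1 hc hz); exists c2 => //.
apply: (dv_if (v0 := VInt (ztest c))); first exact: dv_test.
by rewrite /= ltNge h0.
Qed.

End Level.

End Program.

(* Since levels shrink by the factor 3/4, the bound k^a of level k then covers X
   recursive calls. *)
Lemma exists_exponent X : exists a, (X * 3 ^ a <= 4 ^ a)%N.
Proof.
(* Bernoulli's inequality (4/3)^a >= 1 + a / 3, with the denominators cleared. *)
have h a : ((a + 3) * 3 ^ a <= 3 * 4 ^ a)%N.
  by elim: a => // a IH; rewrite !expnS; nia.
exists (3 * X)%N; have := h (3 * X)%N; have : (0 < 3 ^ (3 * X))%N by rewrite expn_gt0.
by move: (3 ^ _)%N (4 ^ _)%N => u v; nia.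
Qed.

Lemma scale_pow X a j k : (X * 3 ^ a <= 4 ^ a)%N -> (4 * j <= 3 * k)%N -> (X * j ^ a <= k ^ a)%N.
Proof.
move=> hX hj; have h : ((4 * j) ^ a <= (3 * k) ^ a)%N by elim: (a) => // b IH; rewrite !expnS leq_mul.
have p4 : (0 < 4 ^ a)%N by rewrite expn_gt0.
rewrite -(leq_pmul2l p4) mulnCA -expnMn (leq_trans (leq_mul (leqnn X) h)) //.
by rewrite expnMn mulnA leq_mul2r hX orbT.
Qed.

(** * Correctness and running time *)

Section Correctness.
Variables (R : realType) (d : nat) (G : seq 'M[R[i]]_d).
Local Notation M := 'M[R[i]]_d.
Local Notation n := (size G).
Local Notation D := ((d ^ 2)%:R : R).
Hypothesis d_gt0 : (0 < d)%N.
Hypothesis hSU : forall A, A \in G -> in_SU A.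
Variable kw : 'I_d * 'I_d -> 'I_n.
Variables (T0 : finType) (net : T0 -> wtree n) (k0 q c0 : nat).
Local Notation P := (sk_program d_gt0 kw net k0 q c0).
Local Notation F := (step_form d_gt0 kw).
Local Notation body := (sk_body d_gt0 kw net k0).

Variables (C2 : R) (cn cD al L0 : nat).
Hypothesis hC2 : 4 * D + 2 <= C2.
Hypothesis hk0 : (30 <= k0)%N.
Hypothesis hrefine : forall k p (U U' : M) Uz Mz, (k0 < k)%N ->
  D * 2 * 2 ^- p <= 2 ^- (2 * k) -> (k <= p)%N ->
  let h := (3 * k %/ 8)%N in let E := zres p Uz Mz in
  in_SU U -> in_SU U' -> mxn (appr R p Uz - U) <= 2 ^- k ->
  mxn (U' - U) <= C2 * 2 ^- (2 * h) -> mxn (appr R p Mz - U') <= 2 ^- k ->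
  exists tgt : lie_idx d * bool * bool -> M,
    (forall x, in_SU (tgt x) /\ mxn (appr R p (zinput p h E x) - tgt x) <= 2 ^- (2 * h)) /\
    forall r : step_var d -> M, r None = U' -> (forall x, in_SU (r (Some x))) ->
      (forall x, mxn (r (Some x) - tgt x) <= C2 * 2 ^- (2 * h)) ->
      mxn (fmx F r - U) <= C2 * 2 ^- k.
Hypothesis hnet : forall U, in_SU U -> exists c, mxn (tmx (net c) - U) <= 2 ^- k0.
Hypothesis hcn : D * 2 <= 2 ^+ cn.
Hypothesis hcnF : forall p (gz : 'I_n -> zmx d) (s : step_var d -> M) r (e : R),
  (forall k : 'I_n, mxn (appr R p (gz k) - G`_k) <= e) ->
  (forall x, in_SU (s x)) -> (forall x, mxn (appr R p (r x) - s x) <= e) ->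
  D * 2 * 2 ^- p <= e -> e <= 1 -> mxn (appr R p (znum p gz F r) - fmx F s) <= 2 ^+ cn * e.
Hypothesis hcnT : forall c O p, (forall i : 'I_n, presents_at O i.+1 G`_i) -> (cn <= p)%N ->
  mxn (appr R p (znet net O p c) - tmx (net c)) <= 2 ^+ cn * 2 ^- p.
Hypothesis hcD : D + 1 <= 2 ^+ cD.
Hypothesis hal : (2 * (ecost body + leaves F) * 3 ^ al <= 4 ^ al)%N.
Hypothesis hL0 : forall c, (leaves (net c) <= L0)%N.

(** The margin above p covers the size 2^cD of matrices near SU(d), the gate indices and the slack
    of rounding. *)
Definition sk_bits p := (p + (cD + n + 3))%N.
Definition sk_unit p := (sk_bits p ^ 2 + pow2_time p)%N.
(** Half of this pays for the work of the call itself, the other half for its recursive calls, by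
    the choice of [al]. *)
Definition sk_time p k := (2 * ecost body * sk_unit p * k ^ al)%N.

Lemma zvalue_bits p (A : zmx d) (U : M) : in_SU U -> mxn (appr R p A - U) <= 1 ->
  vbits (sk_bits p) (zvalue A).
Proof.
move=> hU hA; rewrite /zvalue /fval.
have hN : mxn (appr R p A) <= 2 ^+ cD.
  apply: le_trans hcD; rewrite -[appr R p A](subrK U) addrC (le_trans (mxnD _ _)) // lerD //.
  exact: mxn_SU.
elim: (enum _) => [|x s IH] /=; first by rewrite /sk_bits addnA addn3.
by rewrite IH andbT (leq_trans (appr_bits x hN)) // /sk_bits; lia.
Qed.

Variable O : oracle.
Hypothesis hG : forall i : 'I_n, presents_at O i.+1 G`_i.

(** A is compared with the matrix of the returned word, not with U. Each level multiplies this
    numerical error by at most 2^cn, and there are at most k levels since they strictly decrease. *)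
Definition sk_result p k (Uz : zmx d) (U : M) (t : wtree n) (A : zmx d) (c : nat) :=
  [/\ Defs.eval P O [:: sk_arg p k Uz] body (wval t A) c,
      (c <= sk_time p k)%N, (leaves t <= L0 * k ^ al)%N,
      mxn (appr R p A - tmx t) <= 2 ^+ (cn * k) * 2 ^- p &
      mxn (tmx t - U) <= C2 * 2 ^- k].

Let p2 m : 0 < 2 ^+ m :> R. Proof. by rewrite exprn_gt0. Qed.
Let pow_le a b : (a <= b)%N -> 2 ^+ a <= 2 ^+ b :> R.
Proof. by move=> ab; rewrite ler_weXn2l // ler1n. Qed.
Let inv_le a b : (a <= b)%N -> 2 ^- b <= 2 ^- a :> R.
Proof. by move=> ab; rewrite lef_pV2 ?posrE ?pow_le. Qed.
Let mul_inv_le a b c : (a + c <= b)%N -> 2 ^+ a * 2 ^- b <= 2 ^- c :> R.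
Proof.
by move=> h; rewrite ler_pdivrMr // mulrC ler_pdivlMr // -exprD pow_le.
Qed.

Lemma sk_correct p k (U : M) Uz : (0 < k)%N -> ((cn + 4) * k <= p)%N -> in_SU U ->
  mxn (appr R p Uz - U) <= 2 ^- k -> exists t A c, sk_result p k Uz U t A c.
Proof.
elim/ltn_ind: k U Uz => k IH U Uz k_gt0 hp hU hUz.
have kp : (k <= p)%N by apply: leq_trans hp; rewrite leq_pmull // addnS.
have k1 a : 2 ^- a <= 1 :> R by rewrite invf_le1 // exprn_ege1 // ler1n.
have hcnp : (cn + 2 * k <= p)%N by nia.
have hDp : D * 2 * 2 ^- p <= 2 ^- (2 * k).
  by apply: le_trans (mul_inv_le hcnp); rewrite ler_wpM2r // invr_ge0 ltW.
have argb : all (vbits (sk_bits p)) [:: sk_arg p k Uz].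
  rewrite /= andbT (zvalue_bits hU (le_trans hUz (k1 _))) andbT.
  by rewrite !(leq_trans (bits_nat _)) // /sk_bits; lia.
have Sp : (p < sk_bits p)%N by rewrite /sk_bits; lia.
have Sp2 : (p + 2 <= sk_bits p)%N by rewrite /sk_bits; lia.
have Sn : (n < sk_bits p)%N by rewrite /sk_bits; lia.
have S0 : (0 < sk_bits p)%N by rewrite (leq_trans _ Sp).
have Tpp : (p <= pow2_time p)%N by rewrite /pow2_time -mulnn; nia.
have [kk0|kk0] := leqP k k0.
  have [c1 hc1] := hnet hU.
  have znet_err c : mxn (appr R p (znet net O p c) - tmx (net c)) <= 2 ^+ (cn * k) * 2 ^- p.
    apply: le_trans (hcnT _ hG _) _; first by lia.
    by rewrite ler_wpM2r ?invr_ge0 ?(ltW (p2 _)) // pow_le // leq_pmulr.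
  have kn : (cn * k + k <= p)%N by nia.
  have [c hcz hcd] : exists2 c, 0 < ztest net O k p Uz c &
      dv P O (pow2_time p) (sk_bits p) [:: sk_arg p k Uz] (ESearch net (enum T0))
        (wval (net c) (znet net O p c)).
    apply: dv_search => //; exists c1; first by rewrite mem_enum.
    apply: (@dist_test_pos R); apply: le_trans (mxn_tri U _ _) _.
    have -> : 3 / 2 ^+ k = 2 ^- k + (2 ^- k + 2 ^- k) :> R by field; rewrite lt0r_neq0.
    rewrite lerD // (le_trans (mxn_tri (tmx (net c1)) _ _)) // lerD //.
      by rewrite mxn_dist (le_trans hc1) // inv_le.
    by rewrite mxn_dist (le_trans (znet_err c1)) // mul_inv_le.
  have hdv : dv P O (pow2_time p) (sk_bits p) [:: sk_arg p k Uz] body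
      (wval (net c) (znet net O p c)).
    apply: dv_if; first by apply: dv_sub; [exact: dv_size | exact: dv_int].
    by rewrite /= subr_gt0 ltz_nat ltnNge kk0.
  have [tm he [ht _]] := dv_eval S0 (leqnn _) argb hdv.
  exists (net c), (znet net O p c), tm; split=> //.
  - apply: leq_trans ht _; rewrite /sk_time -/(sk_unit p).
    have ka : (0 < k ^ al)%N by rewrite expn_gt0 k_gt0.
    by move: (k ^ al)%N ka => u; nia.
  - by rewrite (leq_trans (hL0 c)) // leq_pmulr // expn_gt0 k_gt0.
  have hdt : mxn (appr R p Uz - appr R p (znet net O p c)) <= D * (4 / 2 ^+ k).
    exact: (@dist_test_le R d k p _ _ hcz).
  apply: le_trans (mxn_tri (appr R p (znet net O p c)) _ _) _.
  apply: (@le_trans _ _ (2 ^- k + (D * (4 / 2 ^+ k) + 2 ^- k))).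
    rewrite lerD //; first by rewrite mxn_dist (le_trans (znet_err c)) // mul_inv_le.
    apply: le_trans (mxn_tri (appr R p Uz) _ _) _.
    by apply: lerD; [rewrite mxn_dist; exact: hdt | exact: hUz].
  have -> : 2 ^- k + (D * (4 / 2 ^+ k) + 2 ^- k) = (4 * D + 2) * 2 ^- k :> R.
    by field; rewrite lt0r_neq0.
  by rewrite ler_wpM2r // invr_ge0 ltW.
pose h := (3 * k %/ 8)%N.
have [h0 hk h34] : [/\ (0 < 2 * h)%N, (2 * h < k)%N & (4 * (2 * h) <= 3 * k)%N].
  have := divn_eq (3 * k) 8; have := ltn_pmod (3 * k) (isT : 0 < 8)%N.
  by rewrite -/h; split; lia.
have hpj : ((cn + 4) * (2 * h) <= p)%N.
  by apply: leq_trans hp; rewrite leq_mul2l (ltnW hk) orbT.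
have k2h : 2 ^- k <= 2 ^- (2 * h) :> R by rewrite inv_le // ltnW.
have [t0 [A0 [c1 [ev0 cl0 l0 num0 cor0]]]] := IH _ hk U Uz h0 hpj hU (le_trans hUz k2h).
have hU' := tmx_SU hSU t0.
(* Although the word is only of level 2 h, its matrix is known to within 2^-k, as the residue
   requires. *)
have numk : 2 ^+ (cn * (2 * h)) * 2 ^- p <= 2 ^- k :> R.
  by apply: mul_inv_le; move: hp hk; clear; nia.
have [tgt [htgt href]] :=
  @hrefine k p U (tmx t0) Uz A0 kk0 hDp kp hU hU' hUz cor0 (le_trans num0 numk).
(* The computed inputs are within 2^-(2 h) of their targets, as the induction hypothesis at level 2
   h demands. *)
have /choice[f hf] : forall x, exists w : wtree n * zmx d * nat,
    sk_result p (2 * h) (zinput p h (zres p Uz A0) x) (tgt x) w.1.1 w.1.2 w.2.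
  move=> x; have [hS hN] := htgt x.
  by have [t [A [c hc]]] := IH _ hk (tgt x) _ h0 hpj hS hN; exists (t, A, c).
pose s (x : step_var d) : wtree n := if x is Some x then (f x).1.1 else t0.
pose r (x : step_var d) : zmx d := if x is Some x then (f x).1.2 else A0.
have rs x : mxn (appr R p (r x) - tmx (s x)) <= 2 ^+ (cn * (2 * h)) * 2 ^- p.
  by case: x => [x|//]; have [] := hf x.
have ls x : (leaves (s x) <= L0 * (2 * h) ^ al)%N.
  by case: x => [x|//]; have [] := hf x.
have bs x : vbits (sk_bits p) (wval (s x) (r x)).
  apply/andP; split; first exact: tval_bits.
  apply: (zvalue_bits (tmx_SU hSU (s x))).
  by rewrite (le_trans (rs x)) // (le_trans numk).
pose T := (pow2_time p + sk_time p (2 * h))%N.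
have T1 : (pow2_time p <= T)%N by exact: leq_addr.
have T2 c : (c <= sk_time p (2 * h) -> c <= T)%N.
  by move/leq_trans; apply; exact: leq_addl.
have pT : (p <= T)%N by exact: leq_trans T1.
have dvM : dv P O T (sk_bits p) [:: sk_arg p k Uz] (ERec (@MTarget d)) (wval t0 A0).
  apply: (@dv_rec _ _ _ _ _ _ _ _ _ _ _ _ _ k p h Uz erefl _ Uz _ _ c1) => //.
  - exact: mdv_target.
  - exact: T2.
  - exact: (bs None).
have dvV x : dv P O T (sk_bits p) [:: sk_arg p k Uz] (EStepVar x) (wval (s x) (r x)).
  case: x => [x|//]; have [evx clx _ _ _] := hf x.
  apply: (@dv_rec _ _ _ _ _ _ _ _ _ _ _ _ _ k p h Uz erefl _ _ _ _ _ _ evx) => //.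
  - by apply: mdv_input => //; exact: dvM.
  - exact: T2.
  - exact: (bs (Some x)).
pose A := znum p (fun i => zask d O p i.+1) F r.
have hdv : dv P O T (sk_bits p) [:: sk_arg p k Uz] body (wval (wsubst F s) A).
  apply: (@dv_if _ _ _ _ _ _ _ _ (VInt (k%:Z - k0%:Z))).
    by apply: dv_sub; [exact: dv_size | exact: dv_int].
  rewrite /= subr_gt0 ltz_nat kk0.
  by apply: (dv_word hSU) => //; [exact: dv_prec | exact: dv_pow2p].
have [tm he [ht _]] := dv_eval S0 (leqnn _) argb hdv.
have D0 : 0 <= D by [].
have numA : mxn (appr R p A - tmx (wsubst F s)) <= 2 ^+ (cn * k) * 2 ^- p.
  rewrite tmx_subst.
  have ge : D * 2 * 2 ^- p <= 2 ^+ (cn * (2 * h)) * 2 ^- p.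
    rewrite ler_wpM2r ?invr_ge0 ?(ltW (p2 _)) // (le_trans hcn) // pow_le //.
    by rewrite leq_pmulr.
  have hg (i : 'I_n) : mxn (appr R p (zask d O p i.+1) - G`_i) <= 2 ^+ (cn * (2 * h)) * 2 ^- p.
    exact: le_trans (appr_ask p (hG i)) ge.
  have hs x : in_SU (tmx (s x)) by exact: tmx_SU.
  apply: le_trans (hcnF hg hs rs ge (le_trans numk (k1 _))) _.
  rewrite mulrA -exprD ler_wpM2r ?invr_ge0 ?(ltW (p2 _)) // pow_le //.
  by move: hk; clear; nia.
exists (wsubst F s), A, tm; split=> //.
- apply: leq_trans ht _; rewrite /sk_time /T addnA -/(sk_unit p) /sk_time.
  move: (scale_pow hal h34); rewrite mulnDr mulnDl => /(leq_trans (leq_addr _ _)).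
  have : (0 < k ^ al)%N by rewrite expn_gt0 k_gt0.
  by move: (ecost body) (sk_unit p) (k ^ al)%N ((2 * h) ^ al)%N => E u x y; clear; nia.
- have [c _] := hnet hU.
  have L0_gt0 : (0 < L0)%N by apply: leq_trans (hL0 c); exact: leaves_gt0.
  have L0j : (0 < L0 * (2 * h) ^ al)%N by rewrite muln_gt0 expn_gt0 h0 L0_gt0.
  apply: leq_trans (leaves_subst F L0j ls) _.
  rewrite mulnCA leq_mul2l; apply/orP; right; apply: leq_trans (scale_pow hal h34).
  rewrite leq_mul2r; apply/orP; right.
  by rewrite mulnDr (leq_trans _ (leq_addl _ _)) // leq_pmull.
rewrite tmx_subst; apply: href => //= x; first exact: tmx_SU.
by have [] := hf x.
Qed.

Definition top_time m := let p := (q * m)%N in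
  (p + pow2_time p + sk_time p m + flat_const G * (L0 * m ^ al))%N.

Lemma top_correct m (U : M) : (cn + 4 <= q)%N -> (0 < m)%N -> in_SU U -> presents_at O 0 U ->
  exists (t : wtree n) c,
    [/\ Defs.eval P O [:: VInt m%:Z] (top_body d q) (vlist [seq nat_of_ord k | k <- wflat t]) c,
        (c <= ecost (top_body d q) * (sk_bits (q * m) ^ 2 + top_time m))%N,
        (leaves t <= L0 * m ^ al)%N & mxn (tmx t - U) <= C2 * 2 ^- m].
Proof.
move=> hq m0 hU hOU; pose p := (q * m)%N; pose Uz := zask d O p 0.
have hp : ((cn + 4) * m <= p)%N by rewrite leq_mul2r hq orbT.
have hUz : mxn (appr R p Uz - U) <= 2 ^- m.
  apply: le_trans (appr_ask p hOU) _; apply: le_trans (_ : 2 ^+ cn * 2 ^- p <= _).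
    by rewrite ler_wpM2r // invr_ge0 ltW.
  by apply: mul_inv_le; move: hp m0; clear; nia.
have [t [A [c [ev lc lt num cor]]]] := sk_correct m0 hp hU hUz.
have [c' ev' lc'] := @flat_eval _ _ _ d_gt0 kw _ net k0 q c0 O t [::].
rewrite cats0 in ev'; exists t.
have S0 : (0 < sk_bits p)%N by rewrite /sk_bits addnA addn3.
have Sn : (n < sk_bits p)%N by rewrite /sk_bits; lia.
have mp : (m <= p)%N by rewrite leq_pmull // (leq_trans _ hq) // addn4.
have bs (s : seq 'I_n) : vbits (sk_bits p) (vlist [seq nat_of_ord k | k <- s]).
  elim: s => //= k s IH; apply/andP; split=> //.
  by apply: leq_trans (bits_nat _) (leq_ltn_trans _ Sn); exact/ltnW/ltn_ord.
have henv : all (vbits (sk_bits p)) [:: VInt m%:Z].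
  by rewrite /= andbT (leq_trans (bits_nat m)) // /sk_bits; lia.
have bA : vbits (sk_bits p) (wval t A).
  apply/andP; split; first exact: tval_bits.
  apply: (zvalue_bits (tmx_SU hSU t)); apply: le_trans num _.
  by rewrite -[leRHS]invr1 -[in leRHS](expr0 2); apply: mul_inv_le; move: hp; clear; nia.
have pt : (p <= top_time m)%N by rewrite /top_time -!addnA leq_addr.
have ct : (c <= top_time m)%N.
  by apply: leq_trans lc _; rewrite /top_time addnAC leq_addl.
have ct' : (c' <= top_time m)%N.
  apply: leq_trans (leq_trans (leq_addr _ _) lc') _.
  by rewrite (leq_trans _ (leq_addl _ _)) // leq_mul.
have dp : dv P O (top_time m) (sk_bits p) [:: VInt m%:Z]
    (EArith Mul (EInt q%:Z) (EVar 0)) (VInt p%:Z).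
  by rewrite /p PoszM; apply: dv_mul; [exact: dv_int | exact: dv_var].
have hdv : dv P O (top_time m) (sk_bits p) [:: VInt m%:Z] (top_body d q)
    (vlist [seq nat_of_ord k | k <- wflat t]).
  apply: (dv_call (v1 := VPair (tval t) (VInt 0)) (body := flat_body) _ _ ev' ct') => //.
  apply: dv_pair; last exact: dv_int.
  apply: (dv_fst (v2 := zvalue A)).
  apply: (dv_call (v1 := sk_arg p m Uz) (body := body) _ _ ev ct) => //.
  apply: dv_pair; first exact: dv_var.
  apply: dv_pair => //; apply: dv_fun; apply: dv_MAsk hOU hU dp pt _.
  by rewrite /sk_bits; lia.
by have [tm he [ht _]] := dv_eval S0 (leqnn _) henv hdv; exists tm.
Qed.

End Correctness.

(** * Polynomial bounds in the logarithm of 1/eps *)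

Definition poly_bounded (f : nat -> nat) := exists a b, forall m, (f m <= a * m.+1 ^ b)%N.

Lemma poly_bounded_const c : poly_bounded (fun _ => c).
Proof. by exists c, 0%N => m; rewrite muln1. Qed.

Lemma poly_bounded_id : poly_bounded id.
Proof. by exists 1%N, 1%N => m; rewrite mul1n. Qed.

Lemma poly_boundedD f g :
  poly_bounded f -> poly_bounded g -> poly_bounded (fun m => f m + g m)%N.
Proof.
move=> [a [b hf]] [a' [b' hg]]; exists (a + a')%N, (b + b')%N => m.
rewrite mulnDl leq_add // ?(leq_trans (hf m)) ?(leq_trans (hg m)) //.
  by rewrite leq_mul2l leq_pexp2l ?leq_addr ?orbT.
by rewrite leq_mul2l leq_pexp2l ?leq_addl ?orbT.
Qed.

Lemma poly_boundedS f : poly_bounded f -> poly_bounded (fun m => (f m).+1).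
Proof.
move=> hf; have [a [b h]] := poly_boundedD (poly_bounded_const 1) hf.
by exists a, b => m; rewrite -add1n.
Qed.

Lemma poly_boundedM f g :
  poly_bounded f -> poly_bounded g -> poly_bounded (fun m => f m * g m)%N.
Proof.
move=> [a [b hf]] [a' [b' hg]]; exists (a * a')%N, (b + b')%N => m.
by rewrite expnD mulnACA leq_mul.
Qed.

Lemma poly_boundedX f k : poly_bounded f -> poly_bounded (fun m => f m ^ k)%N.
Proof.
move=> hf; elim: k => [|k IH]; first by exists 1%N, 0%N.
have [a [b h]] := poly_boundedM hf IH; exists a, b => m; rewrite expnS; exact: h.
Qed.

(** The argument will be ln (1/eps), which is negative for eps > 1; this is why the scale is
    compared with 1 + x^2 instead of x. *)
Lemma poly_bounded_realize (R : realType) f c : poly_bounded f -> exists q : {poly R},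
  forall m (x : R), m.+1%:R <= c%:R * (1 + x ^+ 2) -> (f m)%:R <= q.[x].
Proof.
move=> [a [b hf]]; exists (a%:R *: (c%:R *: (1 + 'X^2)) ^+ b) => m x hm.
rewrite hornerZ horner_exp hornerZ hornerD hornerXn hornerC.
apply: le_trans (_ : (a * m.+1 ^ b)%:R <= _); first by rewrite ler_nat.
by rewrite natrM natrX ler_wpM2l // lerXn2r // nnegrE ?(le_trans _ hm).
Qed.

Lemma nat_le_ln (R : realType) m (y : R) : 2 ^+ m <= expR y -> m%:R <= 2 * y.
Proof.
have h2 : expR (2^-1) <= 2 :> R.
  have h := expR_ge1Dx (- 2^-1 : R); have e0 := expR_gt0 (2^-1 : R).
  rewrite expRN in h; rewrite -[2 in leRHS]invrK -[leLHS]invrK lef_pV2 ?posrE ?invr_gt0 //.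
  by lra.
move=> h; have : expR (m%:R * 2^-1) <= expR y.
  by rewrite expRM_natl (le_trans _ h) // lerXn2r // nnegrE // expR_ge0.
by rewrite ler_expR; lra.
Qed.

(** The least precision with an answer above 1. If it is positive, minimality gives eps 2^(n0 - 1)
    <= 2, so it is logarithmic in 1/eps. For large eps the very first answer may be long, hence the
    separate bound on its bits. *)
Lemma exists_scale (R : realType) (O : oracle) (eps : R) : 0 < eps ->
  approximates O (VInt 0) eps -> exists n0,
  [/\ 1 < O (VInt 0) n0,
      forall i, (i < n0)%N -> O (VInt 0) i <= 1 /\ (bits (O (VInt 0) i) <= 1)%N,
      2 ^- n0 <= eps, n0.+1%:R <= 10%:R * (1 + ln (eps^-1) ^+ 2) &
      (bits (O (VInt 0) n0))%:R <= 10%:R * (1 + ln (eps^-1) ^+ 2)].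
Proof.
move=> e0 hO; pose o := O (VInt 0); pose x := ln (eps^-1).
have p2 m : 0 < 2 ^+ m :> R by rewrite exprn_gt0.
have hup i : (o i)%:~R <= eps * 2 ^+ i + 1.
  have := hO i; rewrite distrC ler_norml => /andP[_]; rewrite lerBlDr ler_pdivrMr //.
  by rewrite mulrDl mulVf ?lt0r_neq0 // addrC.
have hlo i : eps * 2 ^+ i - 1 <= (o i)%:~R.
  have := hO i; rewrite ler_norml => /andP[_]; rewrite lerBlDr -(ler_pM2r (p2 i)).
  by rewrite mulrDl mulVf ?lt0r_neq0 // divfK ?lt0r_neq0 // => h; lra.
have ex : exists i, 1 < o i.
  have [i hi] := pow2_dom (3 / eps); exists i; rewrite -(ltr_int R).
  apply: lt_le_trans (hlo i); rewrite ler_pdivrMr // in hi; rewrite mulrC; lra.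
case: (ex_minnP ex) => n0 hn0 hmin; exists n0.
have hlt i : (i < n0)%N -> o i <= 1 by move=> h; rewrite leNgt; apply/negP => /hmin; lia.
have xE : eps = expR (- x) by rewrite expRN lnK ?invrK // posrE invr_gt0.
have absx : `|x| <= (1 + x ^+ 2) / 2.
  by rewrite -real_normK ?num_real //; have := sqr_ge0 (`|x| - 1); rewrite sqrrB; lra.
have hx0 := normr_ge0 x; have x2 := sqr_ge0 x.
have he : expR (- x) <= expR `|x| by rewrite ler_expR -normrN ler_norm.
have he1 : 1 <= expR `|x| by rewrite -expR0 ler_expR.
(* The factor e^4 absorbs the 4 of the next bound together with a rounding by 1; the 10 of the
   statement then follows from 9 + 2 |x| <= 10 + x^2. *)
have he4 : 5 <= expR 4 :> R by have := expR_ge1Dx (4 : R); lra.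
have hsmall : eps * 2 ^+ n0 <= 4 * expR `|x|.
  case: n0 hlt {hmin hn0} => [|n1] hlt; first by rewrite expr0 mulr1 xE; lra.
  have h1 : ((o n1)%:~R : R) <= 1 by rewrite (ler_int R _ 1) hlt.
  by have := hlo n1; rewrite exprS; lra.
split=> //.
- move=> i hi; have h1 := hlt i hi; split=> //.
  have h0 : 0 <= o i.
    suff : -1 < o i by lia.
    rewrite -(ltr_int R) (lt_le_trans _ (hlo i)) //.
    by have := mulr_gt0 e0 (p2 i); rewrite -[(-1)%:~R]/(-1); lra.
  by move: h0 h1; rewrite /o /bits; case: (O _ _) => [[|[|]]|].
- have h : (2 : R) <= (o n0)%:~R by rewrite (ler_int R 2); lia.
  rewrite -[leLHS]mul1r ler_pdivrMr //; have := hup n0; lra.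
- have h : n0%:R <= 2 * (4 + `|x|).
    apply: nat_le_ln; rewrite expRD; case: n0 hlt {hmin hn0 hsmall} => [|n1] hlt.
      by rewrite expr0; nra.
    have h1 : ((o n1)%:~R : R) <= 1 by rewrite (ler_int R _ 1) hlt.
    have h2 : 2 ^+ n1.+1 <= 4 * expR x.
      rewrite -[expR x]invrK -expRN -xE ler_pdivlMr // mulrC.
      by have := hlo n1; rewrite exprS; lra.
    have h3 : expR x <= expR `|x| by rewrite ler_expR ler_norm.
    by nra.
  by rewrite -natr1 -/x; lra.
have h : ((bits (o n0)).-1)%:R <= 2 * (4 + `|x|).
  apply: nat_le_ln; rewrite expRD /bits /= -natrX.
  apply: le_trans (_ : `|o n0|%N%:R <= _).
    by rewrite ler_nat trunc_logP //; lia.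
  rewrite -[X in X <= _]/((`|o n0|%N%:Z)%:~R) gez0_abs; last lia.
  by apply: le_trans (hup n0) _; nra.
by rewrite -/o -/x; move: h; rewrite /bits /= -natr1; lra.
Qed.

Section Compiler.
Variables (R : realType) (d : nat) (d_gt0 : (0 < d)%N) (G : seq 'M[R[i]]_d).
Local Notation M := 'M[R[i]]_d.
Local Notation D := ((d ^ 2)%:R : R).
Hypothesis hSU : forall A, A \in G -> in_SU A.

(** The net is finite, so the sum of the constants of its words bounds each of them. *)
Lemma net_err (T0 : finType) (net : T0 -> wtree (size G)) : exists cn : nat,
  forall c O p, (forall i : 'I_(size G), presents_at O i.+1 G`_i) -> D * 2 <= 2 ^+ p ->
  mxn (appr R p (znet net O p c) - tmx (net c)) <= 2 ^+ cn * 2 ^- p.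
Proof.
have /choice[C hC] : forall c, exists C : R, 0 <= C /\
    forall O p, (forall i : 'I_(size G), presents_at O i.+1 G`_i) -> D * 2 <= 2 ^+ p ->
    mxn (appr R p (znet net O p c) - tmx (net c)) <= C * (D * 2 * 2 ^- p).
  move=> c; have [C C0 h] := znum_err hSU (net c); exists C; split=> // O p hG hp.
  apply: h => //; first by move=> k; exact: appr_ask.
  by rewrite ler_pdivrMr ?exprn_gt0 // mul1r.
have D0 : 0 <= D * 2 by rewrite mulr_ge0.
have [cn hcn] := pow2_dom (\sum_c C c * (D * 2)); exists cn => c O p hG hp.
apply: le_trans (proj2 (hC c) O p hG hp) _.
rewrite mulrA ler_wpM2r ?invr_ge0 ?exprn_ge0 // (le_trans _ hcn) // (bigD1 c) //= lerDl.
by apply: sumr_ge0 => c' _; rewrite mulr_ge0 // (proj1 (hC c')).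
Qed.

End Compiler.

Theorem theorem3 (R : realType) (d : nat) (hd : (0 < d)%N)
    (G : seq 'M[R[i]]_d) (hG : universal G) (hW : contains_weyl G) :
  exists (A : program) (len time : {poly R}),
    forall (eps : R) (U : 'M[R[i]]_d), 0 < eps -> in_SU U ->
    forall O : oracle, presents G O eps U ->
    exists (L t : nat) (w : seq 'I_(size G)),
      [/\ size w = L.+1,
          runs A O (vlist [seq nat_of_ord k | k <- w]) t,
          L%:R <= len.[ln (eps^-1)],
          t%:R <= time.[ln (eps^-1)] &
          opnorm (word_mx w - U) <= eps].
Proof.
have hSU := proj1 hG; have [kw [kw_twirl kw_center kw_period]] := weyl_gates hd hG hW.
have [C2 hC2 [k1 hrefine]] := refine_level hSU kw_twirl kw_center kw_period.
pose k0 := maxn k1 30.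
have k030 : (30 <= k0)%N by exact: leq_maxr.
have pow_le a b : (a <= b)%N -> 2 ^+ a <= 2 ^+ b :> R.
  by move=> ab; rewrite ler_weXn2l // ler1n.
have p2 m : 0 < 2 ^+ m :> R by rewrite exprn_gt0.
have [T0 [net hnet]] : exists (T : finType) (net : T -> wtree (size G)),
    forall U : 'M[R[i]]_d, in_SU U -> exists c, mxn (tmx (net c) - U) <= 2 ^- k0.
  apply: (@SU_net R d G hG (kw (ord2_0 hd))); last by rewrite invr_gt0.
  exists (2 * d ^ 2).-1; rewrite prednK; first exact: kw_period.
  by rewrite muln_gt0 expn_gt0 hd.
have [CF _ hF] := znum_err hSU (step_form hd kw).
have [c1 hc1] := pow2_dom ((d ^ 2)%:R * 2 : R); have [c2 hc2] := pow2_dom CF.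
have [c3 hc3] := net_err hSU net; pose cn := (c1 + c2 + c3)%N.
have [cD hcD] := pow2_dom ((d ^ 2)%:R + 1 : R).
have [al hal] := exists_exponent
  (2 * (ecost (sk_body hd kw net k0) + leaves (step_form hd kw))).
pose L0 := (\sum_c leaves (net c))%N.
have hL0 c : (leaves (net c) <= L0)%N by rewrite /L0 (bigD1 c) //= leq_addr.
(* With C2 <= 2^c0 the final error C2 2^-(n0 + c0) is at most 2^-n0; the successor keeps the level
   positive when n0 = 0. *)
have [c4 hc4] := pow2_dom C2; pose c0 := c4.+1; pose q := (cn + 4)%N.
have hrefine' k p (U U' : 'M[R[i]]_d) Uz Mz : (k0 < k)%N -> _ :=
  fun h => hrefine k p U U' Uz Mz (leq_ltn_trans (leq_maxl _ _) h).
have hcn : (d ^ 2)%:R * 2 <= 2 ^+ cn :> R.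
  by rewrite (le_trans hc1) // pow_le // /cn -addnA leq_addr.
have hcnF p (gz : 'I_(size G) -> zmx d) (s : step_var d -> 'M[R[i]]_d) r (e : R) :
    (forall k : 'I_(size G), mxn (appr R p (gz k) - G`_k) <= e) ->
    (forall x, in_SU (s x)) -> (forall x, mxn (appr R p (r x) - s x) <= e) ->
    (d ^ 2)%:R * 2 * 2 ^- p <= e -> e <= 1 ->
    mxn (appr R p (znum p gz (step_form hd kw) r) - fmx (step_form hd kw) s) <= 2 ^+ cn * e.
  move=> h1 h2 h3 h4 h5; have e0 : 0 <= e.
    by apply: le_trans h4; rewrite !mulr_ge0 ?invr_ge0 // ltW.
  apply: le_trans (hF p gz s r e h1 h2 h3 h4 h5) _; rewrite ler_wpM2r // (le_trans hc2) //.
  by rewrite pow_le // /cn addnAC leq_addl.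
have hcnT c O p : (forall i : 'I_(size G), presents_at O i.+1 G`_i) -> (cn <= p)%N ->
    mxn (appr R p (znet net O p c) - tmx (net c)) <= 2 ^+ cn * 2 ^- p.
  move=> hO hp; apply: le_trans (hc3 c O p hO (le_trans hcn (pow_le _ _ hp))) _.
  by rewrite ler_wpM2r ?invr_ge0 ?(ltW (p2 _)) // pow_le // leq_addl.
have top O hO m U := @top_correct R d G hd hSU kw T0 net k0 q c0 C2 cn cD al L0 hC2 k030
  hrefine' hnet hcn hcnF hcnT hcD hal hL0 O hO m U (leqnn _).
pose T1 n0 := (ecost (top_body d q) *
  (sk_bits G cD (q * (n0 + c0)) ^ 2 + top_time hd kw net k0 q cD al L0 (n0 + c0)))%N.
pose T n0 := (n0.+1 * (2 * n0 + 20 + bits c0%:Z) + 5 + T1 n0)%N.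
pose L1 n0 := (L0 * (n0 + c0) ^ al)%N.
have bL : poly_bounded L1.
  apply: poly_boundedM (poly_bounded_const L0) (poly_boundedX _ _).
  exact: poly_boundedD poly_bounded_id (poly_bounded_const _).
have bT : poly_bounded T.
  rewrite /T /T1 /top_time /sk_time /sk_unit /sk_bits /pow2_time.
  move: (ecost _) (ecost _) (bits _) (flat_const _) (size _) => e1 e2 b w n.
  move: (c0) (q) (L0) (cD) (al) => c q1 L cd a; clear.
  repeat lazymatch goal with
    | |- poly_bounded (fun m => m) => exact: poly_bounded_id
    | |- poly_bounded (fun _ => ?c) => exact: poly_bounded_const
    | |- poly_bounded (fun m => (@?f m + @?g m)%N) => refine (@poly_boundedD f g _ _)
    | |- poly_bounded (fun m => (@?f m * @?g m)%N) => refine (@poly_boundedM f g _ _)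
    | |- poly_bounded (fun m => (@?f m ^ _)%N) => refine (@poly_boundedX f _ _)
    | |- poly_bounded (fun m => (@?f m).+1) => refine (@poly_boundedS f _)
    end.
have [len hlen] := poly_bounded_realize R 10 bL.
have [time htime] := poly_bounded_realize R 10 bT.
(* The extra summand pays for the last answer about eps, whose length is not bounded in terms of
   n0. *)
exists (sk_program hd kw net k0 q c0), len, (time + (2 * 10)%:R *: (1 + 'X^2)).
move=> eps U eps0 hU O [hO hpres].
have hOU : presents_at O 0 U by move=> i j; exact: (hpres ord0 i j).
have hOG (i : 'I_(size G)) : presents_at O i.+1 G`_i.
  by move=> a b; exact: (hpres (lift ord0 i) a b).
have [n0 [hn0 hlt hn0e hn0x hbx]] := exists_scale eps0 hO.
have m0 : (0 < n0 + c0)%N by rewrite /c0 addnS.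
have [t [c [ev lc lt cor]]] := top O hOG (n0 + c0)%N U m0 hU hOU.
have [cf evf lcf] := @find_eval R d G hd kw T0 net k0 q c0 O n0 0 (leq0n _) hn0
  (fun i h => proj1 (hlt i h)) (fun i h => proj2 (hlt i h)).
set P := sk_program _ _ _ _ _ _ in evf.
have e1 := @ev_call P O [::] 3 _ (find_body) _ _ _ _ (ev_int P O [::] 0) erefl evf.
have e2 := ev_arith Add e1 (ev_int P O [::] c0%:Z).
have E : arith_fun Add n0%:Z c0%:Z = (n0 + c0)%N%:Z by rewrite /= PoszD.
rewrite E in e2; have e3 := @ev_call P O [::] 4 _ (top_body d q) _ _ _ _ e2 erefl ev.
have t_gt0 := leaves_gt0 t; exists (leaves t).-1; eexists; exists (wflat t); split.
- by rewrite size_wflat prednK.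
- exact: e3.
- apply: le_trans (hlen _ _ hn0x); rewrite ler_nat (leq_trans (leq_pred _)) //.
- rewrite hornerD hornerZ hornerD hornerXn hornerC.
  apply: le_trans (_ : (T n0 + 2 * bits (O (VInt 0) n0))%N%:R <= _).
    rewrite ler_nat; have := bits_nat n0; move: lc lcf; rewrite subn0 /T -/(T1 n0).
    by move: (T1 n0) (bits c0%:Z) (bits n0%:Z) (bits (O _ _)) => u v w z; clear; nia.
  rewrite natrD lerD ?htime // !natrM -mulrA ler_wpM2l //.
rewrite word_mx_flat (le_trans (opnorm_le _)) // (le_trans cor) // (le_trans _ hn0e) //.
rewrite exprD invfM mulrCA ler_piMr ?invr_ge0 ?(ltW (p2 _)) //.
by rewrite ler_pdivrMr // mul1r (le_trans hc4) // pow_le.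
Qed.
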